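(* For every $c\in(0,1]$ and every function $f\in L^1(\mathbb{T})$ we have $$\frac{1}{2\pi}\left|\left\{\xi\in\mathbb{T} : \mathcal{H}^{\mathbb{T}}f(\xi)\geq 1\right\}\right| \leq c\,\|f\|_1 + 1-\frac{2}{\pi}\arcsin(c)-\frac{2c}{\pi}\ln\left(\frac1c+\sqrt{\frac1{c^2}-1}\right).$$ For every $c\in(0,1]$ the additive constant $D(c)=1-\frac{2}{\pi}\arcsin(c)-\frac{2c}{\pi}\ln\left(\frac1c+\sqrt{\frac1{c^2}-1}\right)$ on the right-hand side is optimal, i.e. for every real $K<D(c)$ there exists $f\in L^1(\mathbb{T})$ such that $\frac{1}{2\pi}|\{\xi\in\mathbb{T}:\mathcal{H}^{\mathbb{T}}f(\xi)\geq 1\}|>c\|f\|_1+K$.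
   Context: $\mathbb{T}$ is the unit circle in $\mathbb{C}$, $|A|$ denotes the arc-length measure of $A\subset\mathbb{T}$ (so $|\mathbb{T}|=2\pi$). Functions are real-valued, and $\|f\|_p$ is the $L^p$-norm with respect to the normalized Haar measure on $\mathbb{T}$, i.e. $\|f\|_p^p=\frac1{2\pi}\int_{-\pi}^{\pi}|f(e^{is})|^p\,ds$. The Hilbert transform on the circle is the singular integral (defined for almost every $t$) $$\mathcal{H}^{\mathbb{T}}f(e^{it})=\frac1{2\pi}\,\mathrm{p.v.}\int_{-\pi}^{\pi}f(e^{is})\cot\frac{t-s}{2}\,ds,\qquad f\in L^1(\mathbb{T}).$$ *)

(* Defs.v *)
From HB Require Import structures.
From mathcomp Require Import all_boot all_order all_algebra.
From mathcomp Require Import all_classical all_reals all_analysis.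
From mathcomp Require Import complex.

Set Implicit Arguments.
Unset Strict Implicit.
Unset Printing Implicit Defensive.

Import Order.TTheory GRing.Theory Num.Theory.
Import numFieldNormedType.Exports.
Import ComplexField.Normc.

Local Open Scope classical_set_scope.
Local Open Scope ring_scope.
Local Open Scope complex_scope.

Definition circle (R : realType) : Type := {z : R[i] | normc z == 1}.

Lemma normc_cis (R : realType) (t : R) : normc (cos t +i* sin t) == 1.
Proof. by rewrite /normc cos2Dsin2 sqrtr1. Qed.

Definition cis (R : realType) (t : R) : circle R :=
  exist _ (cos t +i* sin t) (normc_cis t).

Definition chord (R : realType) (z w : circle R) : R := normc (sval z - sval w).

Definition cot (R : realType) (x : R) : R := cos x / sin x.

(* The angle runs over ]-pi, pi], where [cis] is a bijection onto the circle.
   [lebesgue_measure] is total: on a non-measurable set it is the outer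
   measure. *)
Definition arc_length (R : realType) (A : set (circle R)) : \bar R :=
  lebesgue_measure [set t : R | t \in `]-pi, pi] /\ A (cis t)].

(* Measurability is with respect to the Borel sets of [R]; every class in
   L^1 has such a representative. *)
Definition inL1 (R : realType) (f : circle R -> R) : Prop :=
  (@lebesgue_measure R).-integrable `[-pi, pi] (fun s : R => (f (cis s))%:E).

Definition norm1 (R : realType) (f : circle R -> R) : R :=
  (2 * pi)^-1 * \int[lebesgue_measure]_(s in `[-pi, pi]) `|f (cis s)|.

(* The excised set is the arc of points within chordal distance [eps] of
   e^{it}; it is symmetric about e^{it} for every t, including t = pi, where it
   meets both ends of [-pi, pi]. *)
Definition hilbert_trunc (R : realType) (f : circle R -> R) (t eps : R) : R :=
  (2 * pi)^-1 *
  \int[lebesgue_measure]_(s in [set s : R | s \in `[-pi, pi] /\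
                                            eps < chord (cis t) (cis s)])
     (f (cis s) * cot ((t - s) / 2)).

(* [is_hilbert f xi l]: the principal value defining the Hilbert transform of
   [f] at [xi] exists and equals [l].  The truncated integrals are 2pi-periodic
   in t, so the choice of the angle t of [xi] is immaterial. *)
Definition is_hilbert (R : realType) (f : circle R -> R) (xi : circle R) (l : R)
    : Prop :=
  exists2 t : R, cis t = xi &
    hilbert_trunc f t eps @[eps --> (0 : R)^'+] --> l.

Definition hilbert_ge1 (R : realType) (f : circle R -> R) : set (circle R) :=
  [set xi | exists2 l : R, is_hilbert f xi l & 1 <= l].

Definition D (R : realType) (c : R) : R :=
  1 - 2 / pi * asin c
    - 2 * c / pi * ln (1 / c + Num.sqrt (1 / c ^+ 2 - 1)).

(* Main.v *)
(** Upper bound.  Let u + i v be an analytic polynomial with v(0) = 0, and let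
    x + i y be one with y(0) = 0 and x close to a Poisson mean of
    (pi/2) 1_{v >= 1}, so that x is small where v < 1 - eta.  The inverse
    Gudermannian g + i k of x + i y is analytic, with g >= 0 and |k| <= pi/2,
    and g is small where x is.  The imaginary part g v + k u of
    (g + i k)(u + i v) vanishes at 0, hence has mean 0, so the mean g(0) of g is
    at most about (pi/2) ||u||_1.  But g(0) is a convex function of x(0), which
    is pi/2 times the measure of {v >= 1}, and the tangent to it at arccos c
    gives the inequality.  For general f, a conjugate Poisson integral is an
    average of truncated Hilbert transforms, so it converges to the principal
    value wherever that exists.

    Sharpness.  For c < 1 equality holds for
    f(e^{is}) = - sin(s/2) / sqrt(cos^2(s/2) - c^2) on |s| < 2 arccos c, f = 0
    elsewhere: f(s) cot((t - s)/2) has an explicit primitive whose logarithmic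
    part takes equal values at both ends of the arc and cancels across the
    excised arc, which gives Hf = 1 on |t| < 2 arccos c.  For c = 1 take
    f = 0. *)

Require Import Defs.
From HB Require Import structures.
From mathcomp Require Import all_boot all_order all_algebra.
From mathcomp Require Import all_classical all_reals all_analysis.
From mathcomp Require Import complex measurable_realfun.
From mathcomp Require Import ring lra.

Set Implicit Arguments.
Unset Strict Implicit.
Unset Printing Implicit Defensive.

Import Order.TTheory GRing.Theory Num.Theory.
Import numFieldNormedType.Exports.

Local Open Scope classical_set_scope.
Local Open Scope ring_scope.

(** * Trigonometric polynomials *)

Section TrigPoly.
Variable R : realType.
Implicit Types (a b : nat -> R) (n : nat) (r t : R).

(** The inverse Gudermannian fits because it maps the strip 0 < x < pi/2 conformally onto the half
    strip g > 0, |k| < pi/2: the side x = 0 goes to g = 0 and the side x = pi/2 to |k| = pi/2.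
    Equality in the duality thus asks for v = 1 on a set E, u = 0 off E with the sign of u opposite
    to that of k on E, and x(0) = arccos c, where the tangent touches. If E is an arc, the last
    condition makes it |t| < 2 arccos c. The function u + i v = i (1 - (1 - z) / sqrt((1 + z)^2 - 4
    c^2 z)) vanishes at 0 and has v = 1 on this arc and u = 0 off it; its real part is the extremal
    function.

    Polynomials keep every function smooth beyond the unit circle, so that the mean value property
    is a differentiation in the radius. The price is that truncated Poisson kernels take negative
    values. The tail [ptail] bounds this defect, and x is shifted and rescaled to remain strictly
    between 0 and pi/2. *)

Definition trigpoly n a b r t : R :=
  \sum_(k < n) r ^+ k * (a k * cos (k%:R * t) + b k * sin (k%:R * t)).

(** With complex coefficients a_k - i b_k, [trigpoly] is the real part of the polynomial at r
    e^{it}, and this is its radial derivative. *)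
Definition dtrigpoly n a b r t : R :=
  \sum_(k < n) (k%:R * r ^+ k.-1) *
    (a k * cos (k%:R * t) + b k * sin (k%:R * t)).

Lemma is_derive_pow k r : is_derive r 1 (fun s : R => s ^+ k) (k%:R * r ^+ k.-1).
Proof.
have := @is_deriveX R R id k r 1 1 (is_derive_id _ _).
rewrite /GRing.scale/= mulr1 (_ : id ^+ k = (fun s : R => s ^+ k))//.
by apply/funext => s; rewrite fctE.
Qed.

Lemma is_derive_trigpoly_r n a b r t :
  is_derive r 1 (trigpoly n a b ^~ t) (dtrigpoly n a b r t).
Proof.
rewrite (_ : trigpoly n a b ^~ t = \sum_(k < n)
  (fun r => r ^+ k * (a k * cos (k%:R * t) + b k * sin (k%:R * t)))).
  apply: is_derive_sum => k.
  have D := is_derive_pow k r.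
  by apply: is_derive_eq; rewrite /GRing.scale/=; ring.
by apply/funext => s; rewrite fct_sumE.
Qed.

Lemma is_derive_trigpoly_t n a b r t :
  is_derive t 1 (trigpoly n a b r)
    (trigpoly n (fun k => k%:R * b k) (fun k => - (k%:R * a k)) r t).
Proof.
rewrite (_ : trigpoly n a b r = \sum_(k < n)
  (fun t => r ^+ k * (a k * cos (k%:R * t) + b k * sin (k%:R * t)))).
  apply: is_derive_sum => k.
  have D : is_derive t 1 (fun s : R => k%:R * s) k%:R.
    by apply: is_derive_eq; rewrite /GRing.scale/=; ring.
  have Dc : is_derive t 1 (fun s : R => cos (k%:R * s)) (- sin (k%:R * t) * k%:R).
    exact: is_derive1_comp.
  have Ds : is_derive t 1 (fun s : R => sin (k%:R * s)) (cos (k%:R * t) * k%:R).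
    exact: is_derive1_comp.
  by apply: is_derive_eq; rewrite /GRing.scale/=; ring.
by apply/funext => s; rewrite fct_sumE.
Qed.

(* The harmonic conjugate of [trigpoly n a b] is
   [trigpoly n (fun k => - b k) a]; with it this is the polar form of the
   Cauchy-Riemann equations. *)
Lemma mul_dtrigpoly n a b r t :
  r * dtrigpoly n a b r t =
  trigpoly n (fun k => k%:R * a k) (fun k => k%:R * b k) r t.
Proof.
rewrite mulr_sumr; apply: eq_bigr => -[[|k] _ _] /=.
  by rewrite !mul0r mulr0; ring.
by rewrite exprS; ring.
Qed.

Lemma trigpolyN n a b r t :
  trigpoly n (fun k => - a k) (fun k => - b k) r t = - trigpoly n a b r t.
Proof. by rewrite -sumrN; apply: eq_bigr => k _; ring. Qed.

Lemma cosDn2pi k (t : R) : cos (k%:R * (t + pi *+ 2)) = cos (k%:R * t).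
Proof.
rewrite mulrDr [X in _ + X](_ : _ = pi *+ 2 *+ k); last by rewrite mulr_natl.
by rewrite (periodicn (@cosD2pi R)).
Qed.

Lemma sinDn2pi k (t : R) : sin (k%:R * (t + pi *+ 2)) = sin (k%:R * t).
Proof.
rewrite mulrDr [X in _ + X](_ : _ = pi *+ 2 *+ k); last by rewrite mulr_natl.
by rewrite (periodicn (@sinD2pi R)).
Qed.

Lemma trigpoly_periodic n a b r t :
  trigpoly n a b r (t + pi *+ 2) = trigpoly n a b r t.
Proof. by apply: eq_bigr => k _; rewrite cosDn2pi sinDn2pi. Qed.

Lemma trigpoly0 n a b t : trigpoly n.+1 a b 0 t = a 0%N.
Proof.
rewrite /trigpoly big_ord_recl/= big1 ?addr0 => [|i _].
  by rewrite mul0r cos0 sin0 expr0; ring.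
by rewrite expr0n/= mul0r.
Qed.

Lemma trigpoly_bounded n a b (rho : R) : exists M : R,
  forall r t, `|r| <= rho -> `|trigpoly n a b r t| <= M.
Proof.
exists (\sum_(k < n) rho ^+ k * (`|a k| + `|b k|)) => r t rr.
apply: le_trans (ler_norm_sum _ _ _) _; apply: ler_sum => k _.
rewrite normrM normrX ler_pM ?exprn_ge0//.
  by rewrite lerXn2r ?nnegrE// (le_trans _ rr).
apply: le_trans (ler_normD _ _) _; rewrite !normrM.
by apply: lerD; rewrite ler_piMr// ?cos_max ?sin_max.
Qed.

Lemma dtrigpoly_bounded n a b (rho : R) : exists M : R,
  forall r t, `|r| <= rho -> `|dtrigpoly n a b r t| <= M.
Proof.
exists (\sum_(k < n) k%:R * rho ^+ k.-1 * (`|a k| + `|b k|)) => r t rr.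
apply: le_trans (ler_norm_sum _ _ _) _; apply: ler_sum => k _.
rewrite !normrM normrX normr_nat ler_pM ?mulr_ge0 ?exprn_ge0//.
  by rewrite ler_wpM2l// lerXn2r ?nnegrE// (le_trans _ rr).
apply: le_trans (ler_normD _ _) _; rewrite !normrM.
by apply: lerD; rewrite ler_piMr// ?cos_max ?sin_max.
Qed.

End TrigPoly.

(** * The inverse Gudermannian *)

Section Gudermann.
Variable R : realType.
Implicit Types x y : R.

Definition ch y := (expR y + expR (- y)) / 2.
Definition sh y := (expR y - expR (- y)) / 2.

(* Real and imaginary parts of the inverse Gudermannian
   [log tan (pi/4 + z/2)], the primitive of [1 / cos z], at [z = x + i y]. *)
Definition gdre x y := (ln (ch y + sin x) - ln (ch y - sin x)) / 2.
Definition gdim x y := atan (sh y / cos x).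

Lemma ch_sh y : ch y ^+ 2 - sh y ^+ 2 = 1.
Proof.
have e : expR y * expR (- y) = 1 by rewrite -expRD subrr expR0.
by rewrite /ch /sh; transitivity (expR y * expR (- y)); [field | exact: e].
Qed.

Lemma ch_ge1 y : 1 <= ch y.
Proof.
have := ch_sh y; have := sqr_ge0 (sh y).
have : 0 <= ch y by rewrite /ch divr_ge0// addr_ge0// expR_ge0.
nra.
Qed.

Lemma is_derive_ch y : is_derive y 1 ch (sh y).
Proof.
have D : is_derive y 1 (fun s : R => expR (- s)) (expR (- y) * -1).
  by apply: is_derive1_comp.
rewrite /ch /sh; apply: is_derive_eq.
by rewrite /GRing.scale/=; ring.
Qed.

Lemma is_derive_sh y : is_derive y 1 sh (ch y).
Proof.
have D : is_derive y 1 (fun s : R => expR (- s)) (expR (- y) * -1).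
  by apply: is_derive1_comp.
rewrite /ch /sh; apply: is_derive_eq.
by rewrite /GRing.scale/=; ring.
Qed.

Let den x y := cos x ^+ 2 + sh y ^+ 2.
(* Real and imaginary parts of [1 / cos (x + i y)]. *)
Definition secre x y := cos x * ch y / den x y.
Definition secim x y := sh y * sin x / den x y.

Lemma ch_sin_gt0 x y : 0 < cos x -> 0 < ch y + sin x /\ 0 < ch y - sin x.
Proof.
move=> c0; have := ch_ge1 y; have := cos2Dsin2 x.
by move=> h1 h2; split; nra.
Qed.

(** The derivative is the real part of (1 / cos z) dz; [is_derive_gdim] gives the imaginary part. *)
Lemma is_derive_gdre (X Y : R -> R) (dX dY s : R) : 0 < cos (X s) ->
  is_derive s 1 X dX -> is_derive s 1 Y dY ->
  is_derive s 1 (fun s => gdre (X s) (Y s))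
    (secre (X s) (Y s) * dX - secim (X s) (Y s) * dY).
Proof.
move=> c0 DX DY.
have [p1 p2] := ch_sin_gt0 (Y s) c0.
have D1 := is_derive1_comp (is_derive_ch (Y s)) DY.
have D2 := is_derive1_comp (is_derive_sin (X s)) DX.
have D3 := is_derive1_comp (f := @ln R) (g := (ch \o Y) + (sin \o X)) (is_derive1_ln p1) (is_deriveD D1 D2).
have D4 := is_derive1_comp (f := @ln R) (g := (ch \o Y) - (sin \o X)) (is_derive1_ln p2) (is_deriveB D1 D2).
rewrite /gdre.
have D5 := is_deriveZ (2^-1) (is_deriveB D3 D4).
rewrite (_ : (fun _ => _) = 2^-1 *: ((@ln R \o ((ch \o Y) + (sin \o X))) - (@ln R \o ((ch \o Y) - (sin \o X))))); last first.
  by apply/funext => z; rewrite !fctE /GRing.scale/= mulrC.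
apply: is_derive_eq D5 _.
rewrite /GRing.scale/= /secre /secim /den.
(* Two forms of |cos z|^2. *)
have -> : cos (X s) ^+ 2 + sh (Y s) ^+ 2 = (ch (Y s) + sin (X s)) * (ch (Y s) - sin (X s)).
  by have := ch_sh (Y s); have := cos2Dsin2 (X s); lra.
by field; rewrite ?gt_eqF.
Qed.

Lemma is_derive_gdim (X Y : R -> R) (dX dY s : R) : 0 < cos (X s) ->
  is_derive s 1 X dX -> is_derive s 1 Y dY ->
  is_derive s 1 (fun s => gdim (X s) (Y s))
    (secim (X s) (Y s) * dX + secre (X s) (Y s) * dY).
Proof.
move=> c0 DX DY.
have D1 := is_derive1_comp (is_derive_sh (Y s)) DY.
have D2 := is_derive1_comp (is_derive_cos (X s)) DX.
have c0' : (cos \o X) s != 0 by rewrite /= gt_eqF.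
have D3 := is_deriveM D1 (is_deriveV c0' D2).
have D4 := is_derive1_comp (is_derive1_atan _) D3.
apply: is_derive_eq D4 _.
rewrite !fctE /GRing.scale/= /secre /secim /den.
have p : 0 < cos (X s) ^+ 2 + sh (Y s) ^+ 2 by rewrite ltr_wpDr ?sqr_ge0 ?exprn_gt0.
have p1 : 0 < 1 + (sh (Y s) / cos (X s)) ^+ 2 by rewrite ltr_wpDr ?sqr_ge0.
by field; rewrite ?gt_eqF// addrC.
Qed.

(** |cos z| >= cos x, uniformly in y. Bounds of this kind dominate the radial derivative under the
    integral sign. *)
Lemma secre_bounded (m x y : R) : 0 < m -> m <= cos x -> `|secre x y| <= m^-1.
Proof.
move=> m0 mc.
have c0 := lt_le_trans m0 mc.
have p : 0 < den x y by rewrite /den ltr_wpDr ?sqr_ge0 ?exprn_gt0.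
have h1 := ch_ge1 y; have h2 := ch_sh y; have h3 := cos2Dsin2 x.
have ch0 : 0 < ch y by lra.
rewrite /secre ger0_norm; last first.
  by apply: divr_ge0; [apply: mulr_ge0|]; exact: ltW.
rewrite ler_pdivrMr// -ler_pdivrMl ?invr_gt0// invrK.
apply: (@le_trans _ _ (cos x * (cos x * ch y))).
  by rewrite ler_wpM2r//; apply: mulr_ge0; exact: ltW.
rewrite /den; have := sqr_ge0 (sin x); have := cos_le1 x; nra.
Qed.

Lemma secim_bounded (m x y : R) : 0 < m -> m <= cos x -> `|secim x y| <= m^-1.
Proof.
move=> m0 mc.
have c0 := lt_le_trans m0 mc.
have p : 0 < den x y by rewrite /den ltr_wpDr ?sqr_ge0 ?exprn_gt0.
rewrite /secim normrM normfV (gtr0_norm p).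
rewrite ler_pdivrMr// -ler_pdivrMl ?invr_gt0// invrK normrM.
apply: (@le_trans _ _ (cos x * (`|sh y| * 1))).
  apply: ler_pM => //; first exact: ltW.
  by rewrite ler_wpM2l// sin_max.
rewrite /den mulr1 -[sh y ^+ 2]real_normK ?num_real//.
have := sqr_ge0 (cos x - `|sh y|); have := sqr_ge0 `|sh y|.
have := normr_ge0 (sh y); have := cos_le1 x; have := cos2Dsin2 x; nra.
Qed.

Lemma gdim_bounded x y : `|gdim x y| <= pi / 2.
Proof. by rewrite ler_norml ?ltW ?atan_ltpi2 ?atan_gtNpi2. Qed.

Lemma gdre_ge0 x y : 0 < cos x -> 0 <= sin x -> 0 <= gdre x y.
Proof.
move=> c0 s0; have [p1 p2] := ch_sin_gt0 y c0.
by rewrite divr_ge0// subr_ge0 ler_ln ?posrE//; lra.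
Qed.

Lemma gdreN x y : gdre (- x) y = - gdre x y.
Proof. by rewrite /gdre sinN opprK; ring. Qed.

(** With s = sin x, [gdre] is half of ln(1 + 2 s / (ch y - s)), and ln(1 + q) <= q. The bound does
    not involve y, so g is small where x is small, whatever the conjugate does there. *)
Lemma gdre_le x y : 0 < cos x -> 0 <= sin x ->
  gdre x y <= sin x / (1 - sin x).
Proof.
move=> c0 s0; have [p1 p2] := ch_sin_gt0 y c0.
have h := ch_ge1 y; have h3 := cos2Dsin2 x.
have s1 : 0 < 1 - sin x by nra.
rewrite /gdre -ln_div ?posrE//.
have -> : (ch y + sin x) / (ch y - sin x) = 1 + 2 * sin x / (ch y - sin x).
  by field; rewrite gt_eqF.
have q : 0 <= 2 * sin x / (ch y - sin x) by rewrite divr_ge0 ?mulr_ge0// ltW.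
rewrite ler_pdivrMr// (le_trans (le_ln1Dx _))//; first by lra.
rewrite -mulrA [_ * 2]mulrC ler_wpM2l// ler_wpM2l// lef_pV2 ?posrE//; lra.
Qed.

(** For s = sin x >= 0, s / (1 - s) = s (1 + s) / cos^2 x <= 2 / m^2. *)
Lemma gdre_bounded (m x y : R) : 0 < m -> m <= cos x ->
  `|gdre x y| <= 2 / m ^+ 2.
Proof.
move=> m0 mc.
wlog s0 : x mc / 0 <= sin x => [H|].
  have [/(H _ mc)//|s0] := leP 0 (sin x).
  have := H (- x); rewrite cosN sinN gdreN normrN => /(_ mc); apply; lra.
have c0 := lt_le_trans m0 mc.
rewrite ger0_norm ?gdre_ge0//; apply: le_trans (gdre_le _ c0 s0) _.
have h3 := cos2Dsin2 x.
have s1 : 0 < 1 - sin x by nra.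
rewrite ler_pdivrMr// mulrAC ler_pdivlMr ?exprn_gt0//.
have : m ^+ 2 <= cos x ^+ 2 by rewrite !expr2; nra.
have := sin_le1 x; nra.
Qed.

End Gudermann.

(** * The mean value property for (g + i k)(u + i v) *)

Section MeanValue.
Variable R : realType.
Local Notation mu := (@lebesgue_measure R).

Lemma is_derive_continuous (f : R -> R) (x df : R) :
  is_derive x 1 f df -> {for x, continuous f}.
Proof. by move=> [/derivable1_diffP/differentiable_continuous]. Qed.

Lemma continuous_Icc_integrable (f : R -> R) (a b : R) : continuous f ->
  mu.-integrable `[a, b] (EFin \o f).
Proof.
move=> cf; apply: continuous_compact_integrable; first exact: segment_compact.
exact: continuous_subspaceT.
Qed.

Lemma Rintegral_derive (F f : R -> R) (a b : R) : a < b -> continuous f ->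
  (forall x : R, is_derive x 1 F (f x)) ->
  \int[mu]_(x in `[a, b]) f x = F b - F a.
Proof.
move=> ab cf DF; rewrite /Rintegral (@continuous_FTC2 _ f F)//.
- exact: continuous_subspaceT.
- have cF x : {for x, continuous F} by exact: is_derive_continuous (DF x).
  split=> [x _|//|//]; first by have [] := DF x.
  + by apply: cvg_at_right_filter; exact: cF.
  + by apply: cvg_at_left_filter; exact: cF.
- by move=> x _; rewrite derive1E; by case: (DF x).
Qed.

Lemma continuous_trigpoly N (c d : nat -> R) r : continuous (trigpoly N c d r).
Proof. by move=> t; exact: is_derive_continuous (is_derive_trigpoly_t _ _ _ _ _). Qed.

Lemma continuous_dtrigpoly N (c d : nat -> R) r : continuous (dtrigpoly N c d r).
Proof.
rewrite (_ : dtrigpoly N c d r = trigpoly N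
    (fun k => k%:R * r ^+ k.-1 * c k) (fun k => k%:R * r ^+ k.-1 * d k) 1).
  exact: continuous_trigpoly.
by apply/funext => t; apply: eq_bigr => k _; rewrite expr1n; ring.
Qed.

Lemma continuous_sec (X Y : R -> R) (t : R) : 0 < cos (X t) ->
  {for t, continuous X} -> {for t, continuous Y} ->
  {for t, continuous (fun t => secre (X t) (Y t))} /\
  {for t, continuous (fun t => secim (X t) (Y t))}.
Proof.
move=> c0 cX cY.
have cc : {for t, continuous (fun t => cos (X t))}.
  by apply: (@continuous_comp _ _ _ X cos) => //; exact: continuous_cos.
have cs : {for t, continuous (fun t => sin (X t))}.
  by apply: (@continuous_comp _ _ _ X sin) => //; exact: continuous_sin.
have cC : {for t, continuous (fun t => ch (Y t))}.
  apply: (@continuous_comp _ _ _ Y (@ch R)) => //.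
  exact: is_derive_continuous (is_derive_ch _).
have cS : {for t, continuous (fun t => sh (Y t))}.
  apply: (@continuous_comp _ _ _ Y (@sh R)) => //.
  exact: is_derive_continuous (is_derive_sh _).
have p : cos (X t) ^+ 2 + sh (Y t) ^+ 2 != 0.
  by rewrite gt_eqF// ltr_wpDr ?sqr_ge0 ?exprn_gt0.
have cd : {for t, continuous (fun t => cos (X t) ^+ 2 + sh (Y t) ^+ 2)}.
  by apply: cvgD; [exact: (cvgM cc cc)|exact: (cvgM cS cS)].
by split; (apply: cvgM; [exact: cvgM|exact: cvgV]).
Qed.

Variables (n n' : nat) (a b a' b' : nat -> R).
Variables (rho m : R).
Hypotheses (rho1 : 1 < rho) (m0 : 0 < m).

Let x := trigpoly n.+1 a b.
Let y := trigpoly n.+1 (fun k => - b k) a.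
Let u := trigpoly n'.+1 a' b'.
Let v := trigpoly n'.+1 (fun k => - b' k) a'.
Let dx := dtrigpoly n.+1 a b.
Let dy := dtrigpoly n.+1 (fun k => - b k) a.
Let du := dtrigpoly n'.+1 a' b'.
Let dv := dtrigpoly n'.+1 (fun k => - b' k) a'.

Hypothesis cosx : forall r t, `|r| < rho -> m <= cos (x r t).

Let is_derive_x_t N (c d : nat -> R) (r t : R) :
  is_derive t 1 (trigpoly N c d r)
    (- (r * dtrigpoly N (fun k => - d k) c r t)).
Proof.
apply: is_derive_eq (is_derive_trigpoly_t _ _ _ _ _) _.
rewrite mul_dtrigpoly -trigpolyN; congr (trigpoly _ _ _ _ _).
by apply/funext => k; ring.
Qed.

Let is_derive_y_t N (c d : nat -> R) (r t : R) :
  is_derive t 1 (trigpoly N (fun k => - d k) c r) (r * dtrigpoly N c d r t).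
Proof.
apply: is_derive_eq (is_derive_trigpoly_t _ _ _ _ _) _.
rewrite mul_dtrigpoly; congr (trigpoly _ _ _ _ _).
by apply/funext => k; ring.
Qed.

(** [h1] + i [h2] is the product (g + i k)(u + i v), and [dh2] is the radial derivative of [h2]. *)
Let h1 (r t : R) := gdre (x r t) (y r t) * u r t - gdim (x r t) (y r t) * v r t.
Let h2 (r t : R) := gdre (x r t) (y r t) * v r t + gdim (x r t) (y r t) * u r t.
Let dh2 (r t : R) :=
  (secre (x r t) (y r t) * dx r t - secim (x r t) (y r t) * dy r t) * v r t
  + gdre (x r t) (y r t) * dv r t
  + (secim (x r t) (y r t) * dx r t + secre (x r t) (y r t) * dy r t) * u r t
  + gdim (x r t) (y r t) * du r t.

Let cosx_gt0 r t : `|r| < rho -> 0 < cos (x r t).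
Proof. by move=> /(cosx t); exact: lt_le_trans. Qed.

Let is_derive_h2_r (r t : R) : `|r| < rho -> is_derive r 1 (h2 ^~ t) (dh2 r t).
Proof.
move=> /(cosx_gt0 t) c0.
have Dx : is_derive r 1 (x ^~ t) (dx r t) by exact: is_derive_trigpoly_r.
have Dy : is_derive r 1 (y ^~ t) (dy r t) by exact: is_derive_trigpoly_r.
have Du : is_derive r 1 (u ^~ t) (du r t) by exact: is_derive_trigpoly_r.
have Dv : is_derive r 1 (v ^~ t) (dv r t) by exact: is_derive_trigpoly_r.
have Dg := is_derive_gdre (X := x ^~ t) (Y := y ^~ t) c0 Dx Dy.
have Dk := is_derive_gdim (X := x ^~ t) (Y := y ^~ t) c0 Dx Dy.
apply: is_derive_eq (is_deriveD (is_deriveM Dg Dv) (is_deriveM Dk Du)) _.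
by rewrite /GRing.scale/= /dh2; ring.
Qed.

Let is_derive_h1_t (r t : R) : `|r| < rho -> is_derive t 1 (h1 r) (- (r * dh2 r t)).
Proof.
move=> /(cosx_gt0 t) c0.
have Dx : is_derive t 1 (x r) (- (r * dy r t)) by exact: is_derive_x_t.
have Dy : is_derive t 1 (y r) (r * dx r t) by exact: is_derive_y_t.
have Du : is_derive t 1 (u r) (- (r * dv r t)) by exact: is_derive_x_t.
have Dv : is_derive t 1 (v r) (r * du r t) by exact: is_derive_y_t.
have Dg := is_derive_gdre c0 Dx Dy; have Dk := is_derive_gdim c0 Dx Dy.
apply: is_derive_eq (is_deriveB (is_deriveM Dg Du) (is_deriveM Dk Dv)) _.
by rewrite /GRing.scale/= /dh2; ring.
Qed.

Let continuous_dh2 r : `|r| < rho -> continuous (dh2 r).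
Proof.
move=> rr t; have c0 := cosx_gt0 t rr.
have Dx : is_derive t 1 (x r) (- (r * dy r t)) by exact: is_derive_x_t.
have Dy : is_derive t 1 (y r) (r * dx r t) by exact: is_derive_y_t.
have cg := is_derive_continuous (is_derive_gdre c0 Dx Dy).
have ck := is_derive_continuous (is_derive_gdim c0 Dx Dy).
have [cp cq] := continuous_sec c0 (is_derive_continuous Dx)
  (is_derive_continuous Dy).
have cdx : {for t, continuous (dx r)} by exact: continuous_dtrigpoly.
have cdy : {for t, continuous (dy r)} by exact: continuous_dtrigpoly.
have cdu : {for t, continuous (du r)} by exact: continuous_dtrigpoly.
have cdv : {for t, continuous (dv r)} by exact: continuous_dtrigpoly.
have cu : {for t, continuous (u r)} by exact: continuous_trigpoly.
have cv : {for t, continuous (v r)} by exact: continuous_trigpoly.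
apply: cvgD; [apply: cvgD; [apply: cvgD|]|].
- by apply: cvgM => //; apply: cvgB; exact: cvgM.
- exact: cvgM.
- by apply: cvgM => //; apply: cvgD; exact: cvgM.
- exact: cvgM.
Qed.

(** Makes [h2] integrable on every circle of radius below [rho]. *)
Let continuous_h2 r : `|r| < rho -> continuous (h2 r).
Proof.
move=> rr t; have c0 := cosx_gt0 t rr.
have Dx : is_derive t 1 (x r) (- (r * dy r t)) by exact: is_derive_x_t.
have Dy : is_derive t 1 (y r) (r * dx r t) by exact: is_derive_y_t.
have cg := is_derive_continuous (is_derive_gdre c0 Dx Dy).
have ck := is_derive_continuous (is_derive_gdim c0 Dx Dy).
by apply: cvgD; apply: cvgM => //; exact: continuous_trigpoly.
Qed.

(** By the polar Cauchy-Riemann equations, - r [dh2] is the t-derivative of [h1], which is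
    2pi-periodic. *)
Let int_dh2 r : `|r| < rho -> r != 0 -> \int[mu]_(t in `[-pi, pi]) dh2 r t = 0.
Proof.
move=> rr r0; have c := continuous_dh2 rr.
have E : \int[mu]_(t in `[-pi, pi]) (- r * dh2 r t) = h1 r pi - h1 r (- pi).
  apply: Rintegral_derive.
  - by have := pi_gt0 R; lra.
  - by move=> t; apply: cvgM; [exact: cvg_cst|exact: c].
  - by move=> t; rewrite mulNr; exact: is_derive_h1_t.
have /eqP : - r * \int[mu]_(t in `[-pi, pi]) dh2 r t = 0.
  rewrite -RintegralZl//; last exact: continuous_Icc_integrable.
  rewrite E /h1 /x /y /u /v.
  have P N e d : trigpoly N e d r pi = trigpoly N e d r (- pi).
    by rewrite -[RHS]trigpoly_periodic; congr trigpoly; ring.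
  by rewrite !P subrr.
by rewrite mulf_eq0 oppr_eq0 (negbTE r0)/= => /eqP.
Qed.

Let dh2_bounded : exists2 M : R, 0 <= M & forall r t, `|r| < rho -> `|dh2 r t| <= M.
Proof.
have [Mu Hu] := trigpoly_bounded n'.+1 a' b' rho.
have [Mv Hv] := trigpoly_bounded n'.+1 (fun k => - b' k) a' rho.
have [Mdx Hdx] := dtrigpoly_bounded n.+1 a b rho.
have [Mdy Hdy] := dtrigpoly_bounded n.+1 (fun k => - b k) a rho.
have [Mdu Hdu] := dtrigpoly_bounded n'.+1 a' b' rho.
have [Mdv Hdv] := dtrigpoly_bounded n'.+1 (fun k => - b' k) a' rho.
pose M := (m^-1 * Mdx + m^-1 * Mdy) * Mv + 2 / m ^+ 2 * Mdv +
  (m^-1 * Mdx + m^-1 * Mdy) * Mu + pi / 2 * Mdu.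
suff H r t : `|r| < rho -> `|dh2 r t| <= M.
  exists M => //; apply: le_trans (H 0 0 _); first by [].
  by rewrite normr0 (lt_trans ltr01).
move=> rr; have rr' := ltW rr; have c0 := cosx t rr.
have p1 := secre_bounded (y r t) m0 c0; have p2 := secim_bounded (y r t) m0 c0.
have p3 := gdre_bounded (y r t) m0 c0; have p4 := gdim_bounded (x r t) (y r t).
apply: le_trans (ler_normD _ _) _.
apply: lerD; last by rewrite normrM ler_pM ?Hdu.
apply: le_trans (ler_normD _ _) _.
apply: lerD.
  apply: le_trans (ler_normD _ _) _.
  apply: lerD; rewrite normrM ler_pM ?Hdv ?Hv//.
  by apply: le_trans (ler_normB _ _) _; apply: lerD;
  rewrite normrM ler_pM ?Hdx ?Hdy.
rewrite normrM ler_pM ?Hu//.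
by apply: le_trans (ler_normD _ _) _; apply: lerD;
  rewrite normrM ler_pM ?Hdx ?Hdy.
Qed.

Let J r := \int[mu]_(t in `[-pi, pi]) h2 r t.

(** The integral over the circle of radius r has derivative 0 for 0 < r < 1. Differentiation under
    the integral takes place on ]-rho, rho[, which contains both 0 and 1, so J is continuous on
    [0, 1]. *)
Let mean_J : J 1 = J 0.
Proof.
have [M M0 HM] := dh2_bounded.
have inI (r : R) : r \in `]- rho, rho[ -> `|r| < rho.
  by rewrite in_itv/= ltr_norml.
have dE (r t : R) : `]- rho, rho[%classic r -> partial1of2 h2 r t = dh2 r t.
  move=> /inI rr; rewrite partial1of2E; by case: (is_derive_h2_r t rr).
have DJ (r : R) : `|r| < rho -> is_derive r 1 J (\int[mu]_(t in `[-pi, pi]) dh2 r t).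
  move=> rr.
  have Ir : `]- rho, rho[%classic r by rewrite /= in_itv/= -ltr_norml.
  have H1 (z : R) : `]- rho, rho[%classic z -> mu.-integrable `[- pi, pi] (EFin \o h2 z).
    by move=> /inI rz; exact/continuous_Icc_integrable/continuous_h2.
  have H2 (z t : R) : `]- rho, rho[%classic z -> `[- pi, pi]%classic t -> derivable (h2 ^~ t) z 1.
    by move=> /inI rz _; have [] := is_derive_h2_r t rz.
  have H3 : mu.-integrable `[- pi, pi] (EFin \o cst M).
    by apply: continuous_Icc_integrable => z; exact: cvg_cst.
  have H4 (z t : R) : `]- rho, rho[%classic z -> `[- pi, pi]%classic t ->
      `|partial1of2 h2 z t| <= (cst M) t.
    by move=> Iz _; rewrite dE// HM//; exact: inI.
  have M0' (t : R) : 0 <= (cst M) t by [].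
  split.
    exact: (@derivable_under_integral R _ _ mu h2 `[- pi, pi] (measurable_itv _) r _ _ Ir
      H1 H2 (cst M) M0' H3 H4).
  rewrite -derive1E (@differentiation_under_integral R _ _ mu h2 `[- pi, pi] (measurable_itv _) r
    _ _ Ir H1 H2 (cst M) M0' H3 H4) //.
  by apply: eq_Rintegral => t _; rewrite dE.
have in01 (r : R) : r \in `[0, 1] -> `|r| < rho.
  by rewrite in_itv/= => /andP[r0 r1]; rewrite ger0_norm// (le_lt_trans r1).
have [||c _] := @MVT _ J (fun _ => 0) 0 1 ltr01.
- move=> r r01.
  have rr : `|r| < rho by apply: in01; move: r01; exact: subset_itv_oo_cc.
  apply: is_derive_eq (DJ r rr) _; apply: int_dh2 => //.
  by move: r01; rewrite in_itv/= => /andP[r0 _]; rewrite gt_eqF.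
- apply: derivable_within_continuous => r rr.
  by have [] := DJ r (in01 _ rr).
- by rewrite mul0r => /eqP; rewrite subr_eq0 => /eqP.
Qed.

Lemma gd_mean_value :
  \int[mu]_(t in `[-pi, pi])
    (gdre (x 1 t) (y 1 t) * v 1 t + gdim (x 1 t) (y 1 t) * u 1 t) =
  2 * pi * (gdre (a 0%N) (- b 0%N) * - b' 0%N + gdim (a 0%N) (- b 0%N) * a' 0%N).
Proof.
rewrite -/(J 1) mean_J /J /h2 /x /y /u /v.
under eq_Rintegral do rewrite !trigpoly0.
rewrite Rintegral_cst//= lebesgue_measure_itv/= lte_fin.
by have := pi_gt0 R; case: ifP => [_|]; [rewrite -EFinB/=; lra|lra].
Qed.

End MeanValue.

(** * Poisson kernels *)

Section Kernels.
Variable R : realType.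
Local Notation mu := (@lebesgue_measure R).
Local Notation I := (`[- @pi R, @pi R]%classic).
Implicit Types (n : nat) (r t s : R).

Lemma integrableM_bounded (D : set R) (f h : R -> R) (M : R) : measurable D ->
  mu.-integrable D (EFin \o f) -> measurable_fun D h ->
  (forall s, D s -> `|h s| <= M) ->
  mu.-integrable D (EFin \o (fun s => f s * h s)).
Proof.
move=> mD fi mh hM.
rewrite (_ : EFin \o _ = ((EFin \o f) \* (EFin \o h))%E)//.
apply: integrableMl => //.
exists M; split; first exact: num_real.
by move=> x Mx s Ds /=; rewrite (le_trans (hM _ Ds))// ltW.
Qed.

Lemma Rintegral_sum (D : set R) n (F : 'I_n -> R -> R) : measurable D ->
  (forall k, mu.-integrable D (EFin \o F k)) ->
  \int[mu]_(s in D) (\sum_(k < n) F k s) = \sum_(k < n) \int[mu]_(s in D) F k s.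
Proof.
move=> mD Fi; rewrite /Rintegral.
under eq_integral do rewrite -sumEFin.
rewrite (@integral_sum _ _ _ mu D mD _ (fun k s => (F k s)%:E) Fi).
rewrite (eq_bigr (fun k => (fine (\int[mu]_(x in D) (F k x)%:E))%:E)).
  by rewrite sumEFin.
move=> k _; rewrite fineK//.
exact: (@integrable_fin_num _ _ _ mu _ mD (EFin \o F k)).
Qed.

(** Weights in the expansions 1 + 2 sum r^k cos(kt) and 2 sum r^k sin(kt) of the Poisson kernel and
    its conjugate. *)
Definition ek (k : nat) : R := if k is 0%N then 1 else 2.

Definition poissonk n r t := \sum_(k < n.+1) ek k * r ^+ k * cos (k%:R * t).
Definition cpoissonk n r t := \sum_(k < n.+1) ek k * r ^+ k * sin (k%:R * t).

(** This is |1 - r e^{it}|^2. *)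
Definition poissonden r t := 1 - 2 * r * cos t + r ^+ 2.

Lemma poissonden_ge r t : (1 - `|r|) ^+ 2 <= poissonden r t.
Proof.
have h1 := cos_max t; have h2 : r * cos t <= `|r|.
  apply: le_trans (ler_norm _) _; rewrite normrM ler_piMr//.
rewrite /poissonden -[r ^+ 2]real_normK ?num_real//; nra.
Qed.

(** Multiplication by |1 - r e^{it}|^2 telescopes the sum: 1 - r^2 is the numerator of the full
    kernel, and the other two terms come from the truncation. *)
Lemma poissonkE n r t : poissonden r t * poissonk n r t =
  1 - r ^+ 2 - 2 * r ^+ n.+1 * cos (n.+1%:R * t) + 2 * r ^+ n.+2 * cos (n%:R * t).
Proof.
elim: n => [|n IH]; rewrite /poissonk.
  by rewrite big_ord1 /poissonden /= !mul0r cos0 (mul1r t); ring.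
rewrite big_ord_recr/= mulrDr -/(poissonk n r t) IH /poissonden.
have -> : cos (n.+2%:R * t) = 2 * cos t * cos (n.+1%:R * t) - cos (n%:R * t).
  have -> : n.+2%:R * t = n.+1%:R * t + t :> R by rewrite -natr1; ring.
  have -> : n%:R * t = n.+1%:R * t - t :> R by rewrite -natr1; ring.
  by rewrite cosD cosB; ring.
by rewrite !exprS; ring.
Qed.

Lemma cpoissonkE n r t : poissonden r t * cpoissonk n r t =
  2 * r * sin t - 2 * r ^+ n.+1 * sin (n.+1%:R * t) + 2 * r ^+ n.+2 * sin (n%:R * t).
Proof.
elim: n => [|n IH]; rewrite /cpoissonk.
  by rewrite big_ord1 /poissonden /= !mul0r sin0 (mul1r t); ring.
rewrite big_ord_recr/= mulrDr -/(cpoissonk n r t) IH /poissonden.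
have -> : sin (n.+2%:R * t) = 2 * cos t * sin (n.+1%:R * t) - sin (n%:R * t).
  have -> : n.+2%:R * t = n.+1%:R * t + t :> R by rewrite -natr1; ring.
  have -> : n%:R * t = n.+1%:R * t - t :> R by rewrite -natr1; ring.
  by rewrite sinD sinB; ring.
by rewrite !exprS; ring.
Qed.

(** Bound on the truncation error: the two extra terms of the numerator are at most 2 r^(n+1) each,
    and the denominator is at least (1 - r)^2. *)
Definition ptail n r := 4 * r ^+ n.+1 / (1 - r) ^+ 2.

Lemma ptail_ge0 n r : 0 <= r -> 0 <= ptail n r.
Proof. by move=> r0; rewrite divr_ge0 ?sqr_ge0// mulr_ge0// exprn_ge0. Qed.

Let tail_le n (c d r r1 : R) : `|r| <= r1 -> r1 < 1 -> `|c| <= 1 -> `|d| <= 1 ->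
  `|- (2 * r ^+ n.+1 * c) + 2 * r ^+ n.+2 * d| <= 4 * r1 ^+ n.+1.
Proof.
move=> rr r11 c1 d1; apply: le_trans (ler_normD _ _) _.
have r10 : 0 <= r1 by exact: le_trans rr.
have h k : `|r ^+ k| <= r1 ^+ k by rewrite normrX lerXn2r ?nnegrE.
have h1 := h n.+1; have h2 := h n.+2.
have h3 : r1 ^+ n.+2 <= r1 ^+ n.+1 by rewrite ler_wiXn2l// ltW.
move: (r ^+ n.+1) (r ^+ n.+2) (r1 ^+ n.+1) (r1 ^+ n.+2) h1 h2 h3.
move=> A B A1 B1 hA hB hAB; rewrite normrN !normrM ger0_norm//.
have : `|A| * `|c| <= A1 * 1 by rewrite ler_pM.
have : `|B| * `|d| <= B1 * 1 by rewrite ler_pM.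
lra.
Qed.

(** The full kernel is positive, so only the truncation can make the sum negative. Uniformity over
    |r| <= r1 gives bounds on a whole disc. *)
Lemma poissonk_gt n r r1 t : `|r| <= r1 -> r1 < 1 -> - ptail n r1 <= poissonk n r t.
Proof.
move=> rr r11; have h1 := poissonkE n r t; have h2 := poissonden_ge r t.
have r10 : 0 <= r1 by exact: le_trans rr.
have h3 := tail_le n rr r11 (cos_max (n.+1%:R * t)) (cos_max (n%:R * t)).
have D0 : 0 < poissonden r t.
  by apply: lt_le_trans h2; rewrite exprn_gt0// subr_gt0; lra.
rewrite -(ler_pM2l D0) h1.
have : - (4 * r1 ^+ n.+1) <= - (2 * r ^+ n.+1 * cos (n.+1%:R * t)) + 2 * r ^+ n.+2 * cos (n%:R * t).
  by rewrite lerNl (le_trans _ h3)// -normrN ler_norm.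
have : r ^+ 2 <= 1.
  by rewrite -real_normK ?num_real// exprn_ile1//; lra.
have : 4 * r1 ^+ n.+1 <= poissonden r t * ptail n r1.
  have q0 : 0 < (1 - r1) ^+ 2 by rewrite exprn_gt0//; lra.
  have -> : 4 * r1 ^+ n.+1 = (1 - r1) ^+ 2 * ptail n r1.
    by rewrite [RHS]mulrC /ptail divfK// gt_eqF.
  rewrite ler_wpM2r ?ptail_ge0// (le_trans _ h2)// !expr2; nra.
lra.
Qed.

Lemma cpoissonk_lim n r t : 0 <= r -> r < 1 ->
  `|cpoissonk n r t - 2 * r * sin t / poissonden r t| <= ptail n r.
Proof.
move=> r0 r11; have h1 := cpoissonkE n r t; have h2 := poissonden_ge r t.
have rr : `|r| <= r by rewrite ger0_norm.
have h3 := tail_le n rr r11 (sin_max (n.+1%:R * t)) (sin_max (n%:R * t)).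
have D0 : 0 < poissonden r t.
  by apply: lt_le_trans h2; rewrite exprn_gt0// subr_gt0 ger0_norm.
have -> : cpoissonk n r t - 2 * r * sin t / poissonden r t =
  (- (2 * r ^+ n.+1 * sin (n.+1%:R * t)) + 2 * r ^+ n.+2 * sin (n%:R * t)) / poissonden r t.
  by apply: (mulfI (lt0r_neq0 D0)); rewrite mulrBr h1; field; exact: lt0r_neq0.
rewrite normrM normfV (gtr0_norm D0) ler_pdivrMr//; apply: le_trans h3 _.
have q0 : 0 < (1 - r) ^+ 2 by rewrite exprn_gt0//; lra.
have -> : 4 * r ^+ n.+1 = ptail n r * (1 - r) ^+ 2.
  by rewrite /ptail divfK// gt_eqF.
by rewrite ler_wpM2l ?ptail_ge0// (le_trans _ h2)// ger0_norm.
Qed.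

End Kernels.

(** * Truncated Poisson means as trigonometric polynomials *)

Section PoissonSmoothing.
Variable R : realType.
Local Notation mu := (@lebesgue_measure R).
Local Notation I := (`[- @pi R, @pi R]%classic).
Implicit Types (n k : nat) (r t s : R).

Lemma mI : measurable I. Proof. exact: measurable_itv. Qed.

Lemma muI : mu I = (2 * pi)%:E :> \bar R.
Proof.
have h : - pi < pi :> R by have := pi_gt0 R; lra.
by rewrite lebesgue_measure_itv/= lte_fin h -EFinD; congr EFin; ring.
Qed.

Lemma Rintegral_I_cst (c : R) : \int[mu]_(s in I) c = 2 * pi * c.
Proof.
rewrite Rintegral_cst; last exact: mI.
by rewrite [X in fine X]muI mulrC.
Qed.

Lemma continuous_I_integrable (f : R -> R) : continuous f ->
  mu.-integrable I (EFin \o f).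
Proof. exact: continuous_Icc_integrable. Qed.

Lemma bounded_I_integrable (f : R -> R) (M : R) : measurable_fun I f ->
  (forall s, I s -> `|f s| <= M) -> mu.-integrable I (EFin \o f).
Proof.
move=> mf fM; apply: measurable_bounded_integrable => //.
- by rewrite [X in (X < _)%E]muI ltry.
- exists M; split; first exact: num_real.
  by move=> x Mx s Is /=; rewrite (le_trans (fM _ Is))// ltW.
Qed.

Lemma continuous_cosM (c d : R) : continuous (fun s : R => cos (c * s + d)).
Proof.
move=> s; apply: (@continuous_comp _ _ _ (fun s : R => c * s + d) cos).
  by apply: cvgD; [exact: mulrl_continuous|exact: cvg_cst].
exact: continuous_cos.
Qed.

Lemma continuous_sinM (c d : R) : continuous (fun s : R => sin (c * s + d)).
Proof.
move=> s; apply: (@continuous_comp _ _ _ (fun s : R => c * s + d) sin).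
  by apply: cvgD; [exact: mulrl_continuous|exact: cvg_cst].
exact: continuous_sin.
Qed.

Lemma integrable_mulcos (f : R -> R) (c d : R) : mu.-integrable I (EFin \o f) ->
  mu.-integrable I (EFin \o (fun s => f s * cos (c * s + d))).
Proof.
move=> fi; apply: (@integrableM_bounded _ _ _ _ 1) => //.
  apply: measurable_funTS; apply: continuous_measurable_fun.
  exact: continuous_cosM.
by move=> s _; exact: cos_max.
Qed.

Lemma integrable_mulsin (f : R -> R) (c d : R) : mu.-integrable I (EFin \o f) ->
  mu.-integrable I (EFin \o (fun s => f s * sin (c * s + d))).
Proof.
move=> fi; apply: (@integrableM_bounded _ _ _ _ 1) => //.
  apply: measurable_funTS; apply: continuous_measurable_fun.
  exact: continuous_sinM.
by move=> s _; exact: sin_max.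
Qed.

Lemma Rintegral_cosM k t :
  \int[mu]_(s in I) cos (k%:R * (t - s)) = if k is 0%N then 2 * pi else 0.
Proof.
case: k => [|k].
  under eq_Rintegral do rewrite mul0r cos0.
  by rewrite Rintegral_I_cst mulr1.
have k0 : k.+1%:R != 0 :> R by [].
have D s : is_derive s 1 (fun s : R => - k.+1%:R^-1 * sin (k.+1%:R * (t - s)))
    (cos (k.+1%:R * (t - s))).
  have D : is_derive s 1 (fun s : R => k.+1%:R * (t - s)) (- k.+1%:R).
    by apply: is_derive_eq; rewrite /GRing.scale/=; ring.
  have D1 := is_derive1_comp (is_derive_sin _) D.
  apply: is_derive_eq (is_deriveZ (- k.+1%:R^-1) D1) _.
  by rewrite /GRing.scale/=; field.
rewrite (Rintegral_derive _ _ D).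
- have -> : t - - pi = t - pi + pi *+ 2 :> R by ring.
  by rewrite sinDn2pi subrr.
- by have := pi_gt0 R; lra.
- move=> s; have := @continuous_cosM (- k.+1%:R) (k.+1%:R * t) s.
  by congr continuous_at; apply/funext => x; congr cos; ring.
Qed.

(** Coefficients of the truncated Poisson mean of [f] at radius r; with them, [trigpoly] at radius
    rho is the mean at radius rho r. The [+ 0] matches the form cos(c s + d) of the integrability
    lemmas. *)
Definition pcos r (f : R -> R) k :=
  ek R k * r ^+ k / (2 * pi) * \int[mu]_(s in I) (f s * cos (k%:R * s + 0)).
Definition psin r (f : R -> R) k :=
  ek R k * r ^+ k / (2 * pi) * \int[mu]_(s in I) (f s * sin (k%:R * s + 0)).

Lemma integrable_mul_poissonk n r t (f : R -> R) : mu.-integrable I (EFin \o f) ->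
  mu.-integrable I (EFin \o (fun s => f s * poissonk n r (t - s))).
Proof.
move=> fi.
rewrite (_ : EFin \o _ = (fun s => \sum_(k < n.+1)
    (ek R k * r ^+ k)%:E * (f s * cos (- k%:R * s + k%:R * t))%:E)%E).
  apply: integrable_sum; first exact: mI.
  move=> k _; apply: integrableZl; first exact: mI.
  exact: integrable_mulcos.
apply/funext => s /=; rewrite /poissonk mulr_sumr -sumEFin.
apply: eq_bigr => k _; rewrite -EFinM; congr EFin.
have -> : k%:R * (t - s) = - k%:R * s + k%:R * t by ring.
ring.
Qed.

Lemma integrable_mul_cpoissonk n r t (f : R -> R) : mu.-integrable I (EFin \o f) ->
  mu.-integrable I (EFin \o (fun s => f s * cpoissonk n r (t - s))).
Proof.
move=> fi.
rewrite (_ : EFin \o _ = (fun s => \sum_(k < n.+1)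
    (ek R k * r ^+ k)%:E * (f s * sin (- k%:R * s + k%:R * t))%:E)%E).
  apply: integrable_sum; first exact: mI.
  move=> k _; apply: integrableZl; first exact: mI.
  exact: integrable_mulsin.
apply/funext => s /=; rewrite /cpoissonk mulr_sumr -sumEFin.
apply: eq_bigr => k _; rewrite -EFinM; congr EFin.
have -> : k%:R * (t - s) = - k%:R * s + k%:R * t by ring.
ring.
Qed.

Lemma poisson_trigpoly n r rho t (f : R -> R) : mu.-integrable I (EFin \o f) ->
  trigpoly n.+1 (pcos r f) (psin r f) rho t =
  (2 * pi)^-1 * \int[mu]_(s in I) (f s * poissonk n (rho * r) (t - s)).
Proof.
move=> fi.
have ic k := integrable_mulcos k%:R 0 fi; have is_ k := integrable_mulsin k%:R 0 fi.
pose F (k : nat) s := ek R k * (rho * r) ^+ k * cos (k%:R * t) * (f s * cos (k%:R * s + 0))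
   + ek R k * (rho * r) ^+ k * sin (k%:R * t) * (f s * sin (k%:R * s + 0)).
have Fi1 (c : R) k : mu.-integrable I (EFin \o (fun s => c * (f s * cos (k%:R * s + 0)))).
  by apply: (integrableZl _ _ (ic k)); exact: mI.
have Fi2 (c : R) k : mu.-integrable I (EFin \o (fun s => c * (f s * sin (k%:R * s + 0)))).
  by apply: (integrableZl _ _ (is_ k)); exact: mI.
have Fi k : mu.-integrable I (EFin \o F k).
  by apply: (integrableD _ (Fi1 _ k) (Fi2 _ k)); exact: mI.
have -> : \int[mu]_(s in I) (f s * poissonk n (rho * r) (t - s)) =
          \int[mu]_(s in I) (\sum_(k < n.+1) F k s).
  apply: eq_Rintegral => s _; rewrite /poissonk mulr_sumr.
  apply: eq_bigr => k _; rewrite mulrBr cosB /F !addr0; ring.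
rewrite Rintegral_sum//.
rewrite mulr_sumr; apply: eq_bigr => k _.
rewrite /F RintegralD//.
rewrite !RintegralZl//.
by rewrite /pcos /psin exprMn; ring.
Qed.

Lemma cpoisson_trigpoly n r rho t (f : R -> R) : mu.-integrable I (EFin \o f) ->
  trigpoly n.+1 (fun k => - psin r f k) (pcos r f) rho t =
  (2 * pi)^-1 * \int[mu]_(s in I) (f s * cpoissonk n (rho * r) (t - s)).
Proof.
move=> fi.
have ic k := integrable_mulcos k%:R 0 fi; have is_ k := integrable_mulsin k%:R 0 fi.
pose F (k : nat) s := ek R k * (rho * r) ^+ k * sin (k%:R * t) * (f s * cos (k%:R * s + 0))
   + - (ek R k * (rho * r) ^+ k * cos (k%:R * t)) * (f s * sin (k%:R * s + 0)).
have Fi1 (c : R) k : mu.-integrable I (EFin \o (fun s => c * (f s * cos (k%:R * s + 0)))).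
  by apply: (integrableZl _ _ (ic k)); exact: mI.
have Fi2 (c : R) k : mu.-integrable I (EFin \o (fun s => c * (f s * sin (k%:R * s + 0)))).
  by apply: (integrableZl _ _ (is_ k)); exact: mI.
have Fi k : mu.-integrable I (EFin \o F k).
  by apply: (integrableD _ (Fi1 _ k) (Fi2 _ k)); exact: mI.
have -> : \int[mu]_(s in I) (f s * cpoissonk n (rho * r) (t - s)) =
          \int[mu]_(s in I) (\sum_(k < n.+1) F k s).
  apply: eq_Rintegral => s _; rewrite /cpoissonk mulr_sumr.
  apply: eq_bigr => k _; rewrite mulrBr sinB /F !addr0; ring.
rewrite Rintegral_sum//.
rewrite mulr_sumr; apply: eq_bigr => k _.
rewrite /F RintegralD//.
rewrite !RintegralZl//.
by rewrite /pcos /psin exprMn; ring.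
Qed.

Lemma Rintegral_poissonk n r t : \int[mu]_(s in I) poissonk n r (t - s) = 2 * pi.
Proof.
have ci k (c : R) : mu.-integrable I (EFin \o (fun s => c * cos (k%:R * (t - s)))).
  apply: continuous_I_integrable => s; apply: cvgM; first exact: cvg_cst.
  have := @continuous_cosM (- k%:R) (k%:R * t) s.
  by congr continuous_at; apply/funext => x; congr cos; ring.
rewrite /poissonk Rintegral_sum//.
rewrite big_ord_recl/= big1 ?addr0.
  under eq_Rintegral do rewrite mul0r cos0 mulr1 expr0 mulr1.
  by rewrite Rintegral_I_cst mulr1.
move=> k _; rewrite RintegralZl; last 2 first.
- exact: mI.
- rewrite (_ : EFin \o _ = EFin \o (fun s => 1 * cos ((lift ord0 k)%:R * (t - s)))).
    exact: ci.
  by apply/funext => s /=; rewrite mul1r.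
by rewrite Rintegral_cosM mulr0.
Qed.

(** Extracts the first Fourier coefficient of the kernel; the index [n.+1] guarantees that the term
    k = 1 is present. *)
Lemma Rintegral_cos_poissonk n r t :
  \int[mu]_(s in I) (cos (t - s) * poissonk n.+1 r (t - s)) = 2 * pi * r.
Proof.
have cc k s : {for s, continuous (fun s : R => cos (k%:R * (t - s)))}.
  have := @continuous_cosM (- k%:R) (k%:R * t) s.
  by congr continuous_at; apply/funext => x; congr cos; ring.
have ci k (c : R) : mu.-integrable I (EFin \o (fun s => c * cos (k%:R * (t - s)))).
  apply: continuous_I_integrable => s; apply: cvgM; first exact: cvg_cst.
  exact: cc.
have ci1 k : mu.-integrable I (EFin \o (fun s => cos (k%:R * (t - s)))).
  by apply: continuous_I_integrable => s; exact: cc.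
(* Product-to-sum formula, the weight 2 of [ek] cancelling the factor 1/2. Only k = 1 contributes a
   constant term. *)
pose F k s : R := if k is k'.+1 then
   r ^+ k * cos (k.+1%:R * (t - s)) + r ^+ k * cos (k'%:R * (t - s))
   else 1 * cos (1%:R * (t - s)).
have Fi k : mu.-integrable I (EFin \o F k).
  case: k => [|k]; first exact: ci.
  by apply: (integrableD _ (ci _ _) (ci _ _)); exact: mI.
have -> : \int[mu]_(s in I) (cos (t - s) * poissonk n.+1 r (t - s)) =
          \int[mu]_(s in I) (\sum_(k < n.+2) F k s).
  apply: eq_Rintegral => s _; rewrite /poissonk mulr_sumr.
  apply: eq_bigr => -[[|k] _] _ /=; first by rewrite mul0r cos0 !mul1r; ring.
  have -> : k.+2%:R * (t - s) = k.+1%:R * (t - s) + (t - s) by rewrite -natr1; ring.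
  have -> : k%:R * (t - s) = k.+1%:R * (t - s) - (t - s) by rewrite -natr1; ring.
  by move: (t - s) => x; rewrite cosB cosD; ring.
rewrite Rintegral_sum//.
rewrite !big_ord_recl/= big1 ?addr0.
  under eq_Rintegral do rewrite mul1r.
  rewrite Rintegral_cosM add0r RintegralD//; try exact: ci.
  rewrite !RintegralZl//.
  by rewrite !Rintegral_cosM /bump /=; ring.
move=> k _; rewrite RintegralD//; try exact: ci.
rewrite !RintegralZl//.
by rewrite !Rintegral_cosM !mulr0 addr0.
Qed.

End PoissonSmoothing.

(** * Bounds on truncated Poisson means *)

Section PoissonBounds.
Variable R : realType.
Local Notation mu := (@lebesgue_measure R).
Local Notation I := (`[- @pi R, @pi R]%classic).
Implicit Types (n k : nat) (r t s : R).

Lemma pi2_gt0 : 0 < 2 * pi :> R. Proof. by have := pi_gt0 R; lra. Qed.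

Lemma integrable_I_D (f g : R -> R) : mu.-integrable I (EFin \o f) ->
  mu.-integrable I (EFin \o g) ->
  mu.-integrable I (EFin \o (fun s => f s + g s)).
Proof. by move=> fi gi; apply: (integrableD _ fi gi). Qed.

Lemma integrable_I_B (f g : R -> R) : mu.-integrable I (EFin \o f) ->
  mu.-integrable I (EFin \o g) ->
  mu.-integrable I (EFin \o (fun s => f s - g s)).
Proof. by move=> fi gi; apply: (integrableB _ fi gi). Qed.

Lemma integrable_I_Zl (c : R) (f : R -> R) : mu.-integrable I (EFin \o f) ->
  mu.-integrable I (EFin \o (fun s => c * f s)).
Proof. by move=> fi; apply: (integrableZl _ _ fi). Qed.

Lemma continuous_poissonk n r t : continuous (fun s : R => poissonk n r (t - s)).
Proof.
have E : (fun s : R => poissonk n r (t - s)) = trigpoly n.+1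
    (fun k => ek R k * r ^+ k * cos (k%:R * t))
    (fun k => ek R k * r ^+ k * sin (k%:R * t)) 1.
  apply/funext => s; apply: eq_bigr => k _.
  by rewrite expr1n mulrBr cosB; ring.
by rewrite E; exact: continuous_trigpoly.
Qed.

Lemma integrable_poissonk n r t (c : R) :
  mu.-integrable I (EFin \o (fun s => poissonk n r (t - s) + c)).
Proof.
apply: continuous_I_integrable => s.
by apply: cvgD; [exact: continuous_poissonk|exact: cvg_cst].
Qed.

Lemma Rintegral_poissonkD n r t (c : R) :
  \int[mu]_(s in I) (poissonk n r (t - s) + c) = 2 * pi * (1 + c).
Proof.
rewrite RintegralD//.
- by rewrite Rintegral_poissonk Rintegral_I_cst; ring.
- by apply: continuous_I_integrable; exact: continuous_poissonk.
- by apply: continuous_I_integrable => s; exact: cvg_cst.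
Qed.

Lemma integrable_le1 (f : R -> R) : measurable_fun I f ->
  (forall s, I s -> `|f s| <= 1) -> mu.-integrable I (EFin \o f).
Proof. exact: bounded_I_integrable. Qed.

(** A kernel P >= - d satisfies |P| <= P + 2 d, and the mean of P is 1. *)
Lemma poisson_norm_le1 n r r1 rho t (f : R -> R) : measurable_fun I f ->
  (forall s, I s -> `|f s| <= 1) -> `|rho * r| <= r1 -> r1 < 1 ->
  `|trigpoly n.+1 (pcos r f) (psin r f) rho t| <= 1 + 2 * ptail n r1.
Proof.
move=> mf f1 rr r11; have fi := integrable_le1 mf f1.
have h s := poissonk_gt n s rr r11.
have d0 : 0 <= ptail n r1 by rewrite ptail_ge0// (le_trans _ rr).
rewrite poisson_trigpoly// normrM gtr0_norm ?invr_gt0 ?pi2_gt0//.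
rewrite ler_pdivrMl ?pi2_gt0//.
apply: le_trans (le_normr_Rintegral _ _) _ => //.
  exact: integrable_mul_poissonk.
rewrite -(Rintegral_poissonkD n (rho * r) t).
apply: le_Rintegral => //.
- exact: integrable_norm (integrable_mul_poissonk _ _ _ fi).
- exact: integrable_poissonk.
- move=> s Is; have := h (t - s); have := f1 s Is; rewrite normrM => h1 h2.
  have h3 : `|poissonk n (rho * r) (t - s)| <= poissonk n (rho * r) (t - s) + 2 * ptail n r1.
    by rewrite ler_norml; apply/andP; split; lra.
  by apply: le_trans h3; rewrite ler_piMl.
Qed.

Lemma poisson_ge n r r1 rho t (f : R -> R) : measurable_fun I f ->
  (forall s, I s -> 0 <= f s <= 1) -> `|rho * r| <= r1 -> r1 < 1 ->
  - ptail n r1 <= trigpoly n.+1 (pcos r f) (psin r f) rho t.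
Proof.
move=> mf f01 rr r11.
have fi : mu.-integrable I (EFin \o f).
  by apply: integrable_le1 => // s /f01 /andP[f0 f1]; rewrite ger0_norm.
have h s := poissonk_gt n s rr r11.
have d0 : 0 <= ptail n r1 by rewrite ptail_ge0// (le_trans _ rr).
rewrite poisson_trigpoly// ler_pdivlMl ?pi2_gt0//.
rewrite -Rintegral_I_cst; apply: le_Rintegral => //.
- by apply: continuous_I_integrable => s; exact: cvg_cst.
- exact: integrable_mul_poissonk.
- by move=> s /f01 /andP[f0 f1]; have := h (t - s); nra.
Qed.

Lemma poisson_le n r r1 rho t (f : R -> R) : measurable_fun I f ->
  (forall s, I s -> 0 <= f s <= 1) -> `|rho * r| <= r1 -> r1 < 1 ->
  trigpoly n.+1 (pcos r f) (psin r f) rho t <= 1 + ptail n r1.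
Proof.
move=> mf f01 rr r11.
have fi : mu.-integrable I (EFin \o f).
  by apply: integrable_le1 => // s /f01 /andP[f0 f1]; rewrite ger0_norm.
have h s := poissonk_gt n s rr r11.
have d0 : 0 <= ptail n r1 by rewrite ptail_ge0// (le_trans _ rr).
rewrite poisson_trigpoly// ler_pdivrMl ?pi2_gt0//.
rewrite -(Rintegral_poissonkD n (rho * r) t); apply: le_Rintegral => //.
- exact: integrable_mul_poissonk.
- exact: integrable_poissonk.
- by move=> s /f01 /andP[f0 f1]; have := h (t - s); nra.
Qed.

(** The Poisson mean of C (1 - cos(t - s)) at t is C (1 - r). Since f >= 0, the kernel may first be
    raised by its tail to become nonnegative, which costs at most C times the tail. *)
Lemma poisson_small n r t (C : R) (f : R -> R) : measurable_fun I f ->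
  0 <= C -> 0 <= r -> r < 1 ->
  (forall s, I s -> 0 <= f s <= 1) ->
  (forall s, I s -> f s <= C * (1 - cos (t - s))) ->
  trigpoly n.+2 (pcos r f) (psin r f) 1 t <= C * (1 - r + ptail n.+1 r).
Proof.
move=> mf C0 r0 r1 f01 fC.
have fi : mu.-integrable I (EFin \o f).
  by apply: integrable_le1 => // s /f01 /andP[f0 f1]; rewrite ger0_norm.
have rr : `|r| <= r by rewrite ger0_norm.
have h s := poissonk_gt n.+1 s rr r1.
set d := ptail n.+1 r in h *.
have d0 : 0 <= d by rewrite ptail_ge0.
have ccos : continuous (fun s : R => cos (t - s)).
  move=> s; have := @continuous_cosM _ (- 1) t s.
  by congr continuous_at; apply/funext => x; congr cos; ring.
have i1 : mu.-integrable I (EFin \o (fun s => poissonk n.+1 r (t - s))).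
  by apply: continuous_I_integrable; exact: continuous_poissonk.
have i2 : mu.-integrable I (EFin \o (fun s => cos (t - s) * poissonk n.+1 r (t - s))).
  apply: continuous_I_integrable => s.
  by apply: cvgM; [exact: ccos|exact: continuous_poissonk].
have i3 : mu.-integrable I (EFin \o (fun s => d * cos (t - s))).
  by apply: continuous_I_integrable => s; apply: cvgM; [exact: cvg_cst|exact: ccos].
have i4 : mu.-integrable I (EFin \o (fun s : R => d)).
  by apply: continuous_I_integrable => s; exact: cvg_cst.
have i5 := integrable_I_B i1 i2; have i6 := integrable_I_B i4 i3.
have i7 := integrable_I_D i5 i6.
rewrite poisson_trigpoly// mul1r ler_pdivrMl ?pi2_gt0//.
have -> : 2 * pi * (C * (1 - r + d)) = \int[mu]_(s in I) (C *
   ((poissonk n.+1 r (t - s) - cos (t - s) * poissonk n.+1 r (t - s)) + (d - d * cos (t - s)))).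
  rewrite RintegralZl// RintegralD// !RintegralB//.
  rewrite Rintegral_poissonk Rintegral_cos_poissonk Rintegral_I_cst RintegralZl//; last first.
    exact: continuous_I_integrable.
  rewrite (_ : \int[mu]_(x in I) cos (t - x) = 0); first by ring.
  by under eq_Rintegral do rewrite -[t - _]mul1r; exact: (Rintegral_cosM 1).
apply: le_Rintegral => //.
- exact: integrable_mul_poissonk.
- exact: (integrable_I_Zl C i7).
- move=> s Is; have /andP[f0 _] := f01 s Is; have := fC s Is; have := h (t - s).
  have := cos_le1 (t - s); nra.
Qed.

(** Smoothing is self-adjoint: in Fourier coefficients, both sides are the same symmetric sum. *)
Lemma Rintegral_poisson_sym n r (f g : R -> R) :
  mu.-integrable I (EFin \o f) -> mu.-integrable I (EFin \o g) ->
  \int[mu]_(t in I) (g t * trigpoly n.+1 (pcos r f) (psin r f) 1 t) =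
  \int[mu]_(t in I) (f t * trigpoly n.+1 (pcos r g) (psin r g) 1 t).
Proof.
suff H f' g' : mu.-integrable I (EFin \o f') -> mu.-integrable I (EFin \o g') ->
  \int[mu]_(t in I) (g' t * trigpoly n.+1 (pcos r f') (psin r f') 1 t) =
  \sum_(k < n.+1) (pcos r f' k * \int[mu]_(t in I) (g' t * cos (k%:R * t + 0)) +
                   psin r f' k * \int[mu]_(t in I) (g' t * sin (k%:R * t + 0))).
  move=> fi gi; rewrite !H//; apply: eq_bigr => k _.
  by rewrite /pcos /psin; ring.
move=> {f g} fi gi.
have ic k := integrable_mulcos k%:R 0 gi; have is_ k := integrable_mulsin k%:R 0 gi.
pose F k t := pcos r f' k * (g' t * cos (k%:R * t + 0)) +
              psin r f' k * (g' t * sin (k%:R * t + 0)).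
have Fi k : mu.-integrable I (EFin \o F k).
  exact: (integrable_I_D (integrable_I_Zl _ (ic k)) (integrable_I_Zl _ (is_ k))).
have -> : \int[mu]_(t in I) (g' t * trigpoly n.+1 (pcos r f') (psin r f') 1 t) =
          \int[mu]_(t in I) (\sum_(k < n.+1) F k t).
  apply: eq_Rintegral => t _; rewrite /trigpoly mulr_sumr; apply: eq_bigr => k _.
  by rewrite expr1n /F !addr0; ring.
rewrite Rintegral_sum//; apply: eq_bigr => k _.
rewrite RintegralD//; [|exact: (integrable_I_Zl _ (ic k))|exact: (integrable_I_Zl _ (is_ k))].
by rewrite !RintegralZl.
Qed.

(** By duality: integrate u against its own sign, move the smoothing onto the sign, and use that the
    smoothed sign is at most 1 + 2 [ptail]. *)
Lemma poisson_L1 n r (f : R -> R) : mu.-integrable I (EFin \o f) ->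
  0 <= r -> r < 1 ->
  \int[mu]_(t in I) `|trigpoly n.+1 (pcos r f) (psin r f) 1 t| <=
  (1 + 2 * ptail n r) * \int[mu]_(t in I) `|f t|.
Proof.
move=> fi r0 r1; set u := trigpoly _ _ _ 1.
have cu : continuous u by exact: continuous_trigpoly.
pose sg t : R := if 0 <= u t then 1 else -1.
have mu' : measurable_fun setT u.
  by apply: continuous_measurable_fun; exact: cu.
have msg : measurable_fun I sg.
  apply: measurable_funTS; apply: measurable_fun_ifT => //.
  exact: measurable_fun_ler.
have sg1 t : I t -> `|sg t| <= 1.
  by move=> _; rewrite /sg; case: ifP => _; rewrite ?normrN normr1.
have sgi := integrable_le1 msg sg1.
rewrite (_ : \int[mu]_(t in I) `|u t| = \int[mu]_(t in I) (sg t * u t)); last first.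
  apply: eq_Rintegral => t _; rewrite /sg; case: ifP => [/ger0_norm ->|].
    by rewrite mul1r.
  by move=> /negbT; rewrite -ltNge => /ltr0_norm ->; rewrite mulN1r.
rewrite Rintegral_poisson_sym//.
have ai : mu.-integrable I (EFin \o (fun t => `|f t|)) by exact: integrable_norm fi.
rewrite -RintegralZl//.
have cv : continuous (trigpoly n.+1 (pcos r sg) (psin r sg) 1) by exact: continuous_trigpoly.
have rr : `|1 * r| <= r by rewrite mul1r ger0_norm.
have hb t := poisson_norm_le1 n t msg sg1 rr r1.
have mi : mu.-integrable I
    (EFin \o (fun t => f t * trigpoly n.+1 (pcos r sg) (psin r sg) 1 t)).
  apply: (@integrableM_bounded _ _ _ _ (1 + 2 * ptail n r)) => //.
  apply: measurable_funTS.
  by apply: continuous_measurable_fun; exact: cv.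
apply: le_trans (ler_norm _) _; apply: le_trans (le_normr_Rintegral _ _) _ => //.
apply: le_Rintegral => //.
- exact: integrable_norm mi.
- exact: integrable_I_Zl.
- by move=> t _; rewrite normrM mulrC ler_wpM2r.
Qed.

End PoissonBounds.

(** * The tangent to the inverse Gudermannian, and Lipschitz bounds *)

Section Tangent.
Variable R : realType.
Implicit Types c x : R.

Lemma ch0 : ch 0 = 1 :> R.
Proof. by rewrite /ch oppr0 expR0; field. Qed.

Lemma sh0 : sh 0 = 0 :> R.
Proof. by rewrite /sh oppr0 subrr mul0r. Qed.

Lemma gdim0 x : gdim x 0 = 0.
Proof. by rewrite /gdim sh0 mul0r atan0. Qed.

Lemma secre0 x : secre x 0 = (cos x)^-1.
Proof.
rewrite /secre ch0 sh0 expr0n/= addr0 mulr1.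
have [->|c0] := eqVneq (cos x) 0; first by rewrite expr0n/= invr0 mulr0.
by field.
Qed.

Lemma sin_lex x : 0 <= x -> sin x <= x.
Proof.
rewrite le_eqVlt => /predU1P[<-|x0]; first by rewrite sin0.
have [|z _] := @MVT _ (@sin R) (@cos R) 0 x x0 (fun y _ => is_derive_sin y).
- exact/continuous_subspaceT/continuous_sin.
- by rewrite sin0 !subr0 => ->; have := cos_le1 z; nra.
Qed.

Lemma ler_cos_pi (x y : R) : 0 <= x -> x <= y -> y <= pi -> cos y <= cos x.
Proof.
move=> x0 xy yp; rewrite leNgt ltr_cos ?in_itv/= -?leNgt//.
  by rewrite (le_trans x0).
by rewrite x0 (le_trans xy).
Qed.

(** This is arcosh(1/c), the value of the inverse Gudermannian at arccos c. *)
Definition lnterm c := ln (1 / c + Num.sqrt (1 / c ^+ 2 - 1)).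

Lemma gdre_acos c : 0 < c -> c <= 1 -> gdre (acos c) 0 = lnterm c.
Proof.
move=> c0 c1; have c11 : -1 <= c <= 1 by apply/andP; split; lra.
rewrite /gdre /lnterm sin_acos// ch0.
set s := Num.sqrt (1 - c ^+ 2).
have s0 : 0 <= s by exact: sqrtr_ge0.
have s2 : s ^+ 2 = 1 - c ^+ 2 by rewrite sqr_sqrtr// subr_ge0 expr_le1// ltW.
have -> : Num.sqrt (1 / c ^+ 2 - 1) = s / c.
  have -> : 1 / c ^+ 2 - 1 = (s / c) ^+ 2.
    by rewrite expr_div_n s2; field; rewrite gt_eqF.
  by rewrite sqrtr_sqr ger0_norm// divr_ge0// ltW.
have s1 : s < 1 by nra.
rewrite -ln_div ?posrE; [|lra|lra].
have -> : (1 + s) / (1 - s) = (1 / c + s / c) ^+ 2.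
  rewrite -mulrDl expr_div_n; have -> : c ^+ 2 = (1 - s) * (1 + s) by lra.
  by field; apply/andP; split; apply: lt0r_neq0; lra.
rewrite lnXn; last by rewrite -mulrDl divr_gt0//; lra.
by rewrite mulr2n; field.
Qed.

(** Convexity: the derivative 1 / cos x increases on [0, pi/2[ and equals 1/c at arccos c. The mean
    value theorem is applied on either side of this point. *)
Lemma gd_tangent c x : 0 < c -> c <= 1 -> 0 <= x -> x < pi / 2 ->
  lnterm c + (x - acos c) / c <= gdre x 0.
Proof.
move=> c0 c1 x0 x2; have c11 : -1 <= c <= 1 by apply/andP; split; lra.
rewrite -gdre_acos//; set a := acos c.
have ca : cos a = c by rewrite acosK// in_itv.
have a0 : 0 <= a by exact: acos_ge0.
have p0 := pi_gt0 R.
have a2 : a < pi / 2.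
  rewrite ltNge; apply/negP => h.
  have : cos a <= cos (pi / 2).
    by apply: ler_cos_pi; [lra|exact: h|exact: acos_lepi].
  by rewrite cos_pihalf ca leNgt c0.
have D z : 0 <= z -> z < pi / 2 ->
    is_derive z 1 (fun z => gdre z 0 - z / c) ((cos z)^-1 - c^-1).
  move=> z0 z2.
  have cz : 0 < cos z by apply: cos_gt0_pihalf; apply/andP; split; lra.
  have Dg : is_derive z 1 (fun z => gdre z 0) (cos z)^-1.
    have := is_derive_gdre (X := id) (Y := cst 0) cz (is_derive_id _ _) (is_derive_cst _ _ _).
    by rewrite /= secre0 mulr1 mulr0 subr0.
  apply: is_derive_eq; rewrite /GRing.scale/= mulr0 add0r mulr1.
  by [].
have cw (l u : R) : 0 <= l -> u < pi / 2 ->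
    {within `[l, u], continuous (fun z : R => gdre z 0 - z / c)}.
  move=> l0 u2; apply: derivable_within_continuous => z.
  rewrite in_itv/= => /andP[lz zu].
  by have [] := D z (le_trans l0 lz) (le_lt_trans zu u2).
have [->|xa] := eqVneq x a; first by rewrite subrr mul0r addr0.
suff : 0 <= (gdre x 0 - x / c) - (gdre a 0 - a / c) by lra.
have [lxa|] := ltP x a.
  have [|z] := @MVT _ (fun z : R => gdre z 0 - z / c) (fun z => (cos z)^-1 - c^-1) x a lxa _ (cw _ _ x0 a2).
    by move=> z; rewrite in_itv/= => /andP[h1 h2]; apply: D; lra.
  rewrite in_itv/= => /andP[h1 h2] E.
  have cz : c <= cos z.
    by rewrite -ca; apply: ler_cos_pi; lra.
  have : (cos z)^-1 <= c^-1 by rewrite lef_pV2// posrE; lra.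
  nra.
rewrite le_eqVlt eq_sym (negbTE xa)/= => lax.
have [|z] := @MVT _ (fun z : R => gdre z 0 - z / c) (fun z => (cos z)^-1 - c^-1) a x lax _ (cw _ _ a0 x2).
  by move=> z; rewrite in_itv/= => /andP[h1 h2]; apply: D; lra.
rewrite in_itv/= => /andP[h1 h2] E.
have cz : cos z <= c.
  by rewrite -ca; apply: ler_cos_pi; lra.
have cz0 : 0 < cos z by apply: cos_gt0_pihalf; apply/andP; split; lra.
have : c^-1 <= (cos z)^-1 by rewrite lef_pV2// posrE.
nra.
Qed.

Lemma sin_natmul_le k x : `|sin (k%:R * x)| <= k%:R * `|sin x|.
Proof.
elim: k => [|k IH]; first by rewrite !mul0r sin0 normr0.
have -> : k.+1%:R * x = k%:R * x + x by rewrite -natr1; ring.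
rewrite sinD (le_trans (ler_normD _ _))// !normrM -natr1 mulrDl mul1r lerD//.
  by rewrite (le_trans _ IH)// ler_piMr// cos_max.
by rewrite ler_piMl// cos_max.
Qed.

(** Measuring distance by |sin((s - t)/2)|, half the chord, respects periodicity and leads directly
    to 1 - cos(s - t). *)
Lemma trigpoly_lipschitz n (a b : nat -> R) : exists2 L : R, 0 <= L & forall s t,
  `|trigpoly n a b 1 s - trigpoly n a b 1 t| <= L * `|sin ((s - t) / 2)|.
Proof.
exists (\sum_(k < n) (2 * k%:R * (`|a k| + `|b k|))).
  by apply: sumr_ge0 => k _; rewrite !mulr_ge0// addr_ge0.
move=> s t; rewrite -sumrB mulr_suml; apply: le_trans (ler_norm_sum _ _ _) _.
apply: ler_sum => k _; rewrite expr1n !mul1r.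
set p := k%:R * ((s + t) / 2); set q := k%:R * ((s - t) / 2).
have -> : k%:R * s = p + q by rewrite /p /q; field.
have -> : k%:R * t = p - q by rewrite /p /q; field.
have -> : a k * cos (p + q) + b k * sin (p + q) - (a k * cos (p - q) + b k * sin (p - q))
   = (- (a k * sin p) + b k * cos p) * 2 * sin q.
  by rewrite cosD cosB sinD sinB; ring.
have h := sin_natmul_le k ((s - t) / 2); rewrite -/q in h.
rewrite !normrM (ger0_norm (ler0n _ 2)).
have h2 : `|- (a k * sin p) + b k * cos p| <= `|a k| + `|b k|.
  apply: le_trans (ler_normD _ _) _; rewrite normrN !normrM.
  by apply: lerD; rewrite ler_piMr// ?cos_max ?sin_max.
have -> : 2 * k%:R * (`|a k| + `|b k|) * `|sin ((s - t) / 2)| =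
   (`|a k| + `|b k|) * 2 * (k%:R * `|sin ((s - t) / 2)|) by ring.
by rewrite ler_pM// ?mulr_ge0// ler_wpM2r.
Qed.

Lemma ptail_small (r e : R) : 0 <= r -> r < 1 -> 0 < e ->
  \forall n \near \oo, ptail n r <= e.
Proof.
move=> r0 r1 e0.
have /cvgrPdist_le /(_ e e0) : geometric (4 * r / (1 - r) ^+ 2) r n @[n --> \oo] --> 0.
  by apply: cvg_geometric; rewrite ger0_norm.
apply: filterS => n; rewrite sub0r normrN /geometric/=.
rewrite (_ : _ * r ^+ n = ptail n r); last by rewrite /ptail (exprS r n); ring.
by rewrite ger0_norm ?ptail_ge0.
Qed.

End Tangent.

(** * The estimate for trigonometric polynomials *)

Section WeakTypeTrigPoly.
Variable R : realType.
Local Notation mu := (@lebesgue_measure R).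
Local Notation I := (`[- @pi R, @pi R]%classic).

Definition mean (h : R -> R) : R := (2 * pi)^-1 * \int[mu]_(t in I) h t.
Definition ge1_indic (h : R -> R) : R -> R := \1_[set t | 1 <= h t].

Lemma measurable_ge1_indic (D : set R) (h : R -> R) : continuous h ->
  measurable_fun D (ge1_indic h).
Proof.
move=> ch; apply: measurable_indic.
have mh : measurable_fun setT h.
  exact: continuous_measurable_fun.
rewrite (_ : mkset _ = setT `&` h @^-1` `[1, +oo[%classic).
  by apply: mh => //; exact: measurable_itv.
by apply/seteqP; split=> t /=; rewrite in_itv/= andbT => // -[].
Qed.

Lemma ge1_indic01 (h : R -> R) s : 0 <= ge1_indic h s <= 1.
Proof. by rewrite /ge1_indic indicE; case: (_ \in _); rewrite ?ler01 ?lexx. Qed.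

Lemma mean_ge1_indic01 (h : R -> R) : continuous h -> 0 <= mean (ge1_indic h) <= 1.
Proof.
move=> ch; have f01 := ge1_indic01 h.
have mf := @measurable_ge1_indic I h ch.
rewrite /mean ler_pdivrMl ?pi2_gt0// mulr1; apply/andP; split.
  apply: mulr_ge0; first by rewrite invr_ge0 ltW ?pi2_gt0.
  by apply: Rintegral_ge0 => s _; have /andP[] := f01 s.
rewrite -[2 * pi]mulr1 -Rintegral_I_cst; apply: le_Rintegral => //.
- by apply: integrable_le1 => // s _; have /andP[f0 f1] := f01 s; rewrite ger0_norm.
- by apply: continuous_I_integrable => s; exact: cvg_cst.
- by move=> s _; have /andP[] := f01 s.
Qed.

(** If v(t) <= 1 - eta and v(s) >= 1, the Lipschitz bound gives eta <= L |sin((s - t)/2)|, so that 1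
    - cos(t - s) = 2 sin^2((t - s)/2) is at least 2 eta^2 / L^2. This is the majorant that
    [poisson_small] asks for. *)
Lemma ge1_indic_le N (a b : nat -> R) (eta : R) (v := trigpoly N a b 1) :
  0 < eta -> exists2 C : R, 0 <= C & forall s t,
  v t <= 1 - eta -> ge1_indic v s <= C * (1 - cos (t - s)).
Proof.
move=> e0; have [L L0 HL] := trigpoly_lipschitz N a b.
have C0 : 0 <= L ^+ 2 / (2 * eta ^+ 2).
  by rewrite divr_ge0 ?sqr_ge0// mulr_ge0 ?sqr_ge0.
exists (L ^+ 2 / (2 * eta ^+ 2)) => // s t vt.
have cc : 0 <= 1 - cos (t - s) by rewrite subr_ge0 cos_le1.
rewrite /ge1_indic indicE; case: (boolP (_ \in _)) => [|_]; last exact: mulr_ge0.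
rewrite inE/= => vs.
have h1 : eta <= L * `|sin ((s - t) / 2)|.
  apply: le_trans (HL s t); apply: le_trans (ler_norm _); rewrite -/v; lra.
have h2 : 1 - cos (t - s) = 2 * `|sin ((s - t) / 2)| ^+ 2.
  rewrite real_normK ?num_real//.
  have -> : t - s = - (((s - t) / 2) *+ 2) by rewrite mulr2n; field.
  by rewrite cosN cos_mulr2n cos2sin2; ring.
have h3 : eta ^+ 2 <= (L * `|sin ((s - t) / 2)|) ^+ 2.
  by rewrite lerXn2r ?nnegrE ?(ltW e0)// mulr_ge0.
rewrite h2 mulrAC ler_pdivlMr ?mulr_gt0 ?exprn_gt0//= mul1r.
by rewrite exprMn in h3; lra.
Qed.

Lemma smoothed_indicator N (a b : nat -> R) (eta e : R)
  (v := trigpoly N a b 1) (f := ge1_indic v) :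
  0 < eta -> 0 < e -> e <= 1 -> exists n r r1, [/\ 0 < r, r < r1, r1 < 1,
    (forall rho t, `|rho * r| <= r1 ->
       - e <= trigpoly n.+1 (pcos r f) (psin r f) rho t <= 1 + e) &
    (forall t, v t <= 1 - eta -> trigpoly n.+1 (pcos r f) (psin r f) 1 t <= e)].
Proof.
move=> eta0 e0 e1; have [C C0 HC] := @ge1_indic_le N a b _ eta0.
have f01 := ge1_indic01 v.
have mf : measurable_fun I f by apply: measurable_ge1_indic; exact: continuous_trigpoly.
have C1 : 0 < 2 * (C + 1) by lra.
(* Both 1 - r and the tails are to be at most d; then C (1 - r + tail) <= 2 C d <= e. *)
pose d := e / (2 * (C + 1)).
have d0 : 0 < d by rewrite divr_gt0.
have Cd : 2 * (C + 1) * d = e by rewrite /d mulrC divfK// gt_eqF.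
have d2 : d <= 2^-1 by rewrite ler_pdivrMr//; lra.
have Cd0 : 0 <= C * d by rewrite mulr_ge0// ltW.
(* The gap between r and r1 allows radii rho up to r1 / r > 1. *)
pose r := 1 - d; pose r1 := (1 + r) / 2.
have r0 : 0 < r by rewrite /r; lra.
have rr1 : r < r1 by rewrite /r1 /r; lra.
have r11 : r1 < 1 by rewrite /r1 /r; lra.
have r10 : 0 <= r1 by lra.
have [n1 _ H1] := ptail_small r10 r11 d0.
have [n2 _ H2] := ptail_small (ltW r0) (lt_trans rr1 r11) d0.
pose n := maxn n1 n2.
have h1 : ptail n.+1 r1 <= d by apply: H1 => /=; rewrite ltnW// ltnS leq_maxl.
have h2 : ptail n.+1 r <= d by apply: H2 => /=; rewrite ltnW// ltnS leq_maxr.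
exists n.+1, r, r1; split=> //.
- move=> rho t rr.
  have := @poisson_ge _ n.+1 r r1 rho t f mf (fun s _ => f01 s) rr r11.
  have := @poisson_le _ n.+1 r r1 rho t f mf (fun s _ => f01 s) rr r11.
  by move=> p1 p2; apply/andP; split; lra.
- move=> t /HC fC.
  have := @poisson_small _ n r t C f mf C0 (ltW r0) (lt_trans rr1 r11)
    (fun s _ => f01 s) (fun s _ => fC s).
  have : C * (1 - r + ptail n.+1 r) <= C * (d + d).
    by rewrite ler_wpM2l//; rewrite /r; lra.
  lra.
Qed.

(** Since v(0) = 0 and k(0) = 0, the integrals of g v and - k u agree. The second is at most (pi/2)
    times the integral of |u|; the first is bounded below pointwise by (1 - eta) g - (M + 1) w,
    whose mean is known from g(0). *)
Lemma gd_duality N (a' b' : nat -> R) n (a b : nat -> R) (rho m eta w M : R)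
  (u := trigpoly N.+1 a' b' 1) (v := trigpoly N.+1 (fun k => - b' k) a' 1) :
  b' 0%N = 0 ->
  1 < rho -> 0 < m ->
  (forall q t, `|q| < rho -> m <= cos (trigpoly n.+1 a b q t)) ->
  b 0%N = 0 -> (forall t, 0 <= sin (trigpoly n.+1 a b 1 t)) ->
  0 < eta -> 0 <= w -> (forall t, `|v t| <= M) ->
  (forall t, v t <= 1 - eta -> gdre (trigpoly n.+1 a b 1 t)
     (trigpoly n.+1 (fun i => - b i) a 1 t) <= w) ->
  (1 - eta) * gdre (a 0%N) 0 - (M + 1) * w <= (pi / 2) * mean (fun t => `|u t|).
Proof.
move=> b'0 rho1 m0 cosX b0 sinX eta0 w0 vM Hw.
have cu : continuous u by exact: continuous_trigpoly.
have cv : continuous v by exact: continuous_trigpoly.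
have MV N' c' d' := @gd_mean_value R n N' a b c' d' rho m rho1 m0 cosX.
set x := trigpoly n.+1 a b in MV cosX sinX Hw.
set y := trigpoly n.+1 (fun i => - b i) a in MV Hw.
pose g t := gdre (x 1 t) (y 1 t); pose h t := gdim (x 1 t) (y 1 t).
have cx0 t : 0 < cos (x 1 t).
  by apply: lt_le_trans m0 (cosX _ _ _); rewrite normr1.
have Hx t := is_derive_trigpoly_t n.+1 a b 1 t.
have Hy t := is_derive_trigpoly_t n.+1 (fun i => - b i) a 1 t.
have cg : continuous g.
  by move=> t; exact: (is_derive_continuous (is_derive_gdre (cx0 t) (Hx t) (Hy t))).
have ch : continuous h.
  by move=> t; exact: (is_derive_continuous (is_derive_gdim (cx0 t) (Hx t) (Hy t))).
(* The constant u + i v = i isolates the mean of g. *)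
have MV1 : \int[mu]_(t in I) g t = 2 * pi * gdre (a 0%N) 0.
  have := MV 0%N (fun _ => 0) (fun _ => -1).
  rewrite b0 oppr0 gdim0 opprK mulr1 mulr0 addr0 => <-.
  apply: eq_Rintegral => t _.
  by rewrite /trigpoly !big_ord1 !mul0r cos0 sin0 expr0 /g; ring.
have MV2 : \int[mu]_(t in I) (g t * v t + h t * u t) = 0.
  have := MV N a' b'.
  by rewrite b0 b'0 oppr0 gdim0 mulr0 mul0r addr0 mulr0.
have igv : mu.-integrable I (EFin \o (fun t => g t * v t)).
  by apply: continuous_I_integrable => t; apply: cvgM; [exact: cg|exact: cv].
have ihu : mu.-integrable I (EFin \o (fun t => h t * u t)).
  by apply: continuous_I_integrable => t; apply: cvgM; [exact: ch|exact: cu].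
have iu : mu.-integrable I (EFin \o (fun t => `|u t|)).
  by apply: integrable_norm; exact: continuous_I_integrable.
have ig : mu.-integrable I (EFin \o g) by exact: continuous_I_integrable.
have B1 : \int[mu]_(t in I) (g t * v t) <= (pi / 2) * \int[mu]_(t in I) `|u t|.
  have -> : \int[mu]_(t in I) (g t * v t) = - \int[mu]_(t in I) (h t * u t).
    by move: MV2; rewrite RintegralD// => /eqP; rewrite addr_eq0 => /eqP.
  apply: le_trans (ler_norm _) _; rewrite normrN.
  apply: le_trans (le_normr_Rintegral _ _) _ => //.
  rewrite -RintegralZl//; apply: le_Rintegral => //.
  - exact: integrable_norm ihu.
  - exact: integrable_I_Zl.
  - by move=> t _; rewrite normrM ler_wpM2r// gdim_bounded.
(* Where v < 1 - eta, one has g <= w and g v >= - M g, and (M + 1 - eta) g <= (M + 1) w. *)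
have gv t : (1 - eta) * g t - (M + 1) * w <= g t * v t.
  have g0 : 0 <= g t by exact: gdre_ge0.
  have M0 : 0 <= M by exact: le_trans (vM 0).
  have Q0 : 0 <= (M + 1) * w by rewrite mulr_ge0// addr_ge0.
  have [vt|/ltW vt] := leP (1 - eta) (v t).
    by have := ler_wpM2r g0 vt; clear -Q0; lra.
  have vM' : - M <= v t by have := vM t; rewrite ler_norml => /andP[].
  have : 0 <= (w - g t) * (M + 1).
    by rewrite mulr_ge0 ?subr_ge0 ?addr_ge0//; exact: Hw.
  have : 0 <= g t * (v t + M) by rewrite mulr_ge0// -lerBlDr sub0r.
  have : 0 <= g t * eta by rewrite mulr_ge0// ltW.
  by clear; lra.
have B2 : 2 * pi * ((1 - eta) * gdre (a 0%N) 0 - (M + 1) * w)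
    <= \int[mu]_(t in I) (g t * v t).
  have <- : \int[mu]_(t in I) ((1 - eta) * g t - (M + 1) * w) =
     2 * pi * ((1 - eta) * gdre (a 0%N) 0 - (M + 1) * w).
    rewrite RintegralB//.
    - by rewrite (@RintegralZl _ _ _ mu _ g)// MV1 Rintegral_I_cst; ring.
    - exact: integrable_I_Zl.
    - by apply: continuous_I_integrable => t; exact: cvg_cst.
  apply: le_Rintegral => //.
  apply: integrable_I_B; first exact: integrable_I_Zl.
  by apply: continuous_I_integrable => t; exact: cvg_cst.
rewrite /mean [leRHS]mulrCA ler_pdivlMl ?pi2_gt0//.
exact: le_trans B2 B1.
Qed.
Lemma trigpoly_affine n (a b : nat -> R) (k d q t : R) :
  trigpoly n.+1 (fun i => k * (a i + if i is 0%N then d else 0))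
    (fun i => k * b i) q t = k * (trigpoly n.+1 a b q t + d).
Proof.
rewrite /trigpoly !big_ord_recl/= !mul0r !cos0 !sin0 !expr0.
rewrite [in RHS]mulrDr [in RHS]mulrDr mulr_sumr.
under eq_bigr do rewrite addr0.
rewrite [X in _ + X = _](eq_bigr (fun i : 'I_n => k * (q ^+ bump 0 i *
  (a (bump 0 i) * cos ((bump 0 i)%:R * t) +
   b (bump 0 i) * sin ((bump 0 i)%:R * t))))).
  by ring.
by move=> i _; ring.
Qed.

(** As pi/2 < 2, sin z <= 6 e <= 1/2, so the quotient is at most 12 e; the constant 20 leaves
    slack. *)
Lemma sin_small (k e z : R) : 0 <= e -> e <= 20^-1 -> 0 <= z -> k <= pi / 2 ->
  z <= k * (3 * e) -> sin z / (1 - sin z) <= 20 * e.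
Proof.
move=> e0 e20 z0 k2 ze.
have pe4 : pi < 4 :> R by have := pihalf_lt2 R; clear; lra.
have xs : sin z <= 6 * e.
  apply: le_trans (sin_lex z0) _; apply: le_trans ze _.
  rewrite mulrA ler_wpM2r//; clear -k2 pe4; lra.
have s1 : sin z <= 1 / 2 by clear -xs e20; lra.
rewrite ler_pdivrMr; last by clear -s1; lra.
have : 0 <= e * (1 / 2 - sin z) by rewrite mulr_ge0// subr_ge0.
by clear -xs e0; lra.
Qed.

Lemma gd_step N (a' b' : nat -> R) (c eta e M : R)
  (u := trigpoly N.+1 a' b' 1) (v := trigpoly N.+1 (fun k => - b' k) a' 1)
  (P := mean (ge1_indic v)) : b' 0%N = 0 -> 0 < c -> c <= 1 -> 0 < eta -> eta < 1 ->
  0 < e -> e <= 20^-1 -> (forall t, `|v t| <= M) ->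
  (1 - eta) * (lnterm c + ((pi / 2) / (1 + 4 * e) * (P + 2 * e) - acos c) / c)
    - (M + 1) * (20 * e) <= (pi / 2) * mean (fun t => `|u t|).
Proof.
move=> b'0 c0 c1 eta0 eta1 e0 e20 vM; have p0 := pi_gt0 R.
have [|n [r [r1 [r0 rr1 r11 U01 Us]]]] := @smoothed_indicator N.+1 (fun k => - b' k) a' eta e eta0 e0.
  by clear -e20; lra.
set f := ge1_indic _ in U01 Us.
set U := trigpoly _ _ _ in U01 Us.
have e4 : 0 < 1 + 4 * e by clear -e0; lra.
(* The smoothed indicator U lies in [-e, 1 + e], so x = k (U + 2 e) lies in [k e, k (1 + 3 e)], a
   compact part of ]0, pi/2[. Where v <= 1 - eta, U <= e and hence x <= 3 k e. *)
set k := (pi / 2) / (1 + 4 * e).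
have k0 : 0 < k by rewrite divr_gt0// divr_gt0.
have ke : k * (1 + 4 * e) = pi / 2 by rewrite /k divfK// gt_eqF.
pose a i := k * (pcos r f i + if i is 0%N then 2 * e else 0).
pose b i := k * psin r f i.
have XE rho t : trigpoly n.+1 a b rho t = k * (U rho t + 2 * e).
  exact: trigpoly_affine.
pose rho := r1 / r.
have rho1 : 1 < rho by rewrite ltr_pdivlMr// mul1r.
have Xb q t : `|q| < rho -> k * e <= trigpoly n.+1 a b q t <= k * (1 + 3 * e).
  move=> qr; have /(U01 _ t)/andP[h1 h2] : `|q * r| <= r1.
    rewrite normrM (gtr0_norm r0).
    by move: qr; rewrite /rho ltr_pdivlMr// => /ltW.
  rewrite -/U in h1 h2; rewrite XE !ler_pM2l//.
  by clear -h1 h2; apply/andP; split; lra.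
have kb : k * (1 + 3 * e) < pi / 2 by rewrite -ke ltr_pM2l//; clear -e0; lra.
have ke0 : 0 < k * e by rewrite mulr_gt0.
pose m := cos (k * (1 + 3 * e)).
have kb0 : 0 < k * (1 + 3 * e) by rewrite mulr_gt0//; clear -e0; lra.
have m0 : 0 < m.
  by apply: cos_gt0_pihalf; clear -kb kb0 p0; apply/andP; split; lra.
have cosX q t : `|q| < rho -> m <= cos (trigpoly n.+1 a b q t).
  move=> /(Xb q t)/andP[h1 h2]; apply: ler_cos_pi => //.
    by apply: le_trans h1; exact: ltW.
  by apply: ltW; apply: lt_trans kb _; clear -p0; lra.
have b0 : b 0%N = 0.
  rewrite /b /psin; under eq_Rintegral do rewrite mul0r addr0 sin0 mulr0.
  by rewrite Rintegral_I_cst !mulr0.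
have a0 : a 0%N = k * (P + 2 * e).
  rewrite /a /pcos; under eq_Rintegral do rewrite mul0r addr0 cos0 mulr1.
  by rewrite /ek expr0 mulr1 mul1r.
have n1 : `|1 : R| < rho by rewrite normr1.
have x0 t : 0 <= trigpoly n.+1 a b 1 t.
  by have /andP[h _] := Xb 1 t n1; apply: le_trans h; exact: ltW.
have sinX t : 0 <= sin (trigpoly n.+1 a b 1 t).
  apply: sin_ge0_pi; rewrite x0/=; have /andP[_ h] := Xb 1 t n1.
  by apply: le_trans h _; apply: ltW; apply: lt_trans kb _; clear -p0; lra.
have k2 : k <= pi / 2.
  by rewrite -ke ler_peMr//; [exact: ltW|clear -e0; lra].
have Hw t : v t <= 1 - eta -> gdre (trigpoly n.+1 a b 1 t)
     (trigpoly n.+1 (fun i => - b i) a 1 t) <= 20 * e.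
  move=> vt; apply: le_trans (gdre_le _ _ (sinX t)) _.
    exact: lt_le_trans m0 (cosX _ _ n1).
  apply: (@sin_small k) => //; first exact: ltW.
  rewrite XE ler_pM2l//; have := Us t vt; rewrite -/U; clear; lra.
have w0 : 0 <= 20 * e by rewrite mulr_ge0// ltW.
have := gd_duality b'0 rho1 m0 cosX b0 sinX eta0 w0 vM Hw.
apply: le_trans; rewrite lerB// ler_wpM2l//; first by rewrite subr_ge0 ltW.
have cv : continuous v by exact: continuous_trigpoly.
rewrite a0; have /andP[P0 P1] := mean_ge1_indic01 cv; rewrite -/P in P0 P1.
apply: gd_tangent => //; first by rewrite mulr_ge0 ?ltW//; clear -P0 e0; lra.
by rewrite -ke ltr_pM2l//; clear -P1 e0; lra.
Qed.

Lemma acosE (c : R) : 0 <= c <= 1 -> acos c = pi / 2 - asin c.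
Proof.
move=> /andP[c0 c1]; have c11 : -1 <= c <= 1 by rewrite c1 (le_trans _ c0)// lerN10.
have h1 := asin_lepi2 c11; have p0 := pi_gt0 R.
have h2 : 0 <= asin c.
  rewrite leNgt; apply/negP => h.
  have := asinK (_ : c \in `[-1, 1]); rewrite in_itv/= c11 => /(_ isT) sc.
  have : sin (asin c) < sin 0.
    by rewrite ltr_sin ?in_itv/= ?asin_geNpi2 ?h1//; clear -p0; apply/andP; split; lra.
  by rewrite sin0 sc ltNge c0.
apply: cos_inj; rewrite ?in_itv/=.
- by rewrite acos_ge0// acos_lepi.
- by clear -h1 h2 p0; apply/andP; split; lra.
- rewrite acosK ?in_itv//= cosB cos_pihalf sin_pihalf mul0r add0r mul1r.
  by rewrite asinK ?in_itv.
Qed.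

(** Let e tend to 0 in [gd_step] for fixed eta, then eta to 0; M bounds v alone and depends on
    neither. Multiplying by 2 c / pi normalizes the coefficient of P to 1. *)
Lemma weak_type_trigpoly N (a' b' : nat -> R) (c : R)
  (u := trigpoly N.+1 a' b' 1) (v := trigpoly N.+1 (fun k => - b' k) a' 1) :
  b' 0%N = 0 -> 0 < c -> c <= 1 ->
  mean (ge1_indic v) <= c * mean (fun t => `|u t|) + (1 - 2 / pi * asin c - 2 * c / pi * lnterm c).
Proof.
set P := mean _; set E := mean _ => b'0 c0 c1; have p0 := pi_gt0 R.
have cv : continuous v by exact: continuous_trigpoly.
have /andP[P0 P1] := mean_ge1_indic01 cv; rewrite -/P in P0 P1.
have [M0 HM0] := trigpoly_bounded N.+1 (fun k => - b' k) a' 1.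
pose M := `|M0|.
have M00 : 0 <= M by exact: normr_ge0.
have vM t : `|v t| <= M.
  by apply: le_trans (HM0 1 t _) _; rewrite ?normr1 ?ler_norm.
have Y0 : 0 <= pi / 2 * E.
  rewrite mulr_ge0 ?divr_ge0 ?(ltW p0)// mulr_ge0//.
    by rewrite invr_ge0 mulr_ge0// ltW.
  by apply: Rintegral_ge0 => t _.
set Y := pi / 2 * E in Y0.
pose X := lnterm c + (pi / 2 * P - acos c) / c.
(* Collects the errors linear in e: 2 pi / c from replacing Q by (pi/2) P, and 20 (M + 1) from the
   set where g is small. *)
pose K := 2 * pi / c + 20 * (M + 1).
have K0 : 0 < K by rewrite ltr_wpDr ?mulr_ge0 ?addr_ge0// divr_gt0// mulr_gt0.
have XE eta : 0 < eta -> eta < 1 -> (1 - eta) * X <= Y.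
  move=> h0 h1; apply/ler_addgt0Pr => d d0.
  pose e := Num.min 20^-1 (d / K).
  have e0 : 0 < e by rewrite /e lt_min invr_gt0 divr_gt0//= ltr0n.
  have e20 : e <= 20^-1 by rewrite /e ge_min lexx.
  have eK : K * e <= d.
    by rewrite mulrC -ler_pdivlMr// /e ge_min lexx orbT.
  pose Q := pi / 2 / (1 + 4 * e) * (P + 2 * e).
  have G : (1 - eta) * (lnterm c + (Q - acos c) / c) - (M + 1) * (20 * e) <= Y.
    exact: (gd_step b'0 c0 c1 h0 h1 e0 e20 vM).
  have e4 : 0 < 1 + 4 * e by clear -e0; lra.
  have QE : pi / 2 * P - 2 * pi * e <= Q.
    rewrite /Q [leRHS]mulrAC ler_pdivlMr//.
    have : 0 <= pi * e * (1 - P) by rewrite !mulr_ge0 ?subr_ge0// ltW.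
    have : 0 <= pi * e * e by rewrite !mulr_ge0// ltW.
    have : 0 <= pi * e by rewrite !mulr_ge0// ltW.
    by clear; nra.
  have : (1 - eta) * (X - 2 * pi / c * e) <= (1 - eta) * (lnterm c + (Q - acos c) / c).
    rewrite ler_wpM2l ?subr_ge0 ?(ltW h1)// /X -addrA lerD2l.
    rewrite [X in _ - X]mulrAC -mulrBl ler_wpM2r ?invr_ge0 ?(ltW c0)//.
    by clear -QE; lra.
  have : 0 <= eta * (2 * pi / c * e).
    by rewrite !mulr_ge0 ?invr_ge0// ltW.
  by move: eK G; rewrite /K; clear; lra.
have XY : X <= Y.
  have [|X0] := leP X 0; first by move=> /le_trans; apply.
  rewrite leNgt; apply/negP => YX.
  (* This eta makes (1 - eta) X the midpoint of X and Y, which exceeds Y. *)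
  have := XE ((X - Y) / (2 * X)); rewrite divr_gt0 ?mulr_gt0 ?subr_gt0//.
  rewrite ltr_pdivrMr ?mulr_gt0// => /(_ isT).
  have -> : (1 - (X - Y) / (2 * X)) * X = (X + Y) / 2 by field; rewrite gt_eqF.
  move=> H; have /H : X - Y < 1 * (2 * X) by clear -Y0 X0; lra.
  by clear -YX; lra.
have : 2 * c / pi * X <= 2 * c / pi * Y.
  by rewrite ler_wpM2l// !mulr_ge0 ?invr_ge0// ltW.
have cY (p z : R) : 0 < p -> 2 * c / p * (p / 2 * z) = c * z.
  by move=> ?; field; exact: lt0r_neq0.
rewrite [2 * c / pi * Y]cY// /X acosE; last by rewrite ltW.
have cX (p l s : R) : 0 < p -> 2 * c / p * (l + (p / 2 * P - (p / 2 - s)) / c)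
    = P + 2 * c / p * l - 1 + 2 / p * s.
  by move=> ?; field; rewrite !lt0r_neq0.
by rewrite cX//; clear; lra.
Qed.

End WeakTypeTrigPoly.

(** * Abel means and principal values *)

Section LayerCake.
Variable R : realType.
Local Notation mu := (@lebesgue_measure R).

(** m(s) is the length of the set of y in ]0, 1[ with y < m(s), and Fubini exchanges the integrals.
    Integrability is asked of g m only, because g will carry the singularity of the cotangent. *)
Lemma layer_cake (D : set R) (g m : R -> R) : measurable D ->
  measurable_fun D g -> measurable_fun setT m -> (forall s, 0 <= m s <= 1) ->
  mu.-integrable D (EFin \o (fun s => g s * m s)) ->
  let G y := \int[mu]_(s in [set s | D s /\ y < m s]) g s in
  mu.-integrable `]0, 1[ (EFin \o G) /\
  \int[mu]_(s in D) (g s * m s) = \int[mu]_(y in `]0, 1[) G y.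
Proof.
move=> mD mg mm m01 gmi G.
pose f (z : measurableTypeR R * measurableTypeR R) : \bar R :=
  if (0 < z.1) && (z.1 < m z.2) then ((g \_ D) z.2)%:E else 0%E.
have mgD : measurable_fun setT (g \_ D) by apply: (measurable_restrictT g _).1.
have mf : measurable_fun setT f.
  apply: measurable_fun_ifT => //.
  - apply: measurable_and.
      by apply: measurable_fun_ltr => //; exact: measurable_fst.
    apply: measurable_fun_ltr; first exact: measurable_fst.
    by apply: measurableT_comp => //; exact: measurable_snd.
  - apply/measurable_EFinP.
    by apply: measurableT_comp => //; exact: measurable_snd.
have intc (c : \bar R) s : (\int[mu]_y (if (0 < y)%R && (y < m s)%R then c else 0) = c * (m s)%:E)%E.
  have -> : (fun y => if (0 < y)%R && (y < m s)%R then c else 0%E) =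
      (cst c) \_ `]0, m s[.
    apply/funext => y; rewrite patchE; case: ifPn => [h|/negbTE h].
      by rewrite mem_set//= in_itv.
    by rewrite memNset//= in_itv/= h.
  rewrite -integral_mkcond integral_cst//; congr (_ * _)%E.
  apply: etrans (lebesgue_measure_itv `]0, m s[) _; rewrite /= lte_fin sube0; case: ifPn => // ; rewrite -leNgt => h.
  by have /andP[h0 _] := m01 s; have -> : m s = 0 by apply/eqP; rewrite eq_le h0 h.
have gme s : ((g \_ D) s * m s)%:E = ((EFin \o (fun s => g s * m s)) \_ D) s.
  by rewrite !patchE; case: ifPn => //=; rewrite mul0r.
have fi : (mu \x mu)%E.-integrable setT f.
  apply/(integrable21ltyP _ _ mf).
  have fiE s : (\int[mu]_y `|f (y, s)| = `|((EFin \o (fun s => g s * m s)%R) \_ D) s|)%E.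
    have /andP[ms0 _] := m01 s.
    rewrite -gme EFinM abseM [`|(m s)%:E|%E]gee0_abs ?lee_fin// -intc.
    by apply: eq_integral => y _; rewrite /f /=; case: ifP => // _; rewrite abse0.
  have : mu.-integrable setT ((EFin \o (fun s => g s * m s)) \_ D).
    by apply: (integrable_mkcond _ _).1.
  move=> /integrableP[_ H]; apply: le_lt_trans H; rewrite le_eqVlt; apply/orP; left; apply/eqP.
  by apply: eq_integral => s _; exact: fiE.
have F1 := integrable_fubini_F fi.
have GE y : 0 < y -> fubini_F mu f y = (G y)%:E.
  move=> y0; pose Dy := [set s | D s /\ y < m s].
  have DyE : Dy = D `&` (fun s => y < m s) @^-1` [set true].
    by apply/seteqP; split=> s /= [].
  have mDy : measurable Dy.
    by rewrite DyE; apply: (measurable_funTS (measurable_fun_ltr _ mm)).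
  rewrite /fubini_F /G /Rintegral -/Dy fineK.
    rewrite [RHS]integral_mkcond; apply: eq_integral => s _.
    rewrite /f /= y0 /= !patchE; case: ifPn => [h|/negP h].
      have [/set_mem Ds|Ds] := boolP (s \in D); first by rewrite mem_set.
      by rewrite memNset// => -[/mem_set]; rewrite (negbTE Ds).
    by rewrite memNset// => -[].
  apply: integrable_fin_num => //.
  (* On the layer y < m one has |g| <= |g m| / y, so g is integrable there. *)
  apply: (@le_integrable _ _ _ mu _ mDy _
      (EFin \o (fun s => y^-1 * (g s * m s)))).
  - apply/measurable_EFinP; apply: measurable_funS mg => //.
    by rewrite DyE; exact: subIsetl.
  - move=> s [Ds ys] /=; rewrite lee_fin !normrM mulrCA ler_peMr//.
    have ms0 : 0 < m s by exact: lt_trans ys.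
    by rewrite !gtr0_norm ?invr_gt0// mulrC ler_pdivlMr// mul1r ltW.
  - apply: (@integrableS _ _ _ mu D Dy) => //; first by move=> s [].
    by apply: (integrableZl _ _ gmi).
have G0 y : ~~ (0 < y < 1) -> fubini_F mu f y = 0%E.
  move=> h; rewrite /fubini_F; apply: integral0_eq => s _; rewrite /f /=.
  case: ifPn => // /andP[y0 ym]; move: h; rewrite y0/= -leNgt => y1.
  by have /andP[_ m1] := m01 s; have := lt_le_trans ym (le_trans m1 y1); rewrite ltxx.
have Gi : mu.-integrable `]0, 1[ (EFin \o G).
  apply: (@eq_integrable _ _ _ mu _ _ (fubini_F mu f)) => //.
    by move=> y; rewrite inE/= in_itv/= => /andP[y0 _]; rewrite /= GE.
  exact: integrableS F1.
split=> //; rewrite /Rintegral; congr fine.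
transitivity (\int[mu]_y fubini_F mu f y)%E.
  rewrite /fubini_F (Fubini fi) [LHS]integral_mkcond; apply: eq_integral => s _.
  rewrite -gme EFinM -intc; apply: eq_integral => y _.
  by rewrite /f.
rewrite [RHS]integral_mkcond; apply: eq_integral => y _; rewrite patchE.
case: ifPn; rewrite ?inE ?notin_setE/= in_itv/=; first by move=> /andP[y0 _]; rewrite GE.
by move=> /negP h; rewrite G0.
Qed.
End LayerCake.

(** * Chords and the cotangent in terms of cos and sin *)

Section CircleGeometry.
Variable R : realType.
Local Notation mu := (@lebesgue_measure R).
Implicit Types s t x : R.

Lemma cos_half_sqr x : 1 - cos x = 2 * sin (x / 2) ^+ 2.
Proof.
have {1}-> : x = (x / 2) *+ 2 by rewrite mulr2n; field.
by rewrite cos_mulr2n cos2sin2; ring.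
Qed.

(* Both sides are [0] when [sin (x / 2) = 0], by the convention [1 / 0 = 0]. *)
Lemma cot_half x : cot (x / 2) = sin x / (1 - cos x).
Proof.
rewrite cos_half_sqr /cot.
have -> : sin x = (cos (x / 2) * sin (x / 2)) *+ 2.
  by rewrite -sin_mulr2n; congr sin; rewrite mulr2n; field.
have [->|s0] := eqVneq (sin (x / 2)) 0.
  by rewrite invr0 !mulr0 mul0rn mul0r.
by rewrite mulr2n; field.
Qed.

Lemma chordE t s : chord (cis t) (cis s) = Num.sqrt (2 * (1 - cos (t - s))).
Proof.
rewrite /chord /=; congr Num.sqrt; rewrite cosB.
by have := cos2Dsin2 t; have := cos2Dsin2 s; lra.
Qed.

Lemma lt_chord (e : R) t s : 0 <= e ->
  (e < chord (cis t) (cis s)) = (e ^+ 2 < 2 * (1 - cos (t - s))).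
Proof.
move=> e0; rewrite chordE -{1}[e]ger0_norm// -sqrtr_sqr.
by rewrite !ltNge ler_sqrt ?sqr_ge0.
Qed.

Lemma cis_eqP t s : cis t = cis s -> cos t = cos s /\ sin t = sin s.
Proof. by move=> /(congr1 (@sval _ _)) /= [-> ->]. Qed.

Lemma measurable_inv : measurable_fun setT (@GRing.inv R).
Proof.
rewrite (_ : @GRing.inv R = fun x : R => if x == 0 then 0 else x^-1); last first.
  by apply/funext => x; case: eqP => // ->; rewrite invr0.
apply: measurable_fun_if => //; first exact: measurable_fun_eqr.
rewrite setTI (_ : _ @^-1` _ = [set x : R | x != 0]).
  apply: open_continuous_measurable_fun; first exact: open_neq.
  by move=> x; rewrite inE/= => x0; exact: inv_continuous.
by apply/seteqP; split=> x /= => [->|/negbTE].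
Qed.
End CircleGeometry.

(** * The truncated cotangent kernel *)

Section TruncatedKernel.
Variable R : realType.
Local Notation mu := (@lebesgue_measure R).
Local Notation I := (`[- @pi R, @pi R]%classic).
Implicit Types s t : R.

Lemma continuous_reflect (g : R -> R) t : continuous g -> continuous (fun s : R => g (t - s)).
Proof.
move=> cg s; apply: (@continuous_comp _ _ _ (fun s : R => t - s) g).
  by apply: cvgB; [exact: cvg_cst|exact: cvg_id].
exact: cg.
Qed.

Lemma measurable_cot_half t (D : set R) :
  measurable_fun D (fun s : R => cot ((t - s) / 2)).
Proof.
apply: measurable_funTS.
rewrite (_ : (fun s => _) = (fun s => sin (t - s) * (1 - cos (t - s))^-1)); last first.
  by apply/funext => s; exact: cot_half.
apply: measurable_funM.
  by apply: continuous_measurable_fun; exact: continuous_reflect (@continuous_sin R).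
apply: (measurableT_comp (@measurable_inv R)).
apply: continuous_measurable_fun => s; apply: cvgB; first exact: cvg_cst.
exact: (continuous_reflect (@continuous_cos R)).
Qed.

Lemma measurable_chord_gt t (e : R) : 0 <= e ->
  measurable [set s : R | s \in `[- pi, pi] /\ e < chord (cis t) (cis s)].
Proof.
move=> e0; rewrite (_ : mkset _ =
    I `&` (fun s => e ^+ 2 < 2 * (1 - cos (t - s))) @^-1` [set true]).
  apply: (measurable_fun_ltr (@measurable_cst _ _ _ _ I (e ^+ 2)) _) => //.
  apply: measurable_funTS; apply: continuous_measurable_fun => s.
  apply: cvgM; first exact: cvg_cst.
  by apply: cvgB; [exact: cvg_cst|exact: (continuous_reflect (@continuous_cos R))].
by apply/seteqP; split=> s /= []; rewrite lt_chord.
Qed.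

(** |cot(x/2)| <= 1 / |sin(x/2)|, which is 2 over the chord. *)
Lemma normr_cot_le t s (e : R) : 0 < e -> e < chord (cis t) (cis s) ->
  `|cot ((t - s) / 2)| <= 2 / e.
Proof.
move=> e0; rewrite lt_chord ?(ltW e0)// => h; rewrite cot_half.
have c0 : 0 < 1 - cos (t - s).
  by rewrite -(pmulr_rgt0 _ (ltr0n _ 2)) (lt_trans _ h)// exprn_gt0.
rewrite normrM normfV (gtr0_norm c0) ler_pdivrMr// mulrAC ler_pdivlMr//.
have P1 : 0 <= `|sin (t - s)| * e by rewrite mulr_ge0 ?normr_ge0 ?(ltW e0).
have P2 : 0 <= 2 * (1 - cos (t - s)) by rewrite mulr_ge0 ?(ltW c0).
rewrite -ler_sqr ?nnegrE// !exprMn real_normK ?num_real//.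
have := cos2Dsin2 (t - s); have := cos_geN1 (t - s); have := cos_le1 (t - s).
move: h c0; move: (cos _) (sin _) => C S h c0 C1 C2 CS.
have -> : S ^+ 2 = (1 - C) * (1 + C) by lra.
have q0 : 0 <= (1 - C) * (1 + C) by rewrite mulr_ge0 ?(ltW c0)//; lra.
have : 0 <= (1 - C) * (1 + C) * (2 * (1 - C) - e ^+ 2).
  by rewrite mulr_ge0// subr_ge0 ltW.
have : 0 <= (1 - C) ^+ 2 * (1 - C) by rewrite mulr_ge0 ?sqr_ge0// ltW.
lra.
Qed.

Lemma integrable_hilbert_trunc (f : circle R -> R) t (e : R) : inL1 f -> 0 < e ->
  mu.-integrable [set s : R | s \in `[- pi, pi] /\ e < chord (cis t) (cis s)]
    (EFin \o (fun s => f (cis s) * cot ((t - s) / 2))).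
Proof.
move=> f1 e0; have mD := measurable_chord_gt t (ltW e0).
apply: (@integrableM_bounded _ _ _ _ (2 / e)) => //.
- apply: (@integrableS _ _ _ mu I) => //.
  by move=> s [].
- exact: measurable_cot_half.
- by move=> s [_]; exact: normr_cot_le.
Qed.

End TruncatedKernel.

(** * Conjugate Poisson integrals and principal values *)

Section ConjugatePoisson.
Variable R : realType.
Local Notation mu := (@lebesgue_measure R).
Local Notation I := (`[- @pi R, @pi R]%classic).
Implicit Types s t x : R.

(* The conjugate Poisson kernel is [cot (x / 2)] times this weight, which
   increases with the chord [2 |sin (x / 2)|]; hence a conjugate Poisson
   integral is an average of truncated Hilbert transforms. *)
Definition hweight (r x : R) := r * (2 * (1 - cos x)) / poissonden r x.

Lemma poissonden_gt0 (r x : R) : 0 <= r -> r < 1 -> 0 < poissonden r x.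
Proof.
move=> r0 r1; apply: lt_le_trans (poissonden_ge r x).
by rewrite exprn_gt0// ger0_norm// subr_gt0.
Qed.

Lemma hweight01 (r x : R) : 0 <= r -> r < 1 -> 0 <= hweight r x <= 1.
Proof.
move=> r0 r1; have h := poissonden_gt0 x r0 r1; have c1 := cos_le1 x.
rewrite /hweight; apply/andP; split.
  by rewrite divr_ge0 ?(ltW h)// !mulr_ge0 ?subr_ge0.
rewrite ler_pdivrMr// mul1r /poissonden; have := sqr_ge0 (1 - r); lra.
Qed.

Lemma cot_hweight (r x : R) : 0 <= r -> r < 1 ->
  cot (x / 2) * hweight r x = 2 * r * sin x / poissonden r x.
Proof.
move=> r0 r1; have h := poissonden_gt0 x r0 r1.
rewrite cot_half /hweight; have [c0|c0] := eqVneq (1 - cos x) 0.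
  have -> : sin x = 0.
    have := cos2Dsin2 x; have -> : cos x = 1 by lra.
    by rewrite expr1n => /eqP; rewrite -subr_eq0 addrAC subrr add0r sqrf_eq0 => /eqP.
  by rewrite !mul0r mulr0 mul0r.
by field; rewrite c0 lt0r_neq0.
Qed.

(** With w the squared chord 2 (1 - cos x), the weight is r w / ((1 - r)^2 + r w). Solving y <
    weight for w gives the truncation radius, which tends to 0 as r tends to 1 for each fixed y. *)
Lemma lt_hweight (r x y : R) : 0 < r -> r < 1 -> 0 < y -> y < 1 ->
  (y < hweight r x) = (((1 - r) * Num.sqrt (y / (r * (1 - y)))) ^+ 2 < 2 * (1 - cos x)).
Proof.
move=> r0 r1 y0 y1; have h := poissonden_gt0 x (ltW r0) r1.
have ry : 0 < r * (1 - y) by rewrite mulr_gt0// subr_gt0.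
rewrite exprMn sqr_sqrtr; last by rewrite divr_ge0 ?ltW.
rewrite /hweight ltr_pdivlMr// [in RHS]mulrA ltr_pdivrMr// /poissonden.
rewrite -subr_gt0 -[in RHS]subr_gt0; congr (0 < _); ring.
Qed.

Lemma integrable_conj_poisson (F : R -> R) t (r : R) :
  mu.-integrable I (EFin \o F) -> 0 < r -> r < 1 -> mu.-integrable I
  (EFin \o (fun s => F s * (2 * r * sin (t - s) / poissonden r (t - s)))).
Proof.
move=> Fi r0 r1.
have cc : continuous (fun s : R => cos (t - s)) by exact: continuous_reflect (@continuous_cos R).
have cs : continuous (fun s : R => sin (t - s)) by exact: continuous_reflect (@continuous_sin R).
apply: (@integrableM_bounded _ _ _ _ (2 / (1 - r) ^+ 2)) => //.
  apply: measurable_funTS; apply: continuous_measurable_fun => s.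
  apply: cvgM.
    by apply: cvgM; [exact: cvg_cst|exact: cs].
  apply: cvgV; first by rewrite lt0r_neq0// poissonden_gt0// ltW.
  apply: cvgD; last exact: cvg_cst.
  apply: cvgB; first exact: cvg_cst.
  by apply: cvgM; [exact: cvg_cst|exact: cc].
move=> s _; have h := poissonden_gt0 (t - s) (ltW r0) r1.
have h1 : (1 - r) ^+ 2 <= poissonden r (t - s).
  by have := poissonden_ge r (t - s); rewrite gtr0_norm.
have q0 : 0 < (1 - r) ^+ 2 by rewrite exprn_gt0// subr_gt0.
rewrite normrM normfV (gtr0_norm h) ler_pM ?invr_ge0 ?(ltW h)//.
  rewrite !normrM (gtr0_norm r0) ger0_norm//.
  rewrite -[leRHS]mulr1 -mulrA ler_pM2l//.
  by rewrite -[leRHS]mulr1 ler_pM ?sin_max// ltW.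
by rewrite lef_pV2.
Qed.

Variables (f : circle R -> R) (t : R).
Hypothesis f1 : inL1 f.
Let F s := f (cis s).
Let A := hilbert_trunc f t.

Let Fi : mu.-integrable I (EFin \o F). Proof. exact: f1. Qed.

Let mw r : measurable_fun setT (fun s : R => hweight r (t - s)).
Proof.
have cc : continuous (fun s : R => cos (t - s)) by exact: continuous_reflect (@continuous_cos R).
apply: measurable_funM.
  apply: continuous_measurable_fun => s; apply: cvgM; first exact: cvg_cst.
  apply: cvgM; first exact: cvg_cst.
  by apply: cvgB; [exact: cvg_cst|exact: cc].
apply: (measurableT_comp (@measurable_inv R)).
apply: continuous_measurable_fun => s; apply: cvgD; last exact: cvg_cst.
apply: cvgB; first exact: cvg_cst.
by apply: cvgM; [exact: cvg_cst|exact: cc].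
Qed.

Lemma conj_poisson_layers (r : R) : 0 < r -> r < 1 ->
  let G y := A ((1 - r) * Num.sqrt (y / (r * (1 - y)))) in
  mu.-integrable `]0, 1[ (EFin \o G) /\
  (2 * pi)^-1 * \int[mu]_(s in I)
     (F s * (2 * r * sin (t - s) / poissonden r (t - s))) =
  \int[mu]_(y in `]0, 1[) G y.
Proof.
move=> r0 r1 G.
have [||||] := @layer_cake R I (fun s => F s * cot ((t - s) / 2))
   (fun s => hweight r (t - s)) (@mI R).
- apply: measurable_funM; last exact: measurable_cot_half.
  by apply/measurable_EFinP; exact: measurable_int Fi.
- exact: mw.
- by move=> s; exact: hweight01 (ltW r0) r1.
- apply: (@eq_integrable _ _ _ mu _ _
    (EFin \o (fun s => F s * (2 * r * sin (t - s) / poissonden r (t - s))))) => //.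
    by move=> s _ /=; rewrite -[in RHS]mulrA cot_hweight// ltW.
  exact: integrable_conj_poisson.
- move=> Gi GE; have AE y : 0 < y -> y < 1 -> G y = (2 * pi)^-1 *
     \int[mu]_(s in [set s | I s /\ y < hweight r (t - s)]) (F s * cot ((t - s) / 2)).
    move=> y0 y1; rewrite /G /A /hilbert_trunc; congr (_ * _).
    set e := (1 - r) * _.
    have e0 : 0 <= e by rewrite mulr_ge0 ?sqrtr_ge0// subr_ge0 ltW.
    have -> : [set s : R | s \in `[- pi, pi] /\ e < chord (cis t) (cis s)] =
        [set s | I s /\ y < hweight r (t - s)].
      by apply/seteqP; split=> s /= []; rewrite lt_chord// lt_hweight.
    by [].
  have AE' : {in `]0, 1[%classic, G =1 (fun y => (2 * pi)^-1 *
     \int[mu]_(s in [set s | I s /\ y < hweight r (t - s)]) (F s * cot ((t - s) / 2)))}.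
    by move=> y; rewrite inE/= in_itv/= => /andP[]; exact: AE.
  split.
    apply: (@eq_integrable _ _ _ mu _ _ (EFin \o (fun y => (2 * pi)^-1 *
     \int[mu]_(s in [set s | I s /\ y < hweight r (t - s)]) (F s * cot ((t - s) / 2))))) => //.
      by move=> y /AE' /= ->.
    by apply: (integrableZl _ _ Gi).
  transitivity (\int[mu]_(y in `]0, 1[) ((2 * pi)^-1 *
     \int[mu]_(s in [set s | I s /\ y < hweight r (t - s)]) (F s * cot ((t - s) / 2)))); last first.
    by apply: eq_Rintegral => y Iy; rewrite AE'.
  rewrite RintegralZl// -GE; congr (_ * _).
  by apply: eq_Rintegral => s _; rewrite -[in RHS]mulrA cot_hweight// ltW.
Qed.

(** Existence of the principal value bounds the truncations near e = 0 only; this bound covers the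
    others, so that a constant dominates all of them. *)
Lemma hilbert_trunc_bounded (e0 e : R) : 0 < e0 -> e0 <= e ->
  `|A e| <= (2 * pi)^-1 * (2 / e0 * \int[mu]_(s in I) `|F s|).
Proof.
move=> e00 e0e; have e_gt0 := lt_le_trans e00 e0e.
rewrite /A /hilbert_trunc normrM ger0_norm ?invr_ge0 ?(ltW (pi2_gt0 R))//.
rewrite ler_wpM2l ?invr_ge0 ?(ltW (pi2_gt0 R))//.
set De := mkset _.
have mDe : measurable De by exact: measurable_chord_gt (ltW e_gt0).
have DeI : De `<=` I by move=> s [].
have FDi : mu.-integrable De (EFin \o F)
  by apply: (@integrableS _ _ _ mu I De).
have Fci : mu.-integrable De (EFin \o (fun s => F s * cot ((t - s) / 2))).
  exact: integrable_hilbert_trunc.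
have cotb s : De s -> `|cot ((t - s) / 2)| <= 2 / e0.
  move=> [_ /(normr_cot_le e_gt0)/le_trans]; apply.
  by rewrite ler_pM2l// lef_pV2.
apply: le_trans (le_normr_Rintegral _ _) _ => //.
have aDe : mu.-integrable De (EFin \o (fun s => `|F s|)) by exact: integrable_norm FDi.
have aI : mu.-integrable I (EFin \o (fun s => `|F s|)) by exact: integrable_norm Fi.
apply: (@le_trans _ _ (\int[mu]_(s in De) (2 / e0 * `|F s|))).
  apply: le_Rintegral => //.
  - exact: integrable_norm Fci.
  - by apply: (integrableZl _ _ aDe).
  - by move=> s Ds; rewrite normrM mulrC ler_wpM2r// cotb.
rewrite RintegralZl// ler_wpM2l ?divr_ge0 ?(ltW e00)//.
rewrite /Rintegral fine_le//.
- exact: integrable_fin_num aDe.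
- exact: integrable_fin_num aI.
- by apply: ge0_subset_integral => //; exact: measurable_int aI.
Qed.

(** Dominated convergence in the layer variable y: each truncation radius tends to 0, so the
    integrand tends to l pointwise on ]0, 1[. *)
Lemma conj_poisson_cvg (l : R) (r_ : nat -> R) :
  A e @[e --> 0^'+] --> l -> (forall n, 0 < r_ n /\ r_ n < 1) ->
  r_ n @[n --> \oo] --> (1 : R) ->
  (2 * pi)^-1 * \int[mu]_(s in I)
     (F s * (2 * r_ n * sin (t - s) / poissonden (r_ n) (t - s))) @[n --> \oo] --> l.
Proof.
move=> Al r01 r1.
have [M MA] : exists M, forall e, 0 < e -> `|A e| <= M.
  have [e0 /= e00 H] : \forall e \near 0^'+, `|l - A e| <= 1.
    by move/cvgrPdist_le : Al; apply.
  exists (Num.max (`|l| + 1) ((2 * pi)^-1 * (2 / (e0 / 2) * \int[mu]_(s in I) `|F s|))).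
  move=> e ee0; rewrite le_max; have [h|h] := ltP e e0.
    apply/orP; left; have -> : A e = l - (l - A e) by ring.
    apply: le_trans (ler_normB _ _) _; rewrite lerD2l; apply: H => //=.
    by rewrite sub0r normrN gtr0_norm.
  apply/orP; right; apply: hilbert_trunc_bounded; first by rewrite divr_gt0.
  lra.
pose G n y := A ((1 - r_ n) * Num.sqrt (y / (r_ n * (1 - y)))).
have Gi n : mu.-integrable `]0, 1[ (EFin \o G n).
  by have [h0 h1] := r01 n; have [] := conj_poisson_layers h0 h1.
rewrite (_ : (fun n => _) = (fun n => \int[mu]_(y in `]0, 1[) G n y)); last first.
  by apply/funext => n; have [h0 h1] := r01 n; have [] := conj_poisson_layers h0 h1.
have M0 : 0 <= M by apply: le_trans (MA 1 ltr01).
have Ml : \int[mu]_(y in `]0, 1[) (cst l y) = l.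
  rewrite Rintegral_cst//= [X in fine X](_ : _ = 1%E) ?mulr1//.
  apply: etrans (lebesgue_measure_itv `]0, 1[) _.
  by rewrite /= lte_fin ltr01 sube0.
rewrite -[X in _ --> X]Ml.
have e_gt0 n y : y \in `]0, 1[ -> 0 < (1 - r_ n) * Num.sqrt (y / (r_ n * (1 - y))).
  rewrite in_itv/= => /andP[y0 y1]; have [h0 h1] := r01 n.
  by rewrite mulr_gt0 ?subr_gt0// sqrtr_gt0 divr_gt0// mulr_gt0// subr_gt0.
apply: fine_cvg; rewrite [X in _ --> X]fineK; last first.
  apply: (@integrable_fin_num _ _ _ mu) => //.
  apply: (@integrableS _ _ _ mu `[0, 1]) => //; first exact: subset_itv_oo_cc.
  by apply: continuous_Icc_integrable => s; exact: cvg_cst.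
apply: (@dominated_cvg _ _ _ mu _ _ _ _ (EFin \o cst M)) => //.
- by move=> n; exact: measurable_int (Gi n).
- move=> y Iy; apply: cvg_EFin; first exact: nearW.
  rewrite /G; apply: ((@cvg_at_rightP R A 0 l).1 Al); split.
    by move=> n; exact: e_gt0.
  have /andP[y0 y1] : 0 < y < 1 by move: Iy; rewrite /= in_itv.
  rewrite [X in _ --> X](_ : 0 = (1 - 1) * Num.sqrt (y * (1 * (1 - y))^-1)); last first.
    by rewrite subrr mul0r.
  apply: cvgM; first by apply: cvgB => //; exact: cvg_cst.
  apply: continuous_cvg; first exact: sqrt_continuous.
  apply: cvgM; first exact: cvg_cst.
  apply: cvgV; first by rewrite mul1r subr_eq0 gt_eqF.
  by apply: cvgM => //; exact: cvg_cst.
- apply: (@integrableS _ _ _ mu `[0, 1]) => //; first exact: subset_itv_oo_cc.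
  by apply: continuous_Icc_integrable => s; exact: cvg_cst.
- by move=> n y Iy /=; rewrite lee_fin; apply: MA; exact: e_gt0.
Qed.

End ConjugatePoisson.

(** * The upper bound *)

Section UpperBound.
Variable R : realType.
Local Notation mu := (@lebesgue_measure R).
Local Notation I := (`[- @pi R, @pi R]%classic).
Implicit Types s t : R.

(** Monotonicity of the outer measure, for [hilbert_ge1 f], whose measurability is not
    established. *)
Lemma le_lebesgue_outer (A B : set R) : A `<=` B -> (mu A <= mu B)%E.
Proof.
move=> AB; rewrite /lebesgue_measure /lebesgue_stieltjes_measure.
by rewrite /measure_extension; exact: le_mu_ext.
Qed.

Lemma measurable_superlevel (h : R -> R) (x : R) : continuous h ->
  measurable [set t : R | x <= h t].
Proof.
move=> ch; have mh : measurable_fun setT h by exact: continuous_measurable_fun.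
rewrite (_ : mkset _ = setT `&` h @^-1` `[x, +oo[%classic).
  by apply: mh => //; exact: measurable_itv.
by apply/seteqP; split=> t /=; rewrite in_itv/= andbT => // -[].
Qed.

Lemma measure_ge1 (h : R -> R) : continuous h ->
  mu ([set t | 1 <= h t] `&` I) = (2 * pi * mean (ge1_indic h))%:E.
Proof.
move=> ch; have mh := measurable_superlevel 1 ch.
rewrite /mean mulrA divff ?gt_eqF ?pi2_gt0// mul1r /Rintegral.
rewrite fineK; last first.
  apply: (@integrable_fin_num _ _ _ mu) => //.
  apply: integrable_le1; first exact: measurable_ge1_indic.
  by move=> s _; have /andP[f0 f1] := ge1_indic01 h s; rewrite ger0_norm.
by rewrite -(@integral_indic _ _ _ mu I (@mI R)).
Qed.

Lemma trigpolyZ n (a b : nat -> R) (k r t : R) :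
  trigpoly n (fun i => k * a i) (fun i => k * b i) r t = k * trigpoly n a b r t.
Proof. by rewrite mulr_sumr; apply: eq_bigr => i _; ring. Qed.

Lemma weak_type_poisson (F : R -> R) (c eta r : R) n
  (v := trigpoly n.+1 (fun k => - psin r F k) (pcos r F) 1) :
  mu.-integrable I (EFin \o F) -> 0 < c -> c <= 1 ->
  0 < eta -> eta < 1 -> 0 <= r -> r < 1 ->
  (mu ([set t | (1 - eta <= v t)%R] `&` I) <=
   (c / (1 - eta) * ((1 + 2 * ptail n r) * (\int[mu]_(t in I) `|F t|)%R) +
     2 * pi * D c)%R%:E)%E.
Proof.
move=> Fi c0 c1 e0 e1 r0 r1; have q0 : 0 < 1 - eta by rewrite subr_gt0.
pose k := (1 - eta)^-1; have k0 : 0 < k by rewrite invr_gt0.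
pose v' := trigpoly n.+1 (fun i => - (k * psin r F i)) (fun i => k * pcos r F i) 1.
pose u := trigpoly n.+1 (pcos r F) (psin r F) 1.
have v'E t : v' t = k * v t.
  rewrite /v' /v -trigpolyZ; congr (trigpoly _ _ _ _ _).
  by apply/funext => i; rewrite mulrN.
have -> : [set t | 1 - eta <= v t] = [set t | 1 <= v' t].
  apply/seteqP; split=> t /=; rewrite v'E /k mulrC ler_pdivlMr// ?mul1r//.
rewrite measure_ge1; last exact: continuous_trigpoly.
have psin0 : k * psin r F 0%N = 0.
  rewrite /psin; under eq_Rintegral do rewrite mul0r addr0 sin0 mulr0.
  by rewrite Rintegral_I_cst !mulr0.
have W := @weak_type_trigpoly R n (fun i => k * pcos r F i)
  (fun i => k * psin r F i) c psin0 c0 c1.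
rewrite -/v' in W; rewrite lee_fin.
have L := poisson_L1 n Fi r0 r1.
have uE : mean (fun t => `|trigpoly n.+1 (fun i => k * pcos r F i) (fun i => k * psin r F i) 1 t|)
   = k * mean (fun t => `|u t|).
  rewrite /mean mulrCA; congr (_ * _); rewrite -RintegralZl//.
    by apply: eq_Rintegral => t _; rewrite trigpolyZ normrM gtr0_norm.
  by apply: integrable_norm; apply: continuous_I_integrable; exact: continuous_trigpoly.
rewrite uE in W; have p2 := pi2_gt0 R.
apply: (@le_trans _ _ (2 * pi * (c * (k * mean (fun t => `|u t|)) + D c))).
  by rewrite ler_pM2l.
rewrite mulrDr lerD2r /mean.
have -> : 2 * pi * (c * (k * ((2 * pi)^-1 * \int[mu]_(t in I) `|u t|))) =
   c * k * \int[mu]_(t in I) `|u t|.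
  have H (p z : R) : p != 0 -> p * (c * (k * (p^-1 * z))) = c * k * z.
    by move=> p0; field.
  by rewrite H// gt_eqF.
by rewrite ler_wpM2l// mulr_ge0// ltW.
Qed.

Lemma cpoisson_approx (F : R -> R) (r t : R) n :
  mu.-integrable I (EFin \o F) -> 0 < r -> r < 1 ->
  `|trigpoly n.+1 (fun k => - psin r F k) (pcos r F) 1 t -
    (2 * pi)^-1 * \int[mu]_(s in I) (F s * (2 * r * sin (t - s) / poissonden r (t - s)))|
  <= (2 * pi)^-1 * (ptail n r * \int[mu]_(s in I) `|F s|).
Proof.
move=> Fi r0 r1; rewrite cpoisson_trigpoly// mul1r -mulrBr normrM.
have p2 : 0 < (2 * pi : R)^-1 by rewrite invr_gt0 pi2_gt0.
rewrite (gtr0_norm p2) ler_pM2l//.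
have i1 := integrable_mul_cpoissonk n r t Fi.
have i2 := integrable_conj_poisson t Fi r0 r1.
rewrite -RintegralB//; apply: le_trans (le_normr_Rintegral _ _) _ => //.
  exact: integrable_I_B.
have aF : mu.-integrable I (EFin \o (fun s => `|F s|)) by exact: integrable_norm Fi.
rewrite -RintegralZl//; apply: le_Rintegral => //.
- by apply: integrable_norm; exact: integrable_I_B.
- exact: integrable_I_Zl.
- move=> s _; rewrite -mulrBr normrM mulrC ler_wpM2r//.
  exact: cpoissonk_lim (ltW r0) r1.
Qed.

(** Where the principal value is l >= 1, the polynomials v_n tend to l and eventually exceed 1 -
    eta; the lowered level is needed as l may be 1, approached from below. Hence the set lies in the
    lower limit of the sets S n, each of measure at most X. *)
Lemma upper_bound_eta (f : circle R -> R) (c eta : R) : inL1 f ->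
  0 < c -> c <= 1 -> 0 < eta -> eta < 1 ->
  (arc_length (hilbert_ge1 f) <=
   (c / (1 - eta) * ((1 + 2 * eta) * (\int[mu]_(t in I) `|f (cis t)|)%R) +
     2 * pi * D c)%R%:E)%E.
Proof.
move=> f1 c0 c1 e0 e1; pose F t := f (cis t).
have Fi : mu.-integrable I (EFin \o F) by exact: f1.
set X := (c / _ * _ + _)%R.
pose r_ n : R := 1 - n.+2%:R^-1.
have r01 n : 0 < r_ n /\ r_ n < 1.
  by rewrite /r_; split; [rewrite subr_gt0 invf_lt1 ?ltr1n|rewrite ltrBlDr ltrDl invr_gt0].
have r1 : r_ n @[n --> \oo] --> (1 : R).
  rewrite -[X in _ --> X]subr0; apply: cvgB; first exact: cvg_cst.
  by have := @cvg_harmonic R; rewrite -cvg_shiftS.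
(* The bound eta serves the measure estimate, and 1/(n+1) the convergence of v_n. *)
have /choice[k_ Hk] : forall n, exists k, ptail k (r_ n) <= Num.min eta n.+1%:R^-1.
  move=> n; have [h0 h1] := r01 n.
  have [|k _ H] := ptail_small (e := Num.min eta n.+1%:R^-1) (ltW h0) h1.
    by rewrite lt_min e0 invr_gt0 ltr0n.
  by exists k; apply: H => /=.
pose v_ n := trigpoly (k_ n).+1 (fun k => - psin (r_ n) F k) (pcos (r_ n) F) 1.
have cv n : continuous (v_ n) by exact: continuous_trigpoly.
have v_cvg t l : is_hilbert f (cis t) l -> v_ n t @[n --> \oo] --> l.
  move=> [t' tt' Hl].
  (* The angle in [is_hilbert] may differ from t by a period; the kernel depends only on its cos and
     sin. *)
  have {}Hl : hilbert_trunc f t e @[e --> 0^'+] --> l.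
    rewrite (_ : hilbert_trunc f t = hilbert_trunc f t')//.
    apply/funext => e; rewrite /hilbert_trunc tt'; congr (_ * _).
    have [ct st] := cis_eqP tt'.
    by apply: eq_Rintegral => s _; rewrite !cot_half !sinB !cosB ct st.
  have W := conj_poisson_cvg f1 Hl r01 r1.
  rewrite -[l]add0r.
  pose w_ n := (2 * pi)^-1 * \int[mu]_(s in I)
     (F s * (2 * r_ n * sin (t - s) / poissonden (r_ n) (t - s))).
  rewrite (_ : (fun n => v_ n t) = (fun n => (v_ n t - w_ n) + w_ n)); last first.
    by apply/funext => n; rewrite subrK.
  apply: cvgD => //; apply/cvgr0Pnorm_le => e e_gt0.
  set N := \int[mu]_(s in I) `|F s| in X *.
  have N0 : 0 <= N by apply: Rintegral_ge0.
  have H : (2 * pi)^-1 * (n.+1%:R^-1 * N) @[n --> \oo] --> (0 : R).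
    rewrite [X in _ --> X](_ : 0 = (2 * pi)^-1 * (0 * N)); last by rewrite mul0r mulr0.
    apply: cvgM; first exact: cvg_cst.
    by apply: cvgM; [exact: cvg_harmonic|exact: cvg_cst].
  move/cvgr0Pnorm_le : H => /(_ e e_gt0); apply: filterS => n; apply: le_trans.
  have [h0 h1] := r01 n.
  apply: le_trans (cpoisson_approx t (k_ n) Fi h0 h1) _.
  apply: le_trans (ler_norm _).
  rewrite ler_wpM2l ?invr_ge0 ?(ltW (pi2_gt0 R))// ler_wpM2r//.
  by apply: le_trans (Hk n) _; rewrite ge_min lexx orbT.
pose S n := [set t : R | 1 - eta <= v_ n t] `&` I.
have mS n : measurable (S n).
  by apply: measurableI; [exact: measurable_superlevel|exact: measurable_itv].
have SX n : (mu (S n) <= X%:E)%E.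
  have [h0 h1] := r01 n.
  apply: le_trans (weak_type_poisson (k_ n) Fi c0 c1 e0 e1 (ltW h0) h1) _.
  rewrite lee_fin lerD2r ler_wpM2l ?divr_ge0 ?subr_ge0 ?(ltW c0) ?(ltW e1)//.
  rewrite ler_wpM2r ?Rintegral_ge0// lerD2l ler_wpM2l//.
  by apply: le_trans (Hk n) _; rewrite ge_min lexx.
pose B j := \bigcap_i S (j + i)%N.
have mB j : measurable (B j) by exact: bigcapT_measurable.
have ndB : nondecreasing_seq B.
  move=> i j ij; apply/subsetPset => t Bt l _.
  by have := Bt (j - i + l)%N Logic.I; rewrite addnA subnKC.
apply: (@le_trans _ _ (mu (\bigcup_j B j))).
  apply: le_lebesgue_outer => t [tI [l Hl l1]].
  have /cvgrPdist_lt /(_ eta e0) [j _ H] := v_cvg _ _ Hl.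
  exists j => // i _; split.
    have := H (j + i)%N (leq_addr _ _); rewrite /= ltr_distlC => /andP[h _]; apply: ltW; lra.
  by move: tI; rewrite /= !in_itv/= => /andP[/ltW -> ->].
have mUB : measurable (\bigcup_j B j) by exact: bigcup_measurable.
have := @nondecreasing_cvg_mu _ _ _ mu _ mB mUB ndB.
move=> H; rewrite -(cvg_lim _ H)//; apply: lime_le; first exact: cvgP H.
apply: nearW => j; apply: le_trans (SX j).
by apply: le_lebesgue_outer => t /(_ 0%N Logic.I); rewrite addn0.
Qed.

Lemma hilbert_upper_bound (f : circle R -> R) (c : R) : inL1 f ->
  0 < c -> c <= 1 ->
  (((2 * pi)^-1)%:E * arc_length (hilbert_ge1 f) <= (c * norm1 f + D c)%:E)%E.
Proof.
move=> f1 c0 c1; apply/lee_addgt0Pr => e e0.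
pose N := \int[mu]_(t in I) `|f (cis t)|.
have NE : norm1 f = (2 * pi)^-1 * N by [].
have p2 := pi2_gt0 R; have ip : 0 < (2 * pi : R)^-1 by rewrite invr_gt0.
have N0 : 0 <= norm1 f by rewrite NE mulr_ge0 ?(ltW ip)// Rintegral_ge0.
have cN : 0 <= c * norm1 f by exact: mulr_ge0 (ltW c0) N0.
(* The 6 comes from (1 + 2 h) / (1 - h) <= 1 + 6 h for 0 < h <= 1/2; the 1 keeps K positive when the
   norm is 0. *)
pose K := 6 * (c * norm1 f) + 1.
have K0 : 0 < K by rewrite /K; lra.
pose h := Num.min 2^-1 (e / K).
have h0 : 0 < h by rewrite lt_min invr_gt0 divr_gt0//= ltr0n.
have h2 : h <= 2^-1 by rewrite ge_min lexx.
have hK : h * K <= e by rewrite -ler_pdivlMr// ge_min lexx orbT.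
have h1 : h < 1 by lra.
have U := upper_bound_eta f1 c0 c1 h0 h1.
apply: (@le_trans _ _ ((2 * pi)^-1%:E * (c / (1 - h) * ((1 + 2 * h) * N) + 2 * pi * D c)%:E)%E).
  by rewrite lee_wpmul2l// lee_fin ltW.
rewrite -EFinM -EFinD lee_fin mulrDr (mulrA _ (2 * pi) (D c)) mulVf ?gt_eqF// mul1r.
rewrite [leRHS]addrAC lerD2r.
have -> : (2 * pi)^-1 * (c / (1 - h) * ((1 + 2 * h) * N)) =
    c * norm1 f * ((1 + 2 * h) / (1 - h))
  by rewrite NE; move: (2 * pi)^-1 (1 - h)^-1 => x y; ring.
have q : (1 + 2 * h) / (1 - h) <= 1 + 6 * h.
  by rewrite ler_pdivrMr; nra.
apply: le_trans (ler_wpM2l cN q) _.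
have : 0 <= h by exact: ltW.
by move: hK; rewrite /K; clear; lra.
Qed.

End UpperBound.

(** * The extremal functions *)

Section ImproperFTC.
Variable R : realType.
Local Notation mu := (@lebesgue_measure R).

Lemma FTC_segment (h G : R -> R) (a b : R) : a < b ->
  {in `[a, b], forall x : R, {for x, continuous h}} ->
  {in `[a, b], forall x : R, is_derive x 1 G (h x)} ->
  (\int[mu]_(x in `[a, b]) (h x)%:E = (G b - G a)%:E)%E.
Proof.
move=> ab ch DG; rewrite (@continuous_FTC2 _ h G)//.
- by apply: continuous_in_subspaceT => x; rewrite inE /=; exact: ch.
- have cG x : x \in `[a, b] -> {for x, continuous G}.
    by move=> /DG; exact: is_derive_continuous.
  split=> [x|//|//].
  + by move=> /subset_itv_oo_cc /DG [].
  + by apply: cvg_at_right_filter; apply: cG; rewrite in_itv/= lexx ltW.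
  + by apply: cvg_at_left_filter; apply: cG; rewrite in_itv/= lexx ltW.
- by move=> x /subset_itv_oo_cc /DG [_ <-]; rewrite derive1E.
Qed.

Lemma segment_exhaustion (a b : R) : a < b -> exists e : nat -> R,
  [/\ forall n, 0 < e n /\ a + e n < b - e n,
      forall n m, (n <= m)%N -> e m <= e n,
      e n @[n --> \oo] --> (0 : R),
      a + e n @[n --> \oo] --> a & b - e n @[n --> \oo] --> b].
Proof.
move=> ab; pose e n : R := (b - a) / 2 * n.+2%:R^-1; exists e.
have ba : 0 < (b - a) / 2 by rewrite divr_gt0 ?subr_gt0.
have ecvg : e n @[n --> \oo] --> (0 : R).
  rewrite -(mulr0 ((b - a) / 2)); apply: cvgM; first exact: cvg_cst.
  by have := @cvg_harmonic R; rewrite -cvg_shiftS.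
split=> // [n|n m nm||].
- have e1 : e n < (b - a) / 2 by rewrite /e ltr_pdivrMr// ltr_pMr// ltr1n.
  by split; [rewrite mulr_gt0 ?invr_gt0|lra].
- by rewrite ler_pM2l// lef_pV2 ?posrE// ler_nat !ltnS.
- by rewrite -[X in _ --> X]addr0; apply: cvgD => //; exact: cvg_cst.
- by rewrite -[X in _ --> X]subr0; apply: cvgB => //; exact: cvg_cst.
Qed.

(** Monotone convergence over an exhaustion by segments; finiteness of the integral is part of the
    conclusion. *)
Lemma ge0_FTC_open (h G : R -> R) (a b : R) : a < b ->
  {in `]a, b[, forall x : R, {for x, continuous h}} ->
  {in `]a, b[, forall x : R, is_derive x 1 G (h x)} ->
  {in `]a, b[, forall x : R, 0 <= h x} ->
  {for a, continuous G} -> {for b, continuous G} ->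
  (\int[mu]_(x in `]a, b[) (h x)%:E = (G b - G a)%:E)%E.
Proof.
move=> ab ch DG h0 cGa cGb.
have [e [/all_and2[e0 abn] le_e ecvg cvga cvgb]] := segment_exhaustion ab.
pose F n := `[a + e n, b - e n]%classic.
have Fsub n x : x \in `[a + e n, b - e n] -> x \in `]a, b[.
  rewrite !in_itv/= => /andP[h1 h2]; apply/andP; split.
    by apply: lt_le_trans h1; rewrite ltrDl.
  by apply: le_lt_trans h2 _; rewrite ltrBlDr ltrDl.
have ndF : {homo F : n m / (n <= m)%N >-> (n <= m)%O}.
  move=> n m nm; apply/subsetPset => x; rewrite /F /= !in_itv/= => /andP[h1 h2].
  have emn := le_e _ _ nm.
  apply/andP; split; first by apply: le_trans h1; rewrite lerD2l.
  by apply: le_trans h2 _; rewrite lerB.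
have UF : \bigcup_n F n = `]a, b[%classic.
  apply/seteqP; split=> [x [n _]|x]; first exact: Fsub.
  rewrite /= in_itv/= => /andP[ax xb].
  have m0 : 0 < Num.min (x - a) (b - x) by rewrite lt_min !subr_gt0 ax.
  have /cvgr0Pnorm_le/(_ _ m0)[n _ /(_ n (leqnn n))] := ecvg.
  rewrite /= gtr0_norm// le_min => /andP[h1 h2].
  exists n => //; rewrite /F /= in_itv/=; apply/andP; split; clear -h1 h2; lra.
have mh n : measurable_fun (F n) (EFin \o h).
  apply/measurable_EFinP; apply: subspace_continuous_measurable_fun.
    exact: measurable_itv.
  apply: continuous_in_subspaceT => x; rewrite inE /= => /Fsub; exact: ch.
have H : (\int[mu]_(x in F i) (h x)%:E)%E @[i --> \oo] --> (\int[mu]_(x in \bigcup_i F i) (h x)%:E)%E.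
  apply: (@ge0_nondecreasing_set_cvg_integral _ (measurableTypeR R) R F (EFin \o h) mu ndF).
  - by move=> n; exact: measurable_itv.
  - exact: mh.
  by move=> n x Fx; rewrite /= lee_fin; exact: h0 (Fsub _ _ Fx).
rewrite UF in H; rewrite -(cvg_lim _ H)//.
rewrite (_ : (fun i => _) = (fun n => (G (b - e n) - G (a + e n))%:E)); last first.
  apply/funext => n; apply: FTC_segment => //.
    by move=> x /Fsub; exact: ch.
  by move=> x /Fsub; exact: DG.
apply: cvg_lim => //; apply: cvg_EFin; first exact: nearW.
apply: cvgB.
  exact: (@cvg_comp _ _ _ (fun n => b - e n) G _ (nbhs b)).
exact: (@cvg_comp _ _ _ (fun n => a + e n) G _ (nbhs a)).
Qed.

(** For a signed integrand, known integrability makes the indefinite integral continuous up to the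
    end points, so both sides are limits over inner segments. *)
Lemma FTC_open (h G : R -> R) (a b : R) : a < b ->
  mu.-integrable `[a, b] (EFin \o h) ->
  {in `]a, b[, forall x : R, {for x, continuous h}} ->
  {in `]a, b[, forall x : R, is_derive x 1 G (h x)} ->
  {for a, continuous G} -> {for b, continuous G} ->
  \int[mu]_(x in `[a, b]) h x = G b - G a.
Proof.
move=> ab ih ch DG cGa cGb.
have [e [/all_and2[e0 abn] _ _ cvga cvgb]] := segment_exhaustion ab.
pose P x := \int[mu]_(x in `[a, x]) h x.
have [_ Pa Pb] : [/\ {in `]a, b[, continuous P}, P x @[x --> a^'+] --> P a & P x @[x --> b^'-] --> P b].
  apply/(continuous_within_itvP _ ab).
  exact: parameterized_integral_continuous (ltW ab) ih.
have lim_a (g : R -> R) (l : R) : g x @[x --> a^'+] --> l -> g (a + e n) @[n --> \oo] --> l.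
  move=> /cvg_at_rightP; apply; split=> [n|].
    by rewrite ltrDl.
  exact: cvga.
have lim_b (g : R -> R) (l : R) : g x @[x --> b^'-] --> l -> g (b - e n) @[n --> \oo] --> l.
  move=> /cvg_at_leftP; apply; split=> [n|].
    by rewrite ltrBlDr ltrDl.
  exact: cvgb.
have P0 : P a = 0.
  rewrite /P set_itv1 /Rintegral integral_set1//.
have -> : \int[mu]_(x in `[a, b]) h x = P b - P a by rewrite P0 subr0.
have H1 : P (b - e n) - P (a + e n) @[n --> \oo] --> P b - P a.
  by apply: cvgB; [exact: lim_b|exact: lim_a].
have H2 : G (b - e n) - G (a + e n) @[n --> \oo] --> G b - G a.
  by apply: cvgB; [apply: lim_b; exact: cvg_at_left_filter|apply: lim_a; exact: cvg_at_right_filter].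
apply: cvg_unique H1 _ => //; rewrite (_ : (fun n => P _ - P _) = (fun n => G (b - e n) - G (a + e n)))//.
apply/funext => n.
have sub x : x \in `[a + e n, b - e n] -> x \in `]a, b[.
  rewrite !in_itv/= => /andP[h1 h2]; apply/andP; split.
    by apply: lt_le_trans h1; rewrite ltrDl.
  by apply: le_lt_trans h2 _; rewrite ltrBlDr ltrDl.
have := FTC_segment (abn n) (fun x xi => ch x (sub x xi)) (fun x xi => DG x (sub x xi)).
move=> /(congr1 fine) /= <-; rewrite /P.
have iab c d : a <= c -> d <= b -> mu.-integrable `[c, d] (EFin \o h).
  move=> ac db; apply: (integrableS _ _ _ ih) => // x /=; rewrite !in_itv/= => /andP[h1 h2].
  by rewrite (le_trans ac h1) (le_trans h2 db).
have ale : a <= a + e n by rewrite lerDl (ltW (e0 n)).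
have ble : b - e n <= b by rewrite gerDl oppr_le0 (ltW (e0 n)).
rewrite Rintegral_itvB.
- apply: Rintegral_itv_obnd_cbnd; apply: (integrableS _ _ _ (iab _ _ ale ble)) => //.
  by move=> x /=; exact: subset_itv_oc_cc.
- exact: iab.
- by rewrite bnd_simp.
- by rewrite bnd_simp ltW.
Qed.

End ImproperFTC.

(** * The extremal function and its supporting arc *)

Section Extremal.
Variable R : realType.
Local Notation mu := (@lebesgue_measure R).
Local Notation I := (`[- @pi R, @pi R]%classic).
Implicit Types c s t : R.

(* At [e^{is}] with [|s| <= pi] the value is [- sin (s/2) / qroot c s], hence
   [0] when [cos^2 (s/2) <= c^2], because there the square root is [0]. *)
Definition extremal c (z : circle R) : R :=
  - complex.Im (sval z) / Num.sqrt
    ((1 + complex.Re (sval z)) * (1 + complex.Re (sval z) - 2 * c ^+ 2)).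

Definition qroot c s := Num.sqrt (cos (s / 2) ^+ 2 - c ^+ 2).
Local Notation al c := (2 * acos c).
Local Notation b c := (Num.sqrt (1 - c ^+ 2)).

Lemma cos_half_norm s : cos (`|s| / 2) = cos (s / 2).
Proof. by have [|] := ger0P s => _ //; rewrite mulNr cosN. Qed.

Lemma cos_half_ge0 s : `|s| <= pi -> 0 <= cos (s / 2).
Proof.
by rewrite ler_norml => /andP[h1 h2]; apply: cos_ge0_pihalf; apply/andP; split; lra.
Qed.

Lemma qroot_ge0 c s : 0 <= qroot c s. Proof. exact: sqrtr_ge0. Qed.

Lemma extremal_cis c s : `|s| <= pi ->
  extremal c (cis s) = - sin (s / 2) / qroot c s.
Proof.
move=> /cos_half_ge0 C0; rewrite /extremal /=.
set C := cos (s / 2) in C0 *; set S := sin (s / 2).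
have -> : sin s = 2 * C * S.
  have {1}-> : s = (s / 2) *+ 2 by rewrite mulr2n; field.
  by rewrite sin_mulr2n -mulr_natl -/C -/S; ring.
have -> : cos s = 2 * C ^+ 2 - 1.
  have {1}-> : s = (s / 2) *+ 2 by rewrite mulr2n; field.
  by rewrite cos_mulr2n -/C; ring.
rewrite (_ : (1 + _) * _ = (2 * C) ^+ 2 * (C ^+ 2 - c ^+ 2)); last by ring.
have C20 : 0 <= 2 * C by rewrite mulr_ge0.
rewrite sqrtrM ?sqr_ge0// sqrtr_sqr ger0_norm// -/(qroot c s).
(* When cos(s/2) = 0, both denominators vanish and both quotients are 0 by convention. *)
have [C00|C_neq0] := eqVneq C 0; last first.
  have [->|q0] := eqVneq (qroot c s) 0; first by rewrite !(mulr0, invr0).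
  by field; rewrite q0.
have -> : qroot c s = 0.
  by rewrite /qroot -/C C00 ler0_sqrtr// expr0n/= sub0r oppr_le0 sqr_ge0.
by rewrite C00 mulr0 mul0r oppr0 mul0r invr0 mulr0.
Qed.

Section Arc.
Variable c : R.
Hypothesis c01 : 0 < c < 1.

Let c_gt0 : 0 < c. Proof. by case/andP: c01. Qed.
Let c11 : -1 <= c <= 1.
Proof.
case/andP: c01 => c0 c1.
by rewrite (ltW c1) (le_trans _ (ltW c0))// oppr_le0.
Qed.

Lemma b_sqr : b c ^+ 2 = 1 - c ^+ 2.
Proof.
by case/andP: c01 => c0 c1; rewrite sqr_sqrtr// subr_ge0 expr_le1// ltW.
Qed.

Lemma b_gt0 : 0 < b c.
Proof.
by case/andP: c01 => c0 c1; rewrite sqrtr_gt0 subr_gt0 expr_lt1// ltW.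
Qed.

Lemma acos_bounds : 0 < acos c < pi / 2.
Proof.
case/andP: c01 => c0 c1; apply/andP; split.
  by rewrite acos_gt0// c1 andbT; case/andP: c11.
rewrite acosE ?(ltW c0) ?(ltW c1)// gtrDl oppr_lt0.
rewrite -ltr_sin ?in_itv/= ?asin_geNpi2 ?asin_lepi2//.
  by rewrite sin0 asinK// in_itv.
by rewrite oppr_le0 divr_ge0 ?pi_ge0.
Qed.

Lemma al_gt0 : 0 < al c.
Proof. by case/andP: acos_bounds => h _; rewrite mulr_gt0. Qed.

Lemma al_ltpi : al c < pi.
Proof. by case/andP: acos_bounds => _; rewrite ltr_pdivlMr// mulrC. Qed.

Lemma cos_half_gt s : `|s| < al c -> c < cos (s / 2).
Proof.
rewrite mulrC -ltr_pdivrMr// => sal; rewrite -cos_half_norm.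
have s0 : 0 <= `|s| / 2 by rewrite divr_ge0.
case/andP: acos_bounds => a0 ap.
rewrite -[ltLHS](@acosK _ c) ?in_itv// ltr_cos// in_itv/=.
  by rewrite s0 (le_trans (ltW (lt_trans sal ap)))// ler_piMr ?pi_ge0// invf_le1// ler1n.
by rewrite (ltW a0) (le_trans (ltW ap))// ler_piMr ?pi_ge0// invf_le1// ler1n.
Qed.

Lemma cos_half_le s : al c <= `|s| -> `|s| <= pi -> cos (s / 2) <= c.
Proof.
rewrite mulrC -ler_pdivlMr// => sal sp; rewrite -cos_half_norm.
case/andP: acos_bounds => a0 _.
rewrite -[leRHS](@acosK _ c) ?in_itv//; apply: ler_cos_pi => //; first exact: ltW.
by rewrite ler_pdivrMr//; apply: le_trans sp _; rewrite ler_peMr ?pi_ge0// ler1n.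
Qed.

Lemma qroot_eq0 s : al c <= `|s| -> `|s| <= pi -> qroot c s = 0.
Proof.
move=> h1 h2; apply: ler0_sqrtr; rewrite subr_le0.
by rewrite ler_sqr ?nnegrE ?cos_half_ge0 ?(ltW c_gt0)// cos_half_le.
Qed.

Lemma cos_half_gt0 s : `|s| < al c -> 0 < cos (s / 2).
Proof. by move=> /cos_half_gt; exact: lt_trans c_gt0. Qed.

Lemma qroot_gt0 s : `|s| < al c -> 0 < qroot c s.
Proof.
move=> sal; rewrite sqrtr_gt0 subr_gt0 ltr_sqr ?nnegrE ?(ltW c_gt0)//.
  exact: cos_half_gt.
by rewrite ltW// cos_half_gt0.
Qed.

Lemma cos_half_al : cos (al c / 2) = c.
Proof. by rewrite [2 * _]mulrC mulfK// acosK ?in_itv. Qed.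

Lemma cos_half_ge s : `|s| <= al c -> c <= cos (s / 2).
Proof.
rewrite le_eqVlt => /predU1P[sal|/cos_half_gt/ltW//].
by rewrite -cos_half_norm sal cos_half_al.
Qed.

Lemma qroot_sqr s : `|s| <= al c -> qroot c s ^+ 2 = cos (s / 2) ^+ 2 - c ^+ 2.
Proof.
move=> /cos_half_ge h; rewrite sqr_sqrtr// subr_ge0.
by rewrite ler_sqr ?nnegrE ?(le_trans _ h) ?(ltW c_gt0).
Qed.

Lemma is_derive_half (f : R -> R) s df : is_derive (s / 2) 1 f df ->
  is_derive s 1 (fun x => f (x / 2)) (df / 2).
Proof.
move=> Df; have D1 : is_derive s 1 ( *%R^~ (2^-1 : R)) (2^-1 : R).
  rewrite (_ : *%R^~ _ = 2^-1 *: id); last by apply/funext => x; rewrite /GRing.scale/= mulrC.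
  by apply: is_derive_eq; rewrite /GRing.scale/= mulr1.
exact: (@is_derive1_comp _ f ( *%R^~ (2^-1 : R)) s).
Qed.

Lemma is_derive_qroot s : `|s| < al c ->
  is_derive s 1 (qroot c) (- (cos (s / 2) * sin (s / 2)) / (2 * qroot c s)).
Proof.
move=> sal; have q0 := qroot_gt0 sal.
have D1 := is_derive_half (is_derive_cos (s / 2)).
have D2 := is_deriveB (is_deriveM D1 D1) (is_derive_cst (c ^+ 2) s 1).
have p : 0 < ((fun x : R => cos (x / 2)) * (fun x : R => cos (x / 2)) - cst (c ^+ 2)) s.
  rewrite !fctE -expr2 subr_gt0 ltr_sqr ?nnegrE ?(ltW c_gt0)// ?cos_half_gt//.
  by rewrite ltW// cos_half_gt0.
have D3 := is_derive1_comp (is_derive1_sqrt p) D2.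
rewrite [X in is_derive _ _ X](_ : qroot c = Num.sqrt \o ((fun x : R => cos (x / 2)) * (fun x : R => cos (x / 2)) - cst (c ^+ 2))); last first.
  by apply/funext => x; rewrite /qroot expr2.
apply: is_derive_eq D3 _; rewrite !fctE -expr2 -/(qroot c s) /GRing.scale/=.
by field; rewrite gt_eqF.
Qed.

Lemma continuous_cos_half : continuous (fun s : R => cos (s / 2)).
Proof. by move=> s; exact: is_derive_continuous (is_derive_half (is_derive_cos _)). Qed.

Lemma continuous_sin_half : continuous (fun s : R => sin (s / 2)).
Proof. by move=> s; exact: is_derive_continuous (is_derive_half (is_derive_sin _)). Qed.

Lemma continuous_qroot : continuous (qroot c).
Proof.
move=> s; apply: (@continuous_comp _ _ _ (fun s => cos (s / 2) ^+ 2 - c ^+ 2) Num.sqrt).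
  apply: cvgB; last exact: cvg_cst.
  by have h := @continuous_cos_half s; exact: (cvgM h h).
exact: sqrt_continuous.
Qed.

(** On the arc this is ln c + arcosh(cos(s/2) / c), half a primitive of the extremal function. *)
Definition lnpart s := ln (cos (s / 2) + qroot c s).

Lemma is_derive_lnpart s : `|s| < al c ->
  is_derive s 1 lnpart (- sin (s / 2) / (2 * qroot c s)).
Proof.
move=> sal; have q0 := qroot_gt0 sal; have C0 := cos_half_gt0 sal.
have D := is_deriveD (is_derive_half (is_derive_cos (s / 2))) (is_derive_qroot sal).
have p : 0 < ((fun x : R => cos (x / 2)) + qroot c) s by rewrite !fctE addr_gt0.
have D2 := is_derive1_comp (is_derive1_ln p) D.
apply: is_derive_eq D2 _; rewrite !fctE /GRing.scale/=.
by field; rewrite !gt_eqF// addr_gt0.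
Qed.

Lemma continuous_lnpart s : `|s| <= al c -> {for s, continuous lnpart}.
Proof.
move=> sal; have cc := @continuous_cos_half s; have cq := @continuous_qroot s.
apply: (@continuous_comp _ _ _ (fun s => cos (s / 2) + qroot c s) (@ln R)).
  exact: (cvgD cc cq).
by apply: continuous_ln; rewrite ltr_wpDr ?qroot_ge0// (lt_le_trans c_gt0)// cos_half_ge.
Qed.

End Arc.
End Extremal.

(** * An explicit primitive of f(s) cot((t - s)/2) *)

Section Primitive.
Variables (R : realType) (c : R).
Hypothesis c01 : 0 < c < 1.
Implicit Types s t : R.
Local Notation al := (2 * acos c).
Local Notation b := (Num.sqrt (1 - c ^+ 2)).
Local Notation q := (qroot c).

Let c_gt0 : 0 < c. Proof. by case/andP: c01. Qed.

(* Equal to [2 * asin (sin (s/2) / sqrt (1 - c^2))], written so that it is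
   differentiable without reference to the end points of [asin]. *)
Definition atanpart s := 4 * atan (sin (s / 2) / (b + q s)).

Lemma is_derive_atanpart s : `|s| < al ->
  is_derive s 1 atanpart (cos (s / 2) / q s).
Proof.
move=> sal; have q0 := qroot_gt0 c01 sal; have b0 := b_gt0 c01.
have p : (cst b + q) s != 0 by rewrite !fctE gt_eqF// addr_gt0.
have D1 := is_deriveM (is_derive_half (is_derive_sin (s / 2)))
  (is_deriveV p (is_deriveD (is_derive_cst b s 1) (is_derive_qroot c01 sal))).
have D2 := is_deriveZ 4 (is_derive1_comp (is_derive1_atan _) D1).
apply: is_derive_eq D2 _; rewrite !fctE /GRing.scale/=.
have := qroot_sqr c01 (ltW sal); have := b_sqr c01; have := cos2Dsin2 (s / 2).
move: q0 b0; move: (q s) (b) (cos (s / 2)) (sin (s / 2)) => Q B C S Q0 B0 H1 H2 H3.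
have BQ : 0 < B + Q by rewrite addr_gt0.
have p1 : 0 < (B + Q) ^+ 2 + S ^+ 2 by rewrite ltr_wpDr ?sqr_ge0 ?exprn_gt0.
have -> : (1 + (S / (B + Q)) ^+ 2)^-1 = (B + Q) ^+ 2 / ((B + Q) ^+ 2 + S ^+ 2).
  by field; rewrite !gt_eqF// ltr_wpDr ?sqr_ge0 ?exprn_gt0.
have -> : (B + Q) ^+ 2 + S ^+ 2 = 2 * B * (B + Q) by move: H1 H2 H3; clear; lra.
have E : S ^+ 2 = B ^+ 2 - Q ^+ 2 by move: H1 H2 H3; clear; lra.
transitivity (C * (S ^+ 2 + Q * B + Q ^+ 2) / (B * Q * (B + Q))).
  by field; rewrite !gt_eqF.
by rewrite E; field; rewrite !gt_eqF.
Qed.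

(** Let A be the part without q. Then A^2 - q(s)^2 q(t)^2 = (c b sin((t - s)/2))^2, so [logpart] is
    ln(c b) + arcosh(A / (c b |sin((t - s)/2)|)) for s on the arc. The square inside its second
    logarithm covers both sides of s = t. *)
Definition lognum t s := cos (s / 2) * cos (t / 2) - c ^+ 2 * cos ((t - s) / 2) + q s * q t.

Definition logpart t s := ln (lognum t s) - 2^-1 * ln (sin ((t - s) / 2) ^+ 2).

Lemma lognum_gt0 t s : `|t| < al -> `|s| <= al -> 0 < lognum t s.
Proof.
move=> tal sal; rewrite /lognum.
have h1 := cos_half_gt c01 tal; have h2 := cos_half_ge c01 sal.
have h3 : 0 <= q s * q t by rewrite mulr_ge0// qroot_ge0.
have h4 := cos_le1 ((t - s) / 2); have := c_gt0 => c0.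
have : c ^+ 2 * cos ((t - s) / 2) <= c ^+ 2 by rewrite ler_piMr ?sqr_ge0.
have : c ^+ 2 < cos (s / 2) * cos (t / 2).
  rewrite expr2; apply: (@lt_le_trans _ _ (c * cos (t / 2))); first by rewrite ltr_pM2l.
  by rewrite ler_pM2r// (lt_trans c0).
by move: h3; clear; lra.
Qed.

Lemma is_derive_logpart t s : `|t| < al -> `|s| < al -> sin ((t - s) / 2) != 0 ->
  is_derive s 1 (logpart t) (q t / (2 * sin ((t - s) / 2) * q s)).
Proof.
move=> tal sal tsn; have q0 := qroot_gt0 c01 sal; have N0 := lognum_gt0 tal (ltW sal).
have Dh : is_derive s 1 (fun s => (t - s) / 2) (- 2^-1 : R).
  rewrite (_ : (fun _ => _) = 2^-1 *: (cst t - id)); last first.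
    by apply/funext => x; rewrite !fctE /GRing.scale/= mulrC.
  by apply: is_derive_eq; rewrite /GRing.scale/=; ring.
have Dc := is_derive1_comp (is_derive_cos _) Dh.
have Ds := is_derive1_comp (is_derive_sin _) Dh.
have DN : is_derive s 1 (lognum t) (- sin (s / 2) / 2 * cos (t / 2) - c ^+ 2 * (sin ((t - s) / 2) / 2)
   - (cos (s / 2) * sin (s / 2)) / (2 * q s) * q t).
  have D1 := is_deriveZ (cos (t / 2)) (is_derive_half (is_derive_cos (s / 2))).
  have D2 := is_deriveZ (c ^+ 2) Dc.
  have D3 := is_deriveZ (q t) (is_derive_qroot c01 sal).
  rewrite (_ : lognum t = cos (t / 2) *: (fun x : R => cos (x / 2)) -
      c ^+ 2 *: (cos \o (fun s => (t - s) / 2)) + q t *: q); last first.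
    by apply/funext => x; rewrite !fctE /lognum /GRing.scale/=; ring.
  apply: is_derive_eq (is_deriveD (is_deriveB D1 D2) D3) _.
  by rewrite /GRing.scale/=; ring.
have Dl := is_derive1_comp (is_derive1_ln N0) DN.
have S0 : 0 < ((sin \o (fun s => (t - s) / 2)) * (sin \o (fun s => (t - s) / 2))) s.
  by rewrite !fctE/= -expr2 exprn_even_gt0.
have Dm := is_deriveZ 2^-1 (is_derive1_comp (is_derive1_ln S0) (is_deriveM Ds Ds)).
have := is_deriveB Dl Dm.
rewrite [X in is_derive _ _ X](_ : _ = logpart t); last first.
  by apply/funext => x; rewrite !fctE /logpart expr2.
move=> D; apply: is_derive_eq D _; rewrite !fctE /GRing.scale/=.
have p0 := qroot_gt0 c01 tal.
have := qroot_sqr c01 (ltW sal); have := qroot_sqr c01 (ltW tal).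
have := cos2Dsin2 (s / 2); have := cos2Dsin2 (t / 2).
move: N0 tsn; rewrite /lognum.
rewrite mulrBl cosB sinB.
move: q0 p0.
move: (q s) (q t) (cos (s / 2)) (sin (s / 2)) (cos (t / 2)) (sin (t / 2)).
move=> Q P C S X Y Q0 P0 N0 tsn H1 H2 H3 H4.
have E1 : C * (X * C + Y * S) - S * (Y * C - X * S) = X.
  by transitivity (X * (C ^+ 2 + S ^+ 2)); [ring|rewrite H2 mulr1].
have E2 : (Y * C - X * S) ^+ 2 + (X * C + Y * S) ^+ 2 = 1.
  by transitivity ((X ^+ 2 + Y ^+ 2) * (C ^+ 2 + S ^+ 2)); [ring|rewrite H1 H2 mulr1].
move: (X * C + Y * S) (Y * C - X * S) E1 E2 N0 tsn => g h E1 E2 N0 h0.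
set N := (X in 0 < X) in N0 *.
(* Here g and h are the cos and sin of (t - s)/2. The identity makes N divide the numerator of the
   derivative, leaving P / (2 h Q). *)
have K : Q * (- S * X * h - c ^+ 2 * h ^+ 2 + N * g) - C * S * P * h = N * P.
  transitivity (Q * (X * (C * g - S * h) - c ^+ 2 * (h ^+ 2 + g ^+ 2)) +
     P * (C * (C * g - S * h) + (Q ^+ 2 - C ^+ 2) * g)).
    by rewrite /N; ring.
  rewrite E1 E2 mulr1 -expr2 -H3 H4 /N; ring.
rewrite -/N; clearbody N.
transitivity ((Q * (- S * X * h - c ^+ 2 * h ^+ 2 + N * g) - C * S * P * h) / (2 * h * Q * N)).
  by field; rewrite h0 !gt_eqF.
by rewrite K; field; rewrite h0 !gt_eqF.
Qed.

Lemma sin_half_neq0 t s : `|t| < al -> `|s| <= al -> s != t -> sin ((t - s) / 2) != 0.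
Proof.
move=> tal sal st; have alp := al_ltpi c01.
have ts : `|t - s| < 2 * pi.
  apply: le_lt_trans (ler_normB _ _) _; move: tal sal alp.
  by move: `|t| `|s| => x y; clear; lra.
have ts0 : 0 < `|t - s| by rewrite normr_gt0 subr_eq0 eq_sym.
suff : 0 < sin (`|t - s| / 2).
  by have [|] := ger0P (t - s) => _; [rewrite lt0r => /andP[]|rewrite mulNr sinN oppr_gt0 lt_neqAle => /andP[]].
by apply: sin_gt0_pi; rewrite divr_gt0//= ltr_pdivrMr// mulrC.
Qed.

Lemma continuous_atanpart : continuous atanpart.
Proof.
move=> s; apply: (@cvgM _ _ _ _ (cst 4)); first exact: cvg_cst.
apply: (@continuous_comp _ _ _ (fun s => sin (s / 2) / (b + q s)) (@atan R)); last first.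
  exact: continuous_atan.
apply: cvgM; first exact: continuous_sin_half.
apply: cvgV; first by rewrite gt_eqF// ltr_wpDr ?qroot_ge0// b_gt0.
by apply: cvgD; [exact: cvg_cst|exact: continuous_qroot].
Qed.

Lemma continuous_shift_half (g : R -> R) t : continuous g ->
  continuous (fun s => g ((t - s) / 2)).
Proof.
move=> cg s; apply: (@continuous_comp _ _ _ (fun s : R => (t - s) / 2) g); last exact: cg.
by apply: cvgM; [apply: cvgB; [exact: cvg_cst|exact: cvg_id]|exact: cvg_cst].
Qed.

Lemma continuous_lognum t : continuous (lognum t).
Proof.
move=> s; apply: cvgD.
  apply: cvgB.
    by apply: cvgM; [exact: continuous_cos_half|exact: cvg_cst].
  apply: cvgM; first exact: cvg_cst.
  exact: continuous_shift_half (@continuous_cos R) s.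
by apply: cvgM; [exact: continuous_qroot|exact: cvg_cst].
Qed.

Lemma continuous_ln_lognum t s : `|t| < al -> `|s| <= al ->
  {for s, continuous (fun s => ln (lognum t s))}.
Proof.
move=> tal sal; apply: (@continuous_comp _ _ _ (lognum t) (@ln R)).
  exact: continuous_lognum.
by apply: continuous_ln; exact: lognum_gt0.
Qed.

Lemma continuous_logpart t s : `|t| < al -> `|s| <= al -> s != t ->
  {for s, continuous (logpart t)}.
Proof.
move=> tal sal st; apply: cvgB; first exact: continuous_ln_lognum.
apply: cvgM; first exact: cvg_cst.
apply: (@continuous_comp _ _ _ (fun s => sin ((t - s) / 2) ^+ 2) (@ln R)).
  have h := @continuous_shift_half _ t (@continuous_sin R) s.
  exact: (cvgM h h).
by apply: continuous_ln; rewrite exprn_even_gt0//= sin_half_neq0.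
Qed.

(** At an end q(s) = 0, cos(s/2) = c and sin^2(s/2) = b^2, so [lognum] reduces to - c sin(s/2)
    sin((t - s)/2), and its dependence on t cancels against the second logarithm. *)
Lemma logpart_end t s : `|t| < al -> `|s| = al -> logpart t s = 2^-1 * ln ((c * b) ^+ 2).
Proof.
move=> tal sal; have sal' : `|s| <= al by rewrite sal.
have N0 := lognum_gt0 tal sal'; rewrite /logpart.
have C : cos (s / 2) = c by rewrite -cos_half_norm sal cos_half_al.
have b2 := b_sqr c01.
have S2 : sin (s / 2) ^+ 2 = b ^+ 2 by rewrite b2 sin2cos2 C.
have q0 : q s = 0 by apply: qroot_eq0; rewrite ?sal// ltW// al_ltpi.
have NE : lognum t s = - (c * sin (s / 2) * sin ((t - s) / 2)).
  rewrite /lognum q0 mul0r addr0 mulrBl cosB sinB C.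
  transitivity (c * (cos (t / 2) * (1 - c ^+ 2) - c * sin (t / 2) * sin (s / 2))); first ring.
  by rewrite -b2 -S2; ring.
have N2 : lognum t s ^+ 2 = (c * b) ^+ 2 * sin ((t - s) / 2) ^+ 2.
  by rewrite NE exprMn -S2; ring.
have cb0 : 0 < (c * b) ^+ 2 by rewrite exprn_gt0// mulr_gt0// b_gt0.
have s0 : 0 < sin ((t - s) / 2) ^+ 2.
  by rewrite -(pmulr_rgt0 _ cb0) -N2 exprn_gt0.
have -> : ln (lognum t s) = 2^-1 * ln (lognum t s ^+ 2).
  by rewrite lnXn// mulr2n; field.
by rewrite N2 lnM ?posrE// mulrDr addrK.
Qed.

Lemma atanpart_al : atanpart al = pi.
Proof.
rewrite /atanpart qroot_eq0//; first last.
- by rewrite gtr0_norm ?(ltW (al_ltpi _))// al_gt0.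
- exact: ler_norm.
rewrite [2 * _]mulrC mulfK// sin_acos; last first.
  by case/andP: c01 => c0 c1; rewrite (ltW c1) (le_trans _ (ltW c0))// oppr_le0.
by rewrite addr0 divff ?gt_eqF ?b_gt0// atan1; field.
Qed.

Lemma atanpartN s : atanpart (- s) = - atanpart s.
Proof. by rewrite /atanpart /qroot !mulNr sinN cosN mulNr atanN mulrN. Qed.

Definition hilbert_primitive t s := atanpart s - 2 * sin (t / 2) / q t * logpart t s.

Lemma is_derive_hilbert_primitive t s : `|t| < al -> `|s| < al -> s != t ->
  is_derive s 1 (hilbert_primitive t) (- sin (s / 2) / q s * cot ((t - s) / 2)).
Proof.
move=> tal sal st; have S0 := sin_half_neq0 tal (ltW sal) st.
have q0 := qroot_gt0 c01 sal; have p0 := qroot_gt0 c01 tal.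
have D := is_deriveB (is_derive_atanpart sal) (is_deriveZ (2 * sin (t / 2) / q t) (is_derive_logpart tal sal S0)).
apply: is_derive_eq D _; rewrite /GRing.scale/= /cot.
(* This splits the integrand into the part cos(s/2) / q(s), regular at s = t, and the singular part
   - sin(t/2) / (q(s) sin((t - s)/2)). *)
have -> : sin (t / 2) = sin (s / 2) * cos ((t - s) / 2) + cos (s / 2) * sin ((t - s) / 2).
  by rewrite -sinD; congr sin; field.
by field; rewrite S0 !gt_eqF.
Qed.

Lemma continuous_hilbert_primitive t s : `|t| < al -> `|s| <= al -> s != t ->
  {for s, continuous (hilbert_primitive t)}.
Proof.
move=> tal sal st; apply: cvgB; first exact: continuous_atanpart.
by apply: cvgM; [exact: cvg_cst|exact: continuous_logpart].
Qed.

Lemma hilbert_primitive_ends t : `|t| < al ->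
  hilbert_primitive t al - hilbert_primitive t (- al) = 2 * pi.
Proof.
move=> tal; have a0 := al_gt0 c01.
rewrite /hilbert_primitive (logpart_end tal (gtr0_norm a0)).
rewrite (@logpart_end t (- al)) //; last by rewrite normrN gtr0_norm.
rewrite atanpartN atanpart_al.
by move: (_ / _ * _) => x; ring.
Qed.

End Primitive.

(** * The L^1 norm of the extremal function *)

Section ExtremalIntegral.
Variables (R : realType) (c : R).
Hypothesis c01 : 0 < c < 1.
Implicit Types s t : R.
Local Notation mu := (@lebesgue_measure R).
Local Notation I := (`[- @pi R, @pi R]%classic).
Local Notation al := (2 * acos c).
Local Notation q := (qroot c).
Local Notation F := (fun s : R => extremal c (cis s)).

Let c_gt0 : 0 < c. Proof. by case/andP: c01. Qed.

Lemma measurable_extremal : measurable_fun setT F.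
Proof.
apply: measurable_funM.
  by apply: continuous_measurable_fun => s; apply: cvgN; exact: continuous_sin.
apply: (measurableT_comp (@measurable_inv R)).
apply: continuous_measurable_fun => s.
apply: (@continuous_comp _ _ _ (fun s => (1 + cos s) * (1 + cos s - 2 * c ^+ 2)) Num.sqrt); last first.
  exact: sqrt_continuous.
have h : cos x @[x --> s] --> cos s by exact: continuous_cos.
apply: cvgM; first by apply: cvgD => //; exact: cvg_cst.
by apply: cvgB; [apply: cvgD => //; exact: cvg_cst|exact: cvg_cst].
Qed.

Lemma extremal_eq0 s : al <= `|s| -> `|s| <= pi -> F s = 0.
Proof. by move=> h1 h2 /=; rewrite extremal_cis// qroot_eq0// invr0 mulr0. Qed.

Lemma extremal0 : F 0 = 0.
Proof. by rewrite /= extremal_cis ?normr0 ?pi_ge0// mul0r sin0 oppr0 mul0r. Qed.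

Lemma lnpart_end s : `|s| = al -> lnpart c s = ln c.
Proof.
move=> sal; rewrite /lnpart -cos_half_norm sal cos_half_al// qroot_eq0 ?addr0//.
  by rewrite sal.
by rewrite sal ltW// al_ltpi.
Qed.

Lemma lntermE : lnterm c = lnpart c 0 - ln c.
Proof.
have b0 := b_gt0 c01; have b2 := b_sqr c01.
rewrite /lnpart /qroot mul0r cos0 expr1n -ln_div ?posrE ?addr_gt0//.
rewrite /lnterm mulrDl; congr (ln (_ + _)).
rewrite -[RHS]ger0_norm ?divr_ge0 ?(ltW b0) ?(ltW c_gt0)// -sqrtr_sqr.
by rewrite expr_div_n b2; congr Num.sqrt; field; rewrite gt_eqF.
Qed.

Lemma continuous_primitive_quot s : `|s| < al ->
  {for s, continuous (fun s => - sin (s / 2) / q s)}.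
Proof.
move=> sal; apply: cvgM; first by apply: cvgN; exact: continuous_sin_half.
by apply: cvgV; [rewrite gt_eqF// qroot_gt0|exact: continuous_qroot].
Qed.

(** k will be 1 or -1, the sign of the function on one half of the arc, where it is unbounded near
    the end. *)
Lemma integral_extremal_half (k a b : R) : a < b -> - al <= a -> b <= al ->
  (forall s, a < s < b -> `|F s| = k * F s) ->
  (\int[mu]_(s in `]a, b[) `|F s|%:E = (2 * k * (lnpart c b - lnpart c a))%:E)%E.
Proof.
move=> ab ale ble Fk; have alp := al_ltpi c01.
have sal s : s \in `]a, b[ -> `|s| < al.
  by rewrite in_itv/= => /andP[h1 h2]; rewrite ltr_norml (le_lt_trans ale) ?(lt_le_trans h2).
have FE s : s \in `]a, b[ -> `|F s| = k * (- sin (s / 2) / q s).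
  move=> si; have h := sal s si; rewrite Fk; last by move: si; rewrite in_itv.
  by rewrite /= extremal_cis// (le_trans (ltW h))// ltW.
transitivity (\int[mu]_(s in `]a, b[) (k * (- sin (s / 2) / q s))%:E)%E.
  by apply: eq_integral => s; rewrite inE => /= si; rewrite FE.
rewrite mulrBr; pose G s := 2 * k * lnpart c s.
have cG s : `|s| <= al -> {for s, continuous G}.
  by move=> h; apply: cvgM; [exact: cvg_cst|exact: continuous_lnpart].
apply: (@ge0_FTC_open _ _ G) => //.
- move=> s /sal h; apply: cvgM; first exact: cvg_cst.
  exact: continuous_primitive_quot.
- move=> s /sal h; apply: is_derive_eq (is_deriveZ (2 * k) (is_derive_lnpart c01 h)) _.
  by rewrite /GRing.scale/=; field; rewrite gt_eqF// qroot_gt0.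
- by move=> s si; rewrite -FE.
- by apply: cG; rewrite ler_norml ale (le_trans (ltW ab)).
- by apply: cG; rewrite ler_norml ble (le_trans ale (ltW ab)).
Qed.

Lemma integral_extremal : (\int[mu]_(s in I) `|F s|%:E = (4 * lnterm c)%:E)%E.
Proof.
have a0 := al_gt0 c01; have alp := al_ltpi c01.
pose U := `]- al, 0[%classic `|` `]0, al[%classic : set R.
transitivity (\int[mu]_(s in U) `|F s|%:E)%E.
  rewrite [LHS]integral_mkcond [RHS]integral_mkcond; congr integral.
  apply/funext => s; rewrite !patchE.
  case: ifPn => [|] sI; case: ifPn => // sU; last first.
    move: sI sU; rewrite inE notin_setE /U/= !in_itv/= => sI sU; case: sI.
    by case: sU => /andP[h1 h2]; apply/andP; split; move: h1 h2 a0 alp; clear; lra.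
  move: sI sU; rewrite inE notin_setE /U/= !in_itv/= => sI sU.
  have [->|s0] := eqVneq s 0; first by rewrite extremal0 normr0.
  rewrite extremal_eq0 ?normr0 ?ler_norml//.
  rewrite leNgt; apply/negP; rewrite ltr_norml => /andP[h1 h2]; apply: sU.
  by move: s0; rewrite neq_lt => /orP[] h; [left|right]; rewrite h ?h1 ?h2.
rewrite ge0_integral_setU//=; last first.
- rewrite /disj_set; apply/eqP/seteqP; split=> // s [] /=; rewrite !in_itv/=.
  by move=> /andP[_ h1] /andP[h2 _]; have := lt_trans h1 h2; rewrite ltxx.
- apply: measurable_funTS; apply/measurable_EFinP.
  by apply: measurableT_comp => //; exact: measurable_extremal.
rewrite (@integral_extremal_half 1)//; last first.
- move=> s /andP[h1 h2]; have h : `|s| < al by rewrite ltr_norml h1 (lt_trans h2).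
  rewrite mul1r ger0_norm//= extremal_cis; last by rewrite (le_trans (ltW h))// ltW.
  rewrite divr_ge0 ?qroot_ge0// -sinN -mulNr sin_ge0_pi//.
  by apply/andP; split; move: h1 h2 a0 alp; clear; lra.
- exact: ltW.
- by rewrite oppr_lt0.
rewrite (@integral_extremal_half (- 1))//; last first.
- move=> s /andP[h1 h2]; have h : `|s| < al by rewrite ltr_norml (lt_trans _ h1) ?oppr_lt0.
  rewrite mulN1r ler0_norm//= extremal_cis; last by rewrite (le_trans (ltW h))// ltW.
  rewrite mulNr oppr_le0 divr_ge0 ?qroot_ge0// sin_ge0_pi//.
  by apply/andP; split; move: h1 h2 a0 alp; clear; lra.
- by rewrite oppr_le0 ltW.
have eal : lnpart c al = ln c by rewrite lnpart_end ?gtr0_norm.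
have eNal : lnpart c (- al) = ln c by rewrite lnpart_end ?normrN ?gtr0_norm.
by rewrite lntermE eal eNal -EFinD; congr EFin; ring.
Qed.

Lemma extremal_inL1 : inL1 (extremal c).
Proof.
apply/integrableP; split.
  by apply: measurable_funTS; apply/measurable_EFinP; exact: measurable_extremal.
by have -> := integral_extremal; rewrite ltry.
Qed.

Lemma norm1_extremal : norm1 (extremal c) = (2 * pi)^-1 * (4 * lnterm c).
Proof. by rewrite /norm1 /Rintegral integral_extremal. Qed.

End ExtremalIntegral.

(** * Truncated Hilbert transforms of the extremal function *)

Section PrincipalValue.
Variables (R : realType) (c : R).
Hypothesis c01 : 0 < c < 1.
Implicit Types s t : R.
Local Notation mu := (@lebesgue_measure R).
Local Notation I := (`[- @pi R, @pi R]%classic).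
Local Notation al := (2 * acos c).
Local Notation q := (qroot c).
Local Notation ker t := (fun s : R => - sin (s / 2) / q s * cot ((t - s) / 2)).

Lemma ltr_cos_2pi (x y : R) : 0 < x -> x < pi -> 0 <= y -> y < 2 * pi - x ->
  (cos y < cos x) = (x < y).
Proof.
move=> x0 xp y0 yx; have [yp|yp] := leP y pi.
  by rewrite ltr_cos// in_itv/= ?y0 ?yp// (ltW x0) ltW.
have -> : cos y = cos (2 * pi - y).
  by rewrite -[LHS]cosN -(cosD2pi (- y)); congr cos; rewrite mulr2n; ring.
have -> : x < y by exact: lt_trans yp.
rewrite ltr_cos ?in_itv/= ?(ltW x0) ?(ltW xp)//; first by move: yx; clear; lra.
by apply/andP; split; move: yx yp x0; clear; lra.
Qed.

Lemma integrable_bndo_bndc (a : itv_bound R) (r : R) (f : R -> R) :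
  mu.-integrable [set` Interval a (BLeft r)] (EFin \o f) ->
  mu.-integrable [set` Interval a (BRight r)] (EFin \o f).
Proof.
move=> /integrableP[mf fi]; apply/integrableP; split.
  exact/emeasurable_fun_itv_bndo_bndcP.
by rewrite -integral_itv_bndo_bndc//; exact: measurableT_comp.
Qed.

Lemma integrable_obnd_cbnd (r : R) (b : itv_bound R) (f : R -> R) :
  mu.-integrable [set` Interval (BRight r) b] (EFin \o f) ->
  mu.-integrable [set` Interval (BLeft r) b] (EFin \o f).
Proof.
move=> /integrableP[mf fi]; apply/integrableP; split.
  exact/emeasurable_fun_itv_obnd_cbndP.
by rewrite -integral_itv_obnd_cbnd//; exact: measurableT_comp.
Qed.

(** d is the angle subtended by the chord e; the bound 2 pi - d excludes points close to t only
    after wrapping around the circle. *)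
Lemma chord_gt t s (d e : R) : 0 <= e -> 0 < d -> d < pi -> `|t - s| < 2 * pi - d ->
  e ^+ 2 = 2 * (1 - cos d) -> (e < chord (cis t) (cis s)) = (d < `|t - s|).
Proof.
move=> e0 d0 dp ts E; rewrite lt_chord// E ltr_pM2l// ltrD2l ltrN2.
have -> : cos (t - s) = cos `|t - s| by have [|] := ger0P (t - s) => _ //; rewrite cosN.
by rewrite ltr_cos_2pi.
Qed.

Lemma continuous_ker t s : `|t| < al -> `|s| < al -> s != t ->
  {for s, continuous (ker t)}.
Proof.
move=> tal sal st; apply: cvgM.
  exact: continuous_primitive_quot.
rewrite (_ : (fun s => cot ((t - s) / 2)) = (fun s => cos ((t - s) / 2) / sin ((t - s) / 2)))//.
apply: cvgM; first exact: (@continuous_shift_half _ _ t (@continuous_cos R)).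
apply: cvgV; first by apply: (sin_half_neq0 c01) => //; exact: ltW.
exact: (@continuous_shift_half _ _ t (@continuous_sin R)).
Qed.

Lemma ker_integral t (a b : R) : `|t| < al -> a < b -> - al <= a -> b <= al ->
  ~~ (a <= t <= b) -> mu.-integrable `[a, b] (EFin \o ker t) ->
  \int[mu]_(s in `[a, b]) ker t s = hilbert_primitive c t b - hilbert_primitive c t a.
Proof.
move=> tal ab ale ble tab ki.
have sal s : s \in `]a, b[ -> `|s| < al /\ s != t.
  rewrite in_itv/= => /andP[h1 h2]; split.
    by rewrite ltr_norml (le_lt_trans ale) ?(lt_le_trans h2).
  by apply: contraNneq tab => <-; rewrite !ltW.
apply: (@FTC_open _ _ (hilbert_primitive c t) _ _ ab ki).
- by move=> s /sal[h1 h2]; exact: continuous_ker.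
- by move=> s /sal[h1 h2]; exact: is_derive_hilbert_primitive.
- apply: continuous_hilbert_primitive => //.
    by rewrite ler_norml ale (le_trans (ltW ab)).
  by apply: contraNneq tab => <-; rewrite lexx ltW.
- apply: continuous_hilbert_primitive => //.
    by rewrite ler_norml ble (le_trans ale (ltW ab)).
  by apply: contraNneq tab => <-; rewrite lexx ltW.
Qed.

(** The bound d < al - |t| keeps the excised arc inside the support, and d < 2 (pi - al) prevents
    wrapping, as |t - s| < 2 al there. The primitive gains 2 pi between the ends of the arc, which
    yields the 1. *)
Lemma hilbert_trunc_extremal t (d e : R) : `|t| < al ->
  0 < e -> e ^+ 2 = 2 * (1 - cos d) -> 0 < d -> d < al - `|t| -> d < 2 * (pi - al) ->
  hilbert_trunc (extremal c) t e = 1 + (2 * pi)^-1 *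
    (hilbert_primitive c t (t - d) - hilbert_primitive c t (t + d)).
Proof.
move=> tal e0 E d0 d1 d2; have a0 := al_gt0 c01; have alp := al_ltpi c01.
have /andP[ta at'] : - al < t - d < al.
  by apply/andP; split; move: (ler_norm t) (ler_norm (- t)) d0 d1; rewrite normrN; clear; lra.
have /andP[tb bt'] : - al < t + d < al.
  by apply/andP; split; move: (ler_norm t) (ler_norm (- t)) d0 d1; rewrite normrN; clear; lra.
pose U := `[- al, t - d[%classic `|` `]t + d, al]%classic : set R.
have ts_lt s : `|s| <= al -> `|t - s| < 2 * pi - d.
  move=> sal; apply: le_lt_trans (ler_normB _ _) _; move: tal sal d2.
  by move: `|t| `|s| => x y; clear; lra.
have dpi : d < pi.
  by move: d1 alp (normr_ge0 t); clear; lra.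
set S := [set s : R | s \in `[- pi, pi] /\ e < chord (cis t) (cis s)].
have US : U `<=` S.
  move=> s Us; have sal : `|s| <= al.
    by rewrite ler_norml; case: Us; rewrite /= in_itv/= => /andP[h1 h2]; apply/andP; split; move: h1 h2 ta tb at' bt' d0; clear; lra.
  split; first by rewrite in_itv/= -ler_norml (le_trans sal)// ltW.
  rewrite (chord_gt (ltW e0) d0 dpi (ts_lt _ sal) E).
  by case: Us; rewrite /= in_itv/= => /andP[h1 h2]; rewrite lter_normr; apply/orP; [left|right]; move: h1 h2; clear; lra.
have Ui : mu.-integrable U (EFin \o (fun s => extremal c (cis s) * cot ((t - s) / 2))).
  apply: (@integrableS _ _ _ mu S) => //; last exact: integrable_hilbert_trunc (extremal_inL1 c01) e0.
  - exact: measurable_chord_gt (ltW e0).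
  - by apply: measurableU; exact: measurable_itv.
rewrite /hilbert_trunc -/S.
have -> : \int[mu]_(s in S) (extremal c (cis s) * cot ((t - s) / 2)) =
          \int[mu]_(s in U) (extremal c (cis s) * cot ((t - s) / 2)).
  rewrite [LHS]Rintegral_mkcond [RHS]Rintegral_mkcond; congr Rintegral.
  apply/funext => s; rewrite !patchE.
  case: ifPn => [|] sS; case: ifPn => // sU; last first.
    by move: sS sU; rewrite inE notin_setE => sS /US.
  move: sS sU; rewrite inE notin_setE => -[sI sc] sU.
  have [sal|sal] := leP `|s| al; last first.
    by rewrite extremal_eq0 ?mul0r ?(ltW sal)// ler_norml; move: sI; rewrite in_itv.
  case: sU; move: sc; rewrite (chord_gt (ltW e0) d0 dpi (ts_lt _ sal) E).
  move: sal; rewrite ler_norml lter_normr /U/= !in_itv/= => /andP[h1 h2] /orP[] h; [left|right]; apply/andP; split => //; move: h; clear; lra.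
have UE s : U s -> extremal c (cis s) * cot ((t - s) / 2) = ker t s.
  by move=> /US[sI _]; rewrite extremal_cis// ler_norml; move: sI; rewrite in_itv.
have ki : mu.-integrable U (EFin \o ker t).
  apply: eq_integrable Ui => [|s]; first by apply: measurableU; exact: measurable_itv.
  by rewrite inE => /UE /= ->.
rewrite (@eq_Rintegral _ _ _ mu U (ker t)); last by move=> s; rewrite inE => /UE.
rewrite Rintegral_setU//; last first.
  rewrite /disj_set; apply/eqP/seteqP; split=> // s [] /=; rewrite !in_itv/=.
  by move=> /andP[_ h1] /andP[h2 _]; move: h1 h2 d0; clear; lra.
have ki1 : mu.-integrable `[- al, t - d[ (EFin \o ker t).
  by apply: (@integrableS _ _ _ mu U) ki => //; [exact: measurableU|left].
have ki2 : mu.-integrable `]t + d, al] (EFin \o ker t).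
  by apply: (@integrableS _ _ _ mu U) ki => //; [exact: measurableU|right].
rewrite (Rintegral_itv_bndo_bndc ki1) (Rintegral_itv_obnd_cbnd ki2).
rewrite ker_integral//; last exact: integrable_bndo_bndc.
- rewrite ker_integral//; last exact: integrable_obnd_cbnd.
  + have H := hilbert_primitive_ends c01 tal.
    rewrite (_ : _ - _ + _ = 2 * pi + (hilbert_primitive c t (t - d) - hilbert_primitive c t (t + d))).
      by rewrite mulrDr mulVf// gt_eqF// mulr_gt0// pi_gt0.
    by rewrite -H; ring.
  + exact: ltW.
  + by rewrite negb_and -!ltNge ltrDl d0.
- exact: ltW.
- by rewrite negb_and -!ltNge ltrBlDr ltrDl d0 orbT.
Qed.

End PrincipalValue.

(** * Optimality of the constant *)

Section Sharpness.
Variable R : realType.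
Implicit Types c s t : R.
Local Notation mu := (@lebesgue_measure R).
Local Notation al c := (2 * acos c).

(** The excised arc is symmetric about t, so the terms ln sin^2((t - s)/2) at its two ends are equal
    and cancel. What remains of the primitive is continuous at t, and its increment across the arc
    tends to 0. *)
Lemma is_hilbert_extremal c t : 0 < c < 1 -> `|t| < al c ->
  is_hilbert (extremal c) (cis t) 1.
Proof.
move=> c01 tal; exists t => //.
(* The angle subtended by a chord of length e. *)
pose dl (e : R) := 2 * asin (e / 2).
have dl0 : dl 0 = 0.
  rewrite /dl mul0r.
  have := @acosE R 0; rewrite lexx ler01 acos0 => /(_ isT).
  by set p := pi / 2; lra.
have cdl : {for 0, continuous dl}.
  apply: (@cvgM _ _ _ _ (cst 2)); first exact: cvg_cst.
  apply: (@continuous_comp _ _ _ (fun e : R => e / 2) (@asin R)).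
    by apply: cvgM; [exact: cvg_id|exact: cvg_cst].
  by apply: continuous_asin; rewrite mul0r oppr_lt0 ltr01.
pose k := 2 * sin (t / 2) / qroot c t.
pose Psi (g : R -> R) d := g (t - d) - g (t + d).
have cPsi (g : R -> R) : {for t, continuous g} -> Psi g (dl e) @[e --> 0^'+] --> (0 : R).
  move=> cg.
  rewrite [X in _ --> X](_ : 0 = g t - g t); last by rewrite subrr.
  have cd : dl e @[e --> 0^'+] --> (0 : R).
    by apply: cvg_at_right_filter; rewrite -[X in _ --> X]dl0; exact: cdl.
  apply: cvgB.
    apply: (@cvg_comp _ _ _ (fun e => t - dl e) g _ (nbhs t)) => //.
    have : t - dl e @[e --> 0^'+] --> t - 0 by apply: cvgB => //; exact: cvg_cst.
    by rewrite subr0.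
  apply: (@cvg_comp _ _ _ (fun e => t + dl e) g _ (nbhs t)) => //.
  have : t + dl e @[e --> 0^'+] --> t + 0 by apply: cvgD => //; exact: cvg_cst.
  by rewrite addr0.
have HP : 1 + (2 * pi)^-1 * (Psi (atanpart c) (dl e) - k * Psi (fun s => ln (lognum c t s)) (dl e))
    @[e --> 0^'+] --> (1 : R).
  rewrite [X in _ --> X](_ : 1 = 1 + (2 * pi)^-1 * (0 - k * 0)); last by rewrite mulr0 subr0 mulr0 addr0.
  apply: cvgD; first exact: cvg_cst.
  apply: cvgM; first exact: cvg_cst.
  apply: cvgB; first by apply: cPsi; exact: continuous_atanpart.
  apply: cvgM; first exact: cvg_cst.
  by apply: cPsi; apply: continuous_ln_lognum => //; exact: ltW.
apply: cvg_trans HP; apply: near_eq_cvg.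
have m0 : 0 < Num.min (al c - `|t|) (2 * (pi - al c)).
  by rewrite lt_min subr_gt0 tal/= mulr_gt0// subr_gt0 al_ltpi.
have Hd : \forall e \near 0^'+, `|dl e| < Num.min (al c - `|t|) (2 * (pi - al c)).
  have : dl e @[e --> 0^'+] --> (0 : R).
    by apply: cvg_at_right_filter; rewrite -[X in _ --> X]dl0; exact: cdl.
  by move=> /cvgr0Pnorm_lt; apply.
near=> e.
have e0 : 0 < e by near: e; exact: nbhs_right_gt.
have e1 : e < 1 by near: e; exact: nbhs_right_lt.
have e2 : -1 <= e / 2 <= 1 by apply/andP; split; move: e0 e1; clear; lra.
have : `|dl e| < Num.min (al c - `|t|) (2 * (pi - al c)) by near: e.
have d0 : 0 < dl e.
  rewrite mulr_gt0// -ltr_sin ?in_itv/= ?asin_geNpi2 ?asin_lepi2//.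
    by rewrite sin0 asinK ?in_itv// divr_gt0.
  by rewrite oppr_le0 divr_ge0 ?pi_ge0.
rewrite (gtr0_norm d0) lt_min => /andP[d1 d2].
have E : e ^+ 2 = 2 * (1 - cos (dl e)).
  rewrite cos_half_sqr /dl [2 * asin _]mulrC mulfK// asinK ?in_itv//.
  by field.
rewrite (hilbert_trunc_extremal c01 tal e0 E d0 d1 d2).
congr (1 + _ * _); rewrite /Psi /hilbert_primitive -/k /logpart.
have -> : sin ((t - (t - dl e)) / 2) ^+ 2 = sin ((t - (t + dl e)) / 2) ^+ 2.
  rewrite (_ : t - (t - dl e) = dl e); last by ring.
  by rewrite (_ : t - (t + dl e) = - dl e); [rewrite mulNr sinN sqrrN|ring].
by ring.
Unshelve. all: by end_near.
Qed.

Lemma arc_length_extremal c : 0 < c < 1 ->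
  ((2 * al c)%:E <= arc_length (hilbert_ge1 (extremal c)))%E.
Proof.
move=> c01; have a0 := al_gt0 c01; have alp := al_ltpi c01.
apply: (@le_trans _ _ (mu `]- al c, al c[)).
  rewrite le_eqVlt; apply/orP; left; apply/eqP/esym; apply: etrans (lebesgue_measure_itv `]- al c, al c[) _.
  by rewrite /= lte_fin gtrN// -EFinD; congr EFin; ring.
apply: le_lebesgue_outer => t /=; rewrite !in_itv/= => /andP[h1 h2]; split.
  by apply/andP; split; move: h1 h2 alp; clear; lra.
exists 1; last exact: lexx.
by apply: is_hilbert_extremal => //; rewrite ltr_norml h1.
Qed.

Lemma D_at1 : D (1 : R) = 0.
Proof.
rewrite /D expr1n divr1 subrr sqrtr0 addr0 ln1 mulr0 subr0.
have := @acosE R 1; rewrite ler01 lexx acos1 => /(_ isT) h.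
have -> : asin (1 : R) = pi / 2 by move: h; set p := pi / 2; lra.
have H (p : R) : p != 0 -> 1 - 2 / p * (p / 2) = 0 by move=> p0; field.
by rewrite H// gt_eqF// pi_gt0.
Qed.

(** For c < 1 the normalized measure is at least (2/pi) arccos c, while c times the norm is (2 c /
    pi) [lnterm c]; the difference of the two is D(c). At c = 1 the arc degenerates and D(1) = 0. *)
Lemma hilbert_sharp c (K : R) : 0 < c -> c <= 1 -> K < D c ->
  exists2 f : circle R -> R, inL1 f &
    ((c * norm1 f + K)%:E < ((2 * pi)^-1)%:E * arc_length (hilbert_ge1 f))%E.
Proof.
move=> c0; have p2 := pi2_gt0 R; rewrite le_eqVlt => /predU1P[->|c1].
  rewrite D_at1 => K0; exists (cst 0); first exact: integrable0.
  apply: (@lt_le_trans _ _ 0%E).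
    rewrite /norm1 /=; under eq_Rintegral do rewrite normr0.
    by rewrite /Rintegral integral0 !mulr0 add0r lte_fin.
  apply: mule_ge0; first by rewrite lee_fin invr_ge0 ltW.
  exact: measure_ge0.
have c01 : 0 < c < 1 by rewrite c0.
move=> KD; exists (extremal c); first exact: extremal_inL1.
apply: (@lt_le_trans _ _ (((2 * pi)^-1)%:E * (2 * al c)%:E)%E); last first.
  by rewrite lee_wpmul2l ?arc_length_extremal// lee_fin invr_ge0 ltW.
rewrite -EFinM lte_fin norm1_extremal// acosE ?(ltW c0) ?(ltW c1)//.
move: KD; rewrite /D -/(lnterm c).
have p0 : (pi : R) != 0 by rewrite gt_eqF// pi_gt0.
suff H (p l a : R) : p != 0 -> K < 1 - 2 / p * a - 2 * c / p * l ->
    c * ((2 * p)^-1 * (4 * l)) + K < (2 * p)^-1 * (2 * (2 * (p / 2 - a))).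
  exact: H.
move=> p_neq0; rewrite -(ltrD2l (c * ((2 * p)^-1 * (4 * l)))).
by congr (_ < _); field.
Qed.

End Sharpness.

Theorem theorem1p1 (R : realType) (c : R) (c_gt0 : 0 < c) (c_le1 : c <= 1) :
  (forall f : circle R -> R, inL1 f ->
     (((2 * pi)^-1)%:E * arc_length (hilbert_ge1 f)
        <= (c * norm1 f + D c)%:E)%E) /\
  (forall K : R, K < D c ->
     exists2 f : circle R -> R, inL1 f &
       ((c * norm1 f + K)%:E
          < ((2 * pi)^-1)%:E * arc_length (hilbert_ge1 f))%E).
Proof.
split=> [f f1|K]; first exact: hilbert_upper_bound.
exact: hilbert_sharp.
Qed.
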